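(* Let $\mathcal D$ be the characteristic distribution of a parabolic Monge-Ampère equation $\mathcal E_\omega$. If $\mathcal D''$ is 4-dimensional, then $\mathcal E_\omega$ admits exactly one (up to a factor) nonholonomic intermediate integral $X\in\mathcal D$, which spans $(\mathcal D')^\perp$. Such an integral is classical if $\mathcal D''$ is integrable and genuinely nonholonomic (i.e. not classical) otherwise.
   Context: Everything is $C^\infty$ and local. $J^1(\tau)$ is the manifold of 1-jets of functions $z=z(x,y)$, with coordinates $(x,y,z,p,q)$, $p=z_x,q=z_y$; $U=dz-p\,dx-q\,dy$ and $\mathcal C=\{U=0\}$ is the contact distribution; $dU|_{\mathcal C}$ is symplectic and $\perp$ denotes the orthogonal complement inside $\mathcal C$ with respect to $dU$ of a subdistribution of $\mathcal C$. $X(T)$ is the Lie derivative of $T$ along $X$. For a distribution $\mathcal P$, $\mathcal P'=\mathcal P+[\mathcal P,\mathcal P]$; $\mathcal D''=(\mathcal D')'$. Regularity convention: $\mathcal D,\mathcal D',\mathcal D''$ have constant rank. Integrable means involutive. A Monge-Ampère equation is $N(z_{xx}z_{yy}-z_{xy}^2)+Az_{xx}+Bz_{xy}+Cz_{yy}+D=0$ with coefficients smooth functions on $J^1(\tau)$, nowhere simultaneously zero; it is parabolic if $B^2-4AC+4ND=0$ identically. It is then written $\mathcal E_\omega$ with $$\omega=D\,dx\wedge dy+\tfrac B2dx\wedge dp+C\,dx\wedge dq-A\,dy\wedge dp-\tfrac B2 dy\wedge dq+N\,dp\wedge dq,$$ whose restriction to $\mathcal C$ is degenerate; the characteristic distribution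 is the 2-dimensional lagrangian ($\mathcal D=\mathcal D^\perp$) distribution $\mathcal D=\mathrm{Rad}(\omega|_{\mathcal C})\subset\mathcal C$; one has $\mathcal D'\subset\mathcal C$. The type of a nowhere zero field $X\in\mathcal C$ is the rank, assumed constant, of $U,X(U),X^2(U),X^3(U)$. A nonholonomic intermediate integral of $\mathcal E_\omega$ is a type 2 vector field contained in $\mathcal D$. For $f\in C^\infty(J^1(\tau))$, $X_f$ is the unique field in $\mathcal C$ with $X_f\lrcorner dU=df+\lambda U$ for some function $\lambda$. A nonholonomic intermediate integral is called classical if it is a multiple of $X_f$ for some intermediate integral $f$ of $\mathcal E_\omega$, i.e. a function $f$ (with $df,U$ independent) such that every solution of the first order equations $f=k$, $k\in\mathbb R$, is a solution of $\mathcal E_\omega$ (solutions being 2-dimensional integral surfaces of $\mathcal C$, contained in $\{f=k\}$, respectively annihilating $\omega$). *)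

(* Defs.v *)
From HB Require Import structures.
From mathcomp Require Import all_boot all_order all_algebra.
From mathcomp Require Import all_classical all_reals all_analysis.
Import numFieldNormedType.Exports.

Import Order.TTheory GRing.Theory Num.Theory.
Local Open Scope classical_set_scope.
Local Open Scope ring_scope.

(* Fields and functions are total; their values are only used on the open set
   on which they are required to be smooth.  A 1-form is represented by its row
   of coefficients, a 2-form by its values on pairs of tangent vectors, and a
   distribution by its fibres. *)

Section Calculus.
Context {R : realType} {n : nat}.
Local Notation E := 'rV[R]_n.+1.

Definition partial {W : normedModType R} (i : 'I_n.+1) (f : E -> W) : E -> W :=
  fun a => 'D_(delta_mx 0 i) f a.

Fixpoint Ck (k : nat) (V : set E) {W : normedModType R} (f : E -> W) : Prop :=
  match k with
  | 0 => forall a, V a -> {for a, continuous f}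
  | k'.+1 => forall i : 'I_n.+1,
      (forall a, V a -> derivable f a (delta_mx 0 i)) /\
      Ck k' V (partial i f)
  end.

Definition smooth (V : set E) {W : normedModType R} (f : E -> W) : Prop :=
  forall k, Ck k V f.

Definition pairing (alpha v : E) : R := \sum_i alpha 0 i * v 0 i.

Definition wedge (alpha beta : E) (v w : E) : R :=
  pairing alpha v * pairing beta w - pairing alpha w * pairing beta v.

Definition dfun (f : E -> R) : E -> E := fun a => \row_i partial i f a.

(* d (\sum_j alpha_j dx_j) = \sum_j d alpha_j /\ dx_j *)
Definition dform (alpha : E -> E) : E -> E -> E -> R := fun a v w =>
  \sum_j wedge (dfun (fun b => alpha b 0 j) a) (delta_mx 0 j) v w.

Definition lie_form (X alpha : E -> E) : E -> E := fun a =>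
  \row_j \sum_i (X a 0 i * partial i (fun b => alpha b 0 j) a
                 + alpha a 0 i * partial j (fun b => X b 0 i) a).

Definition bracket (X Y : E -> E) : E -> E := fun a =>
  \row_j \sum_i (X a 0 i * partial i (fun b => Y b 0 j) a
                 - Y a 0 i * partial i (fun b => X b 0 j) a).

Definition linspan (S : set E) : set E :=
  [set v | exists2 s : seq E, (forall u, u \in s -> S u) & v \in span s].

Definition has_dim (S : set E) (k : nat) : Prop :=
  exists2 W : {vspace E}, \dim W = k & S = [set v | v \in W].

Definition constant_rank (V : set E) (P : E -> set E) : Prop :=
  exists k, forall a, V a -> has_dim (P a) k.

Definition is_section (V : set E) (P : E -> set E) (X : E -> E) : Prop :=
  smooth V X /\ forall a, V a -> P a (X a).

(* P + [P, P], computed with germs of sections *)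
Definition derived (P : E -> set E) : E -> set E := fun a =>
  linspan (P a `|` [set v | exists (V : set E) (X Y : E -> E),
    [/\ open V, V a, is_section V P X, is_section V P Y & v = bracket X Y a]]).

Definition is_involutive (V : set E) (P : E -> set E) : Prop :=
  forall (W : set E) (X Y : E -> E), open W -> W `<=` V ->
    is_section W P X -> is_section W P Y ->
    forall a, W a -> P a (bracket X Y a).

End Calculus.

Section Contact.
Context {R : realType}.
Local Notation J1 := 'rV[R]_5.

Definition jx : 'I_5 := @Ordinal 5 0 isT.
Definition jy : 'I_5 := @Ordinal 5 1 isT.
Definition jz : 'I_5 := @Ordinal 5 2 isT.
Definition jp : 'I_5 := @Ordinal 5 3 isT.
Definition jq : 'I_5 := @Ordinal 5 4 isT.

Definition dx : J1 := delta_mx 0 jx.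
Definition dy : J1 := delta_mx 0 jy.
Definition dz : J1 := delta_mx 0 jz.
Definition dp : J1 := delta_mx 0 jp.
Definition dq : J1 := delta_mx 0 jq.

Definition U : J1 -> J1 := fun a => dz - a 0 jp *: dx - a 0 jq *: dy.

Definition contact : J1 -> set J1 := fun a => [set v | pairing (U a) v = 0].

Definition orth (P : J1 -> set J1) : J1 -> set J1 := fun a =>
  [set v | contact a v /\ forall w, P a w -> dform U a v w = 0].

(* type k on V: U, X(U), X^2(U), X^3(U) have rank k at every point of V *)
Definition has_type (V : set J1) (X : J1 -> J1) (k : nat) : Prop :=
  [/\ smooth V X,
      forall a, V a -> X a != 0,
      forall a, V a -> contact a (X a) &
      forall a, V a ->
        \dim (span [seq iter m (lie_form X) U a | m <- iota 0 4]) = k].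

Definition is_hamiltonian (V : set J1) (f : J1 -> R) (X : J1 -> J1) : Prop :=
  [/\ smooth V X,
      forall a, V a -> contact a (X a) &
      exists2 lambda : J1 -> R, smooth V lambda &
        forall a, V a -> forall v,
          dform U a (X a) v = pairing (dfun f a) v + lambda a * pairing (U a) v].

End Contact.

Section MongeAmpere.
Context {R : realType}.
Local Notation J1 := 'rV[R]_5.

Definition monge_ampere (V : set J1) (N A B C D : J1 -> R) : Prop :=
  [/\ smooth V N, smooth V A,
      smooth V B, smooth V C &
      smooth V D] /\
  forall a, V a -> ~ [/\ N a = 0, A a = 0, B a = 0, C a = 0 & D a = 0].

Definition parabolic (V : set J1) (N A B C D : J1 -> R) : Prop :=
  forall a, V a -> B a ^+ 2 - 4 * A a * C a + 4 * N a * D a = 0.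

Definition ma_form (N A B C D : J1 -> R) : J1 -> J1 -> J1 -> R := fun a v w =>
  D a * wedge dx dy v w + B a / 2 * wedge dx dp v w
  + C a * wedge dx dq v w - A a * wedge dy dp v w
  - B a / 2 * wedge dy dq v w + N a * wedge dp dq v w.

Definition characteristic (omega : J1 -> J1 -> J1 -> R) : J1 -> set J1 :=
  fun a => [set v | contact a v /\ forall w, contact a w -> omega a v w = 0].

(* immersed surfaces phi : S -> V, S open in R^2, tangent to the contact
   distribution *)
Definition integral_surface (V : set J1) (S : set 'rV[R]_2)
    (phi : 'rV[R]_2 -> J1) : Prop :=
  [/\ open S, smooth S phi, forall s, S s -> V (phi s),
      forall s, S s -> free [seq partial i phi s | i <- enum 'I_2] &
      forall s i, S s -> contact (phi s) (partial i phi s)].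

Definition annihilates (omega : J1 -> J1 -> J1 -> R) (S : set 'rV[R]_2)
    (phi : 'rV[R]_2 -> J1) : Prop :=
  forall s i j, S s -> omega (phi s) (partial i phi s) (partial j phi s) = 0.

Definition intermediate_integral (omega : J1 -> J1 -> J1 -> R) (V : set J1)
    (f : J1 -> R) : Prop :=
  [/\ smooth V f,
      forall a, V a -> free [:: dfun f a; U a] &
      forall (k : R) (S : set 'rV[R]_2) (phi : 'rV[R]_2 -> J1),
        integral_surface V S phi -> (forall s, S s -> f (phi s) = k) ->
        annihilates omega S phi].

Definition nonholonomic_integral (omega : J1 -> J1 -> J1 -> R) (V : set J1)
    (X : J1 -> J1) : Prop :=
  has_type V X 2 /\ forall a, V a -> characteristic omega a (X a).

(* the integral f and the factor g are only required to exist locally *)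
Definition classical_integral (omega : J1 -> J1 -> J1 -> R) (V : set J1)
    (X : J1 -> J1) : Prop :=
  forall a, V a -> exists (W : set J1) (f : J1 -> R) (Xf : J1 -> J1)
      (g : J1 -> R),
    [/\ [/\ open W, W a & W `<=` V],
        intermediate_integral omega W f,
        is_hamiltonian W f Xf,
        smooth W g &
        forall b, W b -> X b = g b *: Xf b].

Definition spans (V : set J1) (X : J1 -> J1) (P : J1 -> set J1) : Prop :=
  forall a, V a -> P a = [set v | v \in <[X a]>%VS].

End MongeAmpere.

(* Main.v *)
Require Import Defs.
From HB Require Import structures.
From mathcomp Require Import all_boot all_order all_algebra.
From mathcomp Require Import all_classical all_reals all_analysis.
From mathcomp Require Import ring lra.
Import numFieldNormedType.Exports.
Import Order.TTheory GRing.Theory Num.Theory.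
Local Open Scope classical_set_scope.
Local Open Scope ring_scope.

(** Write [P] for the characteristic plane field, [P'] and [P''] for its successive
    derived distributions.

    Since the equation is parabolic, [P] is lagrangian in the contact distribution,
    and near each point it has a frame [(X1, X2)] ([characteristic_frame]).  A
    lagrangian plane is cut out by forms, so modulo [P] the bracket of two
    sections of [P] is a bilinear alternating function of their values
    ([bracket_modulo]); hence [P'] is spanned by [P] and the single bracket
    [Z = [X1, X2]], which lies in the contact distribution.  As [P''] is larger
    than [P], [Z] is nowhere in [P] ([frame_bracket_notin]), and some
    combination [X] of the frame is orthogonal to [Z] for [dU]
    ([adapted_frame]).  Completing it to a frame [(X, Y)], [P'] is the
    orthogonal of [X] in the contact distribution ([derived_orth]), so [X] spans
    the orthogonal of [P'] ([orth_derived]).  The bracket [T = [Y, Z]] is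
    transverse to the contact distribution, and because [P''] has dimension 4 it
    is [P' + <T>], the kernel of a 1-form [X _| dU + lambda U]
    ([derived2_kernel]); in particular [P''] meets the contact distribution in
    [P'].

    Existence: the bracket of [X] with a section of [P'] lies in [P''] and in the
    contact distribution, hence in [P'].  In terms of the pairing formula for Lie
    derivatives this says that [X^2(U)] and [X^3(U)] vanish on [P'], that is, are
    combinations of [U] and [X(U) = X _| dU]: the type of [X] is 2
    ([adapted_type2]).  Uniqueness: if [X' = c X + d Y] has type 2 then
    [X'^2(U)] vanishes on [X], and its value there is [d^2 dU(Y, Z)] up to sign, so
    [d = 0] ([type2_multiple]).

    If [P''] is involutive, its annihilator is locally [h df].  The function [f] is
    produced by Mayer's method ([mayer], [frobenius_hyperplane]): integrate
    along rays an ordinary differential equation depending on parameters.  This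
    rests on the existence of solutions ([picard]) and on their smooth dependence
    on the parameters ([ode_smooth]).  Then [X / h] is the field [X_f], and [f]
    is an intermediate integral: a solution of [f = k] has its tangent planes in
    [P'], where the form of the equation vanishes because [P] is contained in its
    kernel and has codimension 1 in [P'] ([ma_form_orth]).  Conversely, if [X] is
    a multiple of [X_f], then [df] kills [P'], hence the brackets of its
    sections, hence [P'']; being the kernel of [df], [P''] is involutive
    ([involutive_of_classical]). *)

Set Implicit Arguments.
Unset Strict Implicit.
Unset Printing Implicit Defensive.

(** * Calculus of functions that are k times continuously differentiable *)

Section MeanValue.
Context {R : realType}.
Implicit Types h : R -> R.

Lemma mean_value_le h (dh : R -> R) (a b L : R) : a <= b ->
  (forall t, a <= t <= b -> is_derive t 1 h (dh t)) ->
  (forall t, a <= t <= b -> `|dh t| <= L) -> `|h b - h a| <= L * (b - a).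
Proof.
move=> ab hd hL.
have [||c cab ->] := @MVT_segment R h dh a b ab.
- by move=> t; rewrite in_itv/= => /andP[ta tb]; apply: hd; rewrite !ltW.
- apply: derivable_within_continuous => t; rewrite in_itv/= => tab.
  by have [] := hd _ tab.
- rewrite in_itv/= in cab.
  rewrite normrM (ger0_norm (_ : 0 <= b - a)) ?subr_ge0//.
  by rewrite ler_wpM2r ?subr_ge0// hL.
Qed.

Lemma mean_value_norm h (dh : R -> R) (a b L : R) :
  (forall t, Num.min a b <= t <= Num.max a b -> is_derive t 1 h (dh t)) ->
  (forall t, Num.min a b <= t <= Num.max a b -> `|dh t| <= L) ->
  `|h b - h a| <= L * `|b - a|.
Proof.
case: (leP a b) => ab hd hL.
  by rewrite (ger0_norm (_ : 0 <= b - a)) ?subr_ge0//; exact: mean_value_le hd hL.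
rewrite distrC (distrC b a) (ger0_norm (_ : 0 <= a - b)); last by rewrite subr_ge0 ltW.
exact: mean_value_le (ltW ab) hd hL.
Qed.

End MeanValue.

Section Coordinates.
Context {R : realType} {n : nat}.
Local Notation E := 'rV[R]_n.+1.

Lemma coord_le (x : E) j : `|x 0 j| <= `|x|.
Proof.
rewrite [leRHS]/Num.Def.normr/= mx_normrE.
by apply: le_trans (le_bigmax _ _ (0, j)) => /=.
Qed.

Lemma coords_le (x : E) e : 0 <= e -> (forall j, `|x 0 j| <= e) -> `|x| <= e.
Proof.
move=> e0 H; rewrite [leLHS]/Num.Def.normr/= mx_normrE.
by apply: bigmax_le => // -[i j] _ /=; rewrite ord1.
Qed.

Lemma coords_lt (x : E) e : 0 < e -> (forall j, `|x 0 j| < e) -> `|x| < e.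
Proof.
move=> e0 H; rewrite [ltLHS]/Num.Def.normr/= mx_normrE.
by apply: bigmax_lt => // -[i j] _ /=; rewrite ord1.
Qed.

Lemma coord_delta (i j : 'I_n.+1) : (delta_mx 0 i : E) 0 j = (j == i)%:R.
Proof. by rewrite mxE eqxx. Qed.

Lemma nbhs_rVP (a : E) (P : set E) :
  nbhs a P <-> exists2 d, 0 < d & forall x, `|x - a| < d -> P x.
Proof.
split.
  move/nbhs_normP => [d d0 H]; exists d => // x xa; apply: H => /=.
  by rewrite /ball_/= distrC.
move=> [d d0 H]; apply/nbhs_ballP; exists d => // x /=.
by rewrite -ball_normE /ball_/= distrC; exact: H.
Qed.

Lemma open_norm (V : set E) (a : E) : open V -> V a ->
  exists2 d, 0 < d & forall x, `|x - a| < d -> V x.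
Proof. by move=> oV Va; apply/nbhs_rVP/open_nbhs_nbhs. Qed.

Lemma continuous_norm (f : E -> R) (a : E) : {for a, continuous f} ->
  forall e, 0 < e -> exists2 d, 0 < d & forall x, `|x - a| < d -> `|f x - f a| < e.
Proof.
move=> /cvgrPdist_lt H e e0; have /nbhs_rVP[d d0 {}H] := H _ e0.
by exists d => // x /H; rewrite distrC.
Qed.

End Coordinates.

Lemma continuous_at_sum {R : realType} {T : topologicalType}
    {V : normedModType R} (I : Type) (r : seq I) (f : I -> T -> V) (a : T) :
  (forall j, {for a, continuous (f j)}) ->
  {for a, continuous (fun x => \sum_(j <- r) f j x)}.
Proof.
move=> H; elim: r => [|j r IH].
  rewrite (_ : (fun x => _) = cst 0); first exact: cvg_cst.
  by apply/funext => x; rewrite big_nil.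
rewrite (_ : (fun x => _) = f j \+ (fun x => \sum_(j <- r) f j x)).
  exact: continuousD.
by apply/funext => x; rewrite big_cons.
Qed.

Section Lines.
Context {R : realType} {V W : normedModType R}.

Lemma is_derive_line (f : V -> W) (p e : V) (t : R) (df : W) :
  is_derive (p + t *: e) e f df <-> is_derive t 1 (fun s => f (p + s *: e)) df.
Proof.
have E : (fun h : R => h^-1 *: (f (h *: e + (p + t *: e)) - f (p + t *: e))) =
   (fun h : R => h^-1 *: ((fun s => f (p + s *: e)) (h *: 1 + t)
                          - (fun s => f (p + s *: e)) t)).
  by apply/funext => h /=; rewrite [h *: 1]mulr1 scalerDl addrCA.
by split=> -[d1 d2]; split; move: d1 d2; rewrite /derivable /derive E.
Qed.

End Lines.

Lemma differentiable_bound {R : realType} {V W : normedModType R} (f : V -> W)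
    (L : {linear V -> W}) (a : V) : continuous L ->
  (forall e : R, 0 < e ->
     \forall x \near (0 : V), `|f (x + a) - (f a + L x)| <= e * `|x|) ->
  differentiable f a.
Proof.
move=> Lc H.
have Ho : f \o shift a = cst (f a) + L +o_ 0 id.
  by apply/eqaddoP => e e0; apply: H.
by apply/diff_locallyP; rewrite (diff_unique Lc Ho); split.
Qed.

Section Strict.
Context {R : realType} {n : nat}.
Local Notation E := 'rV[R]_n.+1.
Implicit Types (f : E -> R) (V : set E).

Let hybrid (x y : E) (k : nat) : E := \row_j (if (j < k)%N then x 0 j else y 0 j).

(** A function with continuous partial derivatives is strictly differentiable:
    moving the coordinates one after the other reduces the claim to the mean
    value inequality on segments parallel to the axes. *)
Lemma C1_strict V f a : open V -> Ck 1 V f -> V a ->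
  forall e, 0 < e -> exists2 d, 0 < d &
    forall x y, `|x - a| < d -> `|y - a| < d ->
      `|f x - f y - \sum_j (x - y) 0 j * partial j f a| <= e * `|x - y|.
Proof.
move=> oV C1 Va e e0.
have [r r0 Vr] := open_norm oV Va.
pose e' := e / n.+1%:R.
have e'0 : 0 < e' by rewrite divr_gt0.
have cont j : exists2 d, 0 < d &
    forall x, `|x - a| < d -> `|partial j f x - partial j f a| < e'.
  by have [_ /(_ a Va) /continuous_norm] := C1 j; exact.
pose dd j := sval (cid2 (cont j)).
have dd0 j : 0 < dd j by rewrite /dd; case: cid2.
have ddP j x : `|x - a| < dd j -> `|partial j f x - partial j f a| < e'.
  by rewrite /dd; case: cid2 => d /= _; exact.
pose d := \big[Num.min/r]_j dd j.
exists d; first by apply: lt_bigmin.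
move=> x y xd yd.
have xr : `|x - a| < r by apply: lt_le_trans xd _; exact: bigmin_le_id.
have dle j : d <= dd j by exact: bigmin_le.
have step (k : 'I_n.+1) : `|f (hybrid x y k.+1) - f (hybrid x y k)
    - (x - y) 0 k * partial k f a| <= e' * `|x - y|.
  pose h t := f (hybrid x y k + t *: delta_mx 0 k) - t * partial k f a.
  pose s := (x - y) 0 k.
  have near_a t : Num.min 0 s <= t <= Num.max 0 s ->
      `|hybrid x y k + t *: delta_mx 0 k - a| < d.
    move=> ts; apply: coords_lt; first by apply: lt_bigmin.
    move=> j; rewrite !mxE eqxx/=.
    have xj : `|x 0 j - a 0 j| < d.
      by have := le_lt_trans (coord_le (x - a) j) xd; rewrite !mxE; apply.
    have yj : `|y 0 j - a 0 j| < d.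
      by have := le_lt_trans (coord_le (y - a) j) yd; rewrite !mxE; apply.
    have [jk|jk] := eqVneq j k; last by rewrite mulr0 addr0; case: ifP.
    rewrite jk in xj yj *; rewrite ltnn mulr1; move: ts xj yj; rewrite /s !mxE.
    rewrite !ltr_norml; case: (leP 0 (x 0 k - y 0 k)) => _ /andP[t1 t2] /andP[x1 x2] /andP[y1 y2];
    apply/andP; split; lra.
  have -> : hybrid x y k.+1 = hybrid x y k + s *: delta_mx 0 k.
    apply/rowP => j; rewrite /s !mxE eqxx/= ltnS leq_eqVlt (_ : (nat_of_ord j == k) = (j == k))//.
    have [jk|jk] := eqVneq j k; last by rewrite mulr0 addr0.
    by rewrite jk ltnn/= mulr1 addrC subrK.
  have := @mean_value_norm R h
    (fun t => partial k f (hybrid x y k + t *: delta_mx 0 k) - partial k f a) 0 s e'.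
  rewrite /h scale0r mul0r subr0 addr0 subr0 => H.
  rewrite addrAC; apply: le_trans (H _ _) _; last by rewrite ler_wpM2l ?coord_le// ltW.
  - move=> t ts; apply: is_deriveB; last first.
      by apply: is_derive_eq; rewrite scaler0 add0r [_ *: _]mulr1.
    apply: (@is_derive_line R E R f (hybrid x y k) (delta_mx 0 k) t _).1.
    apply: DeriveDef => //; have [+ _] := C1 k; apply; apply: Vr.
    by apply: lt_le_trans (near_a _ ts) _; exact: bigmin_le_id.
  - by move=> t ts; apply/ltW/ddP/(lt_le_trans (near_a _ ts)).
have -> : f x - f y = \sum_(k < n.+1) (f (hybrid x y k.+1) - f (hybrid x y k)).
  rewrite -(big_mkord xpredT (fun k => f (hybrid x y k.+1) - f (hybrid x y k))).
  rewrite telescope_sumr//; congr (f _ - f _); apply/rowP => j; rewrite mxE//.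
  by rewrite ltn_ord.
rewrite -sumrB; apply: le_trans (ler_norm_sum _ _ _) _.
apply: le_trans (ler_sum _ (fun k _ => step k)) _.
rewrite sumr_const card_ord -mulr_natr mulrAC /e' divfK//.
Qed.

Lemma C1_differentiable V f a : open V -> Ck 1 V f -> V a -> differentiable f a.
Proof.
move=> oV C1 Va.
pose L : E -> R := fun v => \sum_j v 0 j * partial j f a.
have Llin : linear L.
  move=> c u v; rewrite /L scaler_sumr -big_split; apply: eq_bigr => j _ /=.
  by rewrite !mxE mulrDl -mulrA.
pose lin := GRing.isLinear.Build _ _ _ _ L Llin.
pose LL : {linear E -> R} := HB.pack L lin.
have LLc : continuous LL.
  move=> x; apply: continuous_at_sum => j.
  exact: (continuousM (@coord_continuous _ _ _ 0 j x) (@cst_continuous _ _ (partial j f a) x)).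
apply: (@differentiable_bound R E R f LL a LLc) => e e0.
have [d d0 H] := C1_strict oV C1 Va e0.
apply/nbhs_rVP; exists d => // x xd /=; rewrite subr0 in xd.
have := H (x + a) a; rewrite addrK subrr normr0 => /(_ xd d0).
by rewrite opprD addrA.
Qed.

Lemma C1_derive V f a v : open V -> Ck 1 V f -> V a ->
  'D_v f a = \sum_j v 0 j * partial j f a.
Proof.
move=> oV C1 Va; have df := C1_differentiable oV C1 Va.
rewrite deriveE // {1}(row_sum_delta v) linear_sum /=.
by apply: eq_bigr => j _; rewrite linearZ /= /partial deriveE.
Qed.

End Strict.

Section Chain.
Context {R : realType} {U V W : normedModType R}.

(** The inner function is only required to be derivable in the direction [u]:
    restricting to the line through [x] reduces to a curve. *)
Lemma is_derive_comp (f : V -> W) (g : U -> V) (x u : U) :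
  derivable g x u -> differentiable f (g x) ->
  is_derive x u (f \o g) ('D_('D_u g x) f (g x)).
Proof.
move=> dg df.
have dg1 : is_derive (0 : R) 1 (fun s => g (x + s *: u)) ('D_u g x).
  apply: (@is_derive_line R U V g x u 0 ('D_u g x)).1.
  by rewrite scale0r addr0; apply: DeriveDef.
have dgd : differentiable (fun s : R => g (x + s *: u)) 0.
  by apply/derivable1_diffP; case: dg1.
have df' : differentiable f (g (x + 0 *: u)) by rewrite scale0r addr0.
have := @is_derive_line R U W (f \o g) x u 0 ('D_('D_u g x) f (g x)).
rewrite scale0r addr0 => -[_]; apply.
have dc : differentiable (f \o (fun s : R => g (x + s *: u))) 0.
  exact: differentiable_comp.
apply: DeriveDef; first exact/derivable1_diffP.
rewrite -[LHS]/('D_1 (f \o (fun s : R => g (x + s *: u))) 0).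
rewrite deriveE// diff_comp //= -deriveE // scale0r addr0.
congr ('D_ _ f _); rewrite -deriveE//; exact: derive_val.
Qed.

End Chain.

Section CkLocal.
Context {R : realType} {n : nat} {W : normedModType R}.
Local Notation E := 'rV[R]_n.+1.
Implicit Types (f g : E -> W) (V : set E).

Lemma partial_eq V f g i a : open V -> V a -> (forall b, V b -> f b = g b) ->
  partial i f a = partial i g a.
Proof.
move=> oV Va fg; apply: near_eq_derive.
by near do apply: fg; exact: open_nbhs_nbhs.
Unshelve. all: by end_near. Qed.

Lemma derivable_eq V f g v a : open V -> V a -> (forall b, V b -> f b = g b) ->
  derivable f a v -> derivable g a v.
Proof.
move=> oV Va fg; apply: near_eq_derivable.
by near do apply: fg; exact: open_nbhs_nbhs.
Unshelve. all: by end_near. Qed.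

Lemma Ck_eq k V f g : open V -> (forall b, V b -> f b = g b) ->
  Ck k V f -> Ck k V g.
Proof.
move=> oV; elim: k f g => [|k IH] f g fg /=.
  move=> H a Va; apply: (@cvg_trans _ (f x @[x --> a])).
    apply: near_eq_cvg; first exact: nbhs_filter.
    have := open_nbhs_nbhs (conj oV Va).
    by apply: filterS => b Vb; rewrite fg.
  by rewrite -fg//; exact: H.
move=> H i; have [H1 H2] := H i; split.
  by move=> a Va; apply: derivable_eq fg (H1 _ Va).
by apply: IH H2 => b Vb; exact: partial_eq fg.
Qed.

Lemma Ck_sub k V V' f : V' `<=` V -> Ck k V f -> Ck k V' f.
Proof.
move=> sV; elim: k f => [|k IH] f /=; first by move=> H a /sV /H.
by move=> H i; have [H1 H2] := H i; split; [move=> a /sV /H1|exact: IH].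
Qed.

Lemma smooth_sub V V' f : V' `<=` V -> smooth V f -> smooth V' f.
Proof. by move=> sV sf k; exact: Ck_sub sV (sf k). Qed.

Lemma smooth_eq V f g : open V -> (forall b, V b -> f b = g b) ->
  smooth V f -> smooth V g.
Proof. by move=> oV fg sf k; exact: Ck_eq oV fg (sf k). Qed.

Lemma smooth_partial V f i : smooth V f -> smooth V (partial i f).
Proof. by move=> sf k; have [] := sf k.+1 i. Qed.

Lemma smooth_derivable V f i a : smooth V f -> V a ->
  derivable f a (delta_mx 0 i).
Proof. by move=> sf Va; have [H _] := sf 1%N i; exact: H. Qed.

Lemma Ck_cst k V (c : W) : Ck k V (fun=> c).
Proof.
elim: k c => [|k IH] c /=; first by move=> a _; exact: cst_continuous.
move=> i; split; first by move=> a _; exact: derivable_cst.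
rewrite (_ : partial i _ = fun=> 0); first exact: IH.
by apply/funext => a; exact: derive_cst.
Qed.

Lemma CkD k V f g : open V -> Ck k V f -> Ck k V g ->
  Ck k V (fun x => f x + g x).
Proof.
move=> oV; elim: k f g => [|k IH] f g /=.
  by move=> Hf Hg a Va; apply: continuousD; [exact: Hf|exact: Hg].
move=> Hf Hg i; have [f1 f2] := Hf i; have [g1 g2] := Hg i; split.
  by move=> a Va; apply: derivableD; [exact: f1|exact: g1].
apply: Ck_eq (IH _ _ f2 g2) => // b Vb.
by rewrite /partial [RHS]deriveD//; [exact: f1|exact: g1].
Qed.

Lemma Ck_sum k V (I : Type) (r : seq I) (P : pred I) (F : I -> E -> W) :
  open V -> (forall j, P j -> Ck k V (F j)) ->
  Ck k V (fun x => \sum_(j <- r | P j) F j x).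
Proof.
move=> oV HF; elim: r => [|j r IH].
  by apply: Ck_eq (@Ck_cst k V 0) => // b _; rewrite big_nil.
have [Pj|nPj] := boolP (P j).
  by apply: Ck_eq (CkD oV (HF j Pj) IH) => // b _; rewrite big_cons Pj.
by apply: Ck_eq IH => // b _; rewrite big_cons (negPf nPj).
Qed.

End CkLocal.

Section CkScalar.
Context {R : realType} {n : nat}.
Local Notation E := 'rV[R]_n.+1.
Implicit Types (f g : E -> R) (V : set E).

Lemma Ck_pred k V f : open V -> Ck k.+1 V f -> Ck k V f.
Proof.
move=> oV; elim: k f => [|k IH] f H.
  by move=> a Va; apply/differentiable_continuous/(C1_differentiable oV H Va).
by move=> i; have [H1 H2] := H i; split => //; exact: IH.
Qed.

Lemma Ck_le k l V f : open V -> (k <= l)%N -> Ck l V f -> Ck k V f.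
Proof.
move=> oV; elim: l => [|l IH]; first by rewrite leqn0 => /eqP ->.
by rewrite leq_eqVlt => /orP[/eqP->//|kl] /(Ck_pred oV); exact: IH.
Qed.

Lemma smooth_continuous V f a : smooth V f -> V a -> {for a, continuous f}.
Proof. by move=> sf Va; exact: (sf 0%N). Qed.

Lemma CkM k V f g : open V -> Ck k V f -> Ck k V g ->
  Ck k V (fun x => f x * g x).
Proof.
move=> oV; elim: k f g => [|k IH] f g.
  by move=> Hf Hg a Va; apply: continuousM; [exact: Hf|exact: Hg].
move=> Hf Hg i; have [f1 f2] := Hf i; have [g1 g2] := Hg i; split.
  by move=> a Va; apply: derivableM; [exact: f1|exact: g1].
have := CkD oV (IH _ _ (Ck_pred oV Hf) g2) (IH _ _ (Ck_pred oV Hg) f2).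
apply: Ck_eq => // b Vb.
by rewrite /partial [RHS]deriveM//; [exact: f1|exact: g1].
Qed.

Lemma CkN k V f : open V -> Ck k V f -> Ck k V (fun x => - f x).
Proof.
move=> oV Hf; apply: Ck_eq (CkM oV (@Ck_cst R n R k V (-1)) Hf) => // b _.
by rewrite mulN1r.
Qed.

Lemma CkB k V f g : open V -> Ck k V f -> Ck k V g ->
  Ck k V (fun x => f x - g x).
Proof. by move=> oV Hf Hg; apply: CkD => //; exact: CkN. Qed.

Lemma Ck_inv k V f : open V -> (forall a, V a -> f a != 0) -> Ck k V f ->
  Ck k V (fun x => (f x)^-1).
Proof.
move=> oV f0; elim: k => [|k IH].
  by move=> Hf a Va; apply: continuousV; [exact: f0|exact: Hf].
move=> Hf i; have [f1 f2] := Hf i; split.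
  by move=> a Va; apply: derivableV; [exact: f0|exact: f1].
have Hi := IH (Ck_pred oV Hf).
have := CkN oV (CkM oV (CkM oV Hi Hi) f2).
apply: Ck_eq => // b Vb.
rewrite /partial [RHS]deriveV//; [|exact: f0|exact: f1].
by rewrite -invfM scaleNr.
Qed.

Lemma partial_coord i j (a : E) : partial i (fun x : E => x 0 j) a = (j == i)%:R.
Proof.
rewrite /partial; have := @derive_mx R E 1 n.+1 id a (delta_mx 0 i) (@derivable_id R E a _).
by rewrite derive_id => /(congr1 (fun M : E => M 0 j)); rewrite coord_delta mxE => ->.
Qed.

Lemma Ck_coord k V j : Ck k V (fun x : E => x 0 j).
Proof.
case: k => [|k]; first by move=> a _; exact: coord_continuous.
move=> i; split.
  move=> a _; have /derivable_mxP := @derivable_id R E a (delta_mx 0 i); exact.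
rewrite (_ : partial i _ = fun=> (j == i)%:R : R); first exact: Ck_cst.
by apply/funext => a; exact: partial_coord.
Qed.

Let two_approx (A B P Q s e : R) : 0 < s ->
  `|P - s * A| <= e / 2 * s -> `|Q - s * B| <= e / 2 * s -> P = Q ->
  `|A - B| <= e.
Proof.
move=> s0 + + PQ; rewrite PQ !ler_norml => /andP[p1 p2] /andP[p3 p4].
by apply/andP; split; rewrite -(ler_pM2l s0); lra.
Qed.

(** Mixed second differences, computed in either order by the mean value
    inequality, agree; hence so do the mixed partial derivatives. *)
Lemma partial_comm V f i j a : open V -> Ck 2 V f -> V a ->
  partial i (partial j f) a = partial j (partial i f) a.
Proof.
move=> oV C2 Va.
have key k l (e : R) : 0 < e -> exists2 d, 0 < d & forall h, 0 < h < d ->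
    `|f (a + h *: delta_mx 0 k + h *: delta_mx 0 l)
  - f (a + h *: delta_mx 0 k) - f (a + h *: delta_mx 0 l) + f a
     - h ^+ 2 * partial l (partial k f) a| <= e * h ^+ 2.
  move=> e0.
  have [r r0 Vr] := open_norm oV Va.
  have C1k : Ck 1 V (partial k f) by have [] := C2 k.
  have [d d0 Hd] := C1_strict oV C1k Va e0.
  exists (Num.min d r / 2); first by rewrite divr_gt0// lt_min d0.
  move=> h /andP[h0 hd].
  have nd (s t : R) : 0 <= s <= h -> 0 <= t <= h ->
      `|a + s *: delta_mx 0 k + t *: delta_mx 0 l - a| < Num.min d r.
    move=> sh th; apply: coords_lt; first by rewrite lt_min d0.
    move=> m; rewrite !mxE eqxx/= [X in `|X|](_ : _ = s * (m == k)%:R + t * (m == l)%:R); last by ring.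
    rewrite ger0_norm; last by rewrite addr_ge0// mulr_ge0//; lra.
    by case: (m == k); case: (m == l); rewrite ?mulr1 ?mulr0; lra.
  (* the mean value inequality in the direction [k], applied to the increment in
     the direction [l] corrected by its expected linear part *)
  pose phi s := f (a + h *: delta_mx 0 l + s *: delta_mx 0 k)
     - f (a + s *: delta_mx 0 k) - s * (h * partial l (partial k f) a).
  have := @mean_value_le R phi (fun s => partial k f (a + h *: delta_mx 0 l + s *: delta_mx 0 k)
     - partial k f (a + s *: delta_mx 0 k) - h * partial l (partial k f) a) 0 h (e * h) (ltW h0).
  rewrite /phi !scale0r !addr0 mul0r subr0 subr0 => H.
  rewrite (_ : f _ - _ - _ + _ - _ = f (a + h *: delta_mx 0 l + h *: delta_mx 0 k) -
     f (a + h *: delta_mx 0 k) - h * (h * partial l (partial k f) a) -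
     (f (a + h *: delta_mx 0 l) - f a)); last by rewrite [a + _ + _]addrAC; ring.
  rewrite expr2 [e * _]mulrA; apply: H => s sh.
  - apply: is_deriveB; first apply: is_deriveB.
    + apply: (@is_derive_line R E R f (a + h *: delta_mx 0 l) (delta_mx 0 k) s _).1.
      apply: DeriveDef => //; have [+ _] := C2 k; apply; apply: Vr.
      rewrite [a + h *: _ + _]addrAC; apply: (lt_le_trans (nd s h sh _)); first by rewrite lexx ltW.
      by rewrite ge_min lexx orbT.
    + apply: (@is_derive_line R E R f a (delta_mx 0 k) s _).1.
      apply: DeriveDef => //; have [+ _] := C2 k; apply; apply: Vr.
      have := nd s 0 sh; rewrite scale0r addr0 lexx (ltW h0) => /(_ isT).
      by rewrite lt_min => /andP[].
    + by apply: is_derive_eq; rewrite scaler0 add0r [_ *: _]mulr1.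
  - have P1 : `|a + h *: delta_mx 0 l + s *: delta_mx 0 k - a| < d.
      rewrite [a + h *: _ + _]addrAC; have := nd s h sh; rewrite lexx (ltW h0) => /(_ isT).
      by rewrite lt_min => /andP[].
    have P2 : `|a + s *: delta_mx 0 k - a| < d.
      have := nd s 0 sh; rewrite scale0r addr0 lexx (ltW h0) => /(_ isT).
      by rewrite lt_min => /andP[].
    have := Hd _ _ P1 P2.
    have -> : a + h *: delta_mx 0 l + s *: delta_mx 0 k - (a + s *: delta_mx 0 k)
       = h *: delta_mx 0 l.
      by rewrite [a + h *: _ + _]addrAC [_ + h *: _]addrC addrK.
    rewrite (bigD1 l)//= big1 ?addr0; last first.
      by move=> m ml; rewrite !mxE eqxx/= (negPf ml) mulr0 mul0r.
    rewrite !mxE !eqxx mulr1 => /le_trans; apply; rewrite ler_pM2l//.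
    apply: coords_le; first exact: ltW.
    move=> m; rewrite !mxE eqxx/= ger0_norm; last by rewrite mulr_ge0// ltW.
    by case: (m == l); rewrite ?mulr1 ?mulr0// (ltW h0).
apply/eqP; rewrite -subr_eq0 -normr_le0; apply/ler_addgt0Pr => e e0.
have e20 : 0 < e / 2 by rewrite divr_gt0.
have [d d0 Hd] := key i j _ e20; have [d' d'0 Hd'] := key j i _ e20.
pose h := Num.min d d' / 2.
have h0 : 0 < h by rewrite divr_gt0// lt_min d0.
have hd : 0 < h < d by rewrite h0 /= /h; case: (leP d d') => ?; lra.
have hd' : 0 < h < d' by rewrite h0 /= /h; case: (leP d d') => ?; lra.
rewrite add0r; apply: (two_approx _ (Hd' _ hd') (Hd _ hd)); first by rewrite exprn_gt0.
by rewrite [a + h *: delta_mx 0 j + _]addrAC; ring.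
Qed.

End CkScalar.

Section CkVector.
Context {R : realType} {n m : nat}.
Local Notation E := 'rV[R]_n.+1.
Local Notation E' := 'rV[R]_m.+1.
Implicit Types (X : E -> E') (V : set E).

Lemma partial_mx i X a j : derivable X a (delta_mx 0 i) ->
  partial i X a 0 j = partial i (fun b => X b 0 j) a.
Proof. by move=> dX; rewrite /partial derive_mx// mxE. Qed.

Lemma continuous_rV {T : topologicalType} (f : T -> E') a :
  (forall j, {for a, continuous (fun b => f b 0 j)}) -> {for a, continuous f}.
Proof.
move=> H; apply/cvgrPdist_lt => e e0.
have : \forall b \near a, forall j, `|f a 0 j - f b 0 j| < e.
  apply: filter_forall => j.
  by have /cvgrPdist_lt /(_ e e0) := H j.
apply: filterS => b Hb; apply: coords_lt => // j.
by rewrite !mxE.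
Qed.

Lemma Ck_mx k V X : open V ->
  Ck k V X <-> (forall j, Ck k V (fun b => X b 0 j)).
Proof.
move=> oV; elim: k X => [|k IH] X /=.
  split=> [H j a Va|H a Va]; last by apply: continuous_rV => j; exact: H.
  apply: (@continuous_comp _ _ _ X (fun x : E' => x 0 j)); first exact: H.
  exact: coord_continuous.
split=> [H j i|H i].
  have [H1 H2] := H i; split.
    by move=> a Va; have /derivable_mxP := H1 _ Va; exact.
  apply: Ck_eq ((IH _).1 H2 j) => // b Vb.
  by rewrite partial_mx//; exact: H1.
have dX a : V a -> derivable X a (delta_mx 0 i).
  by move=> Va; apply/derivable_mxP => u j; rewrite ord1; have [+ _] := H j i; exact.
split; first exact: dX.
apply/IH => j; have [_ +] := H j i; apply: Ck_eq => // b Vb.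
by rewrite partial_mx//; exact: dX.
Qed.

Lemma smooth_mx V X : open V ->
  smooth V X <-> (forall j, smooth V (fun b => X b 0 j)).
Proof.
move=> oV; split=> [H j k|H k]; first by move: (H k) => /(Ck_mx _ _ oV).
by apply/Ck_mx => // j; exact: H.
Qed.

End CkVector.

Section CkComp.
Context {R : realType} {n m : nat}.
Local Notation E := 'rV[R]_n.+1.
Local Notation E' := 'rV[R]_m.+1.
Implicit Types (X : E -> E') (V : set E).

Lemma is_derive_comp_coord (V' : set E') (f : E' -> R) X a v : open V' -> Ck 1 V' f ->
  V' (X a) -> derivable X a v ->
  is_derive a v (fun b => f (X b))
    (\sum_j 'D_v (fun b => X b 0 j) a * partial j f (X a)).
Proof.
move=> oV' C1 Va dX.
have df := C1_differentiable oV' C1 Va.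
have := is_derive_comp dX df; rewrite (C1_derive _ oV' C1 Va).
rewrite (eq_bigr (fun j => 'D_v (fun b => X b 0 j) a * partial j f (X a)))//.
by move=> j _; rewrite derive_mx// mxE.
Qed.

Lemma partial_comp (V' : set E') (f : E' -> R) X i a : open V' -> Ck 1 V' f ->
  V' (X a) -> derivable X a (delta_mx 0 i) ->
  partial i (fun b => f (X b)) a =
    \sum_j partial i (fun b => X b 0 j) a * partial j f (X a).
Proof.
by move=> oV' C1 Va dX; have [_] := is_derive_comp_coord oV' C1 Va dX.
Qed.

Lemma Ck_comp k V (V' : set E') (f : E' -> R) X : open V -> open V' ->
  (forall a, V a -> V' (X a)) -> Ck k V' f ->
  (forall j, Ck k V (fun b => X b 0 j)) -> Ck k V (fun b => f (X b)).
Proof.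
move=> oV oV' VV'; elim: k f => [|k IH] f Hf HX.
  move=> a Va; apply: (@continuous_comp _ _ _ X f); last exact/Hf/VV'.
  by apply: continuous_rV => j; exact: HX.
have HX' := (Ck_mx _ _ oV).2 HX.
have Hf1 : Ck 1 V' f by exact: Ck_le oV' _ Hf.
have dX i a : V a -> derivable X a (delta_mx 0 i).
  by move=> Va; have [H _] := HX' i; exact: H.
move=> i; split.
  by move=> a Va; have [] := is_derive_comp_coord oV' Hf1 (VV' _ Va) (dX i _ Va).
have : Ck k V (fun a => \sum_j partial i (fun b => X b 0 j) a * partial j f (X a)).
  apply: Ck_sum => // j _; apply: CkM => //; first by have [] := HX j i.
  apply: IH; first by have [] := Hf j.
  by move=> l; exact: Ck_pred.
apply: Ck_eq => // a Va; rewrite (partial_comp oV' Hf1 (VV' _ Va))//; exact: dX.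
Qed.

Lemma smooth_comp V (V' : set E') (f : E' -> R) X : open V -> open V' ->
  (forall a, V a -> V' (X a)) -> smooth V' f -> smooth V X ->
  smooth V (fun b => f (X b)).
Proof.
move=> oV oV' VV' sf sX k; apply: (Ck_comp oV oV' VV' (sf k)).
exact/Ck_mx.
Qed.

End CkComp.

Section Smooth.
Context {R : realType} {n : nat}.
Local Notation E := 'rV[R]_n.+1.
Implicit Types (f g : E -> R) (V : set E).

Lemma smooth_cst V (c : R) : smooth V (fun _ : E => c).
Proof. by move=> k; exact: Ck_cst. Qed.

Lemma smooth_coord V j : smooth V (fun x : E => x 0 j).
Proof. by move=> k; exact: Ck_coord. Qed.

Lemma smoothD V f g : open V -> smooth V f -> smooth V g ->
  smooth V (fun x => f x + g x).
Proof. by move=> oV sf sg k; exact: CkD. Qed.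

Lemma smoothN V f : open V -> smooth V f -> smooth V (fun x => - f x).
Proof. by move=> oV sf k; exact: CkN. Qed.

Lemma smoothB V f g : open V -> smooth V f -> smooth V g ->
  smooth V (fun x => f x - g x).
Proof. by move=> oV sf sg k; exact: CkB. Qed.

Lemma smoothM V f g : open V -> smooth V f -> smooth V g ->
  smooth V (fun x => f x * g x).
Proof. by move=> oV sf sg k; exact: CkM. Qed.

Lemma smoothV V f : open V -> (forall a, V a -> f a != 0) -> smooth V f ->
  smooth V (fun x => (f x)^-1).
Proof. by move=> oV f0 sf k; exact: Ck_inv. Qed.

Lemma smooth_sum V (I : Type) (r : seq I) (P : pred I) (F : I -> E -> R) :
  open V -> (forall j, P j -> smooth V (F j)) ->
  smooth V (fun x => \sum_(j <- r | P j) F j x).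
Proof. by move=> oV sF k; apply: Ck_sum => // j Pj; exact: sF. Qed.

Lemma open_neq0 V f : open V -> smooth V f ->
  open (V `&` [set a | f a != 0]).
Proof.
move=> oV sf; rewrite openE => a [Va fa].
rewrite /interior; apply: filterI; first exact: open_nbhs_nbhs.
have /cvgrPdist_lt /(_ `|f a|) := smooth_continuous sf Va.
rewrite normr_gt0 => /(_ fa); apply: filterS => b /= Hb.
by apply: contraTneq Hb => ->; rewrite subr0 ltxx.
Qed.

End Smooth.

(** * Ordinary differential equations with parameters *)

Lemma continuous_nearP {R : realType} {T : topologicalType} (f : T -> R) (a : T) :
  {for a, continuous f} <->
  (forall e, 0 < e -> \forall b \near a, `|f b - f a| < e).
Proof.
split=> [/cvgrPdist_lt H e e0|H].
  by have := H e e0; apply: filterS => b; rewrite distrC.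
by apply/cvgrPdist_lt => e e0; have := H e e0; apply: filterS => b; rewrite distrC.
Qed.

Section OneVariable.
Context {R : realType}.
Implicit Types (f r : R -> R) (T : R).

Lemma is_derive_normP f (x l : R) :
  is_derive x 1 f l <-> (forall e, 0 < e -> exists2 d, 0 < d &
    forall h, `|h| < d -> `|f (x + h) - f x - h * l| <= e * `|h|).
Proof.
split=> [[dv vl] e e0|H].
  move: dv => /cvgrPdist_le; rewrite -/(derive f x 1) vl => /(_ e e0).
  move=> /nbhs_ballP[d /= d0 Hd]; exists d => // h hd.
  have [->|h0] := eqVneq h 0; first by rewrite addr0 subrr mul0r subr0 normr0 mulr0.
  have := Hd h; rewrite /ball/= sub0r normrN => /(_ hd h0).
  rewrite [h *: 1]mulr1 distrC => Hl.
  have -> : f (x + h) - f x - h * l = h * (h^-1 *: (f (h + x) - f x) - l).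
    by rewrite mulrBr /GRing.scale/= mulrA divff// mul1r [x + h]addrC.
  by rewrite normrM mulrC ler_wpM2r.
have cv : h^-1 *: ((f \o shift x) (h *: 1) - f x) @[h --> 0^'] --> l.
  apply/cvgrPdist_le => e e0; have [d d0 Hd] := H e e0.
  apply/nbhs_ballP; exists d => // h; rewrite /ball/= sub0r normrN => hd h0.
  rewrite [h *: 1]mulr1 -(ler_pM2l (_ : 0 < `|h|)) ?normr_gt0// mulrC distrC.
  rewrite mulrC -normrM mulrBr /GRing.scale/= mulrA divff// mul1r [h + x]addrC.
  by rewrite [leRHS]mulrC; exact: Hd.
by apply: DeriveDef; [apply/cvg_ex; exists l|exact/cvg_lim].
Qed.

(** On a time interval of radius at most 2 a function whose derivative is
    bounded by a quarter of its size, up to a small error, stays small: bounding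
    its maximum by the mean value inequality, the maximum absorbs itself. *)
Lemma ode_estimate r (dr : R -> R) T (e0 e : R) : 0 <= T <= 2 -> 0 <= e ->
  (forall t : R, `|t| <= T -> is_derive t 1 r (dr t)) ->
  (forall t, `|t| <= T -> `|dr t| <= 4^-1 * `|r t| + e) ->
  `|r 0| <= e0 -> forall t, `|t| <= T -> `|r t| <= 2 * (e0 + 2 * e).
Proof.
move=> /andP[T0 T2] ege0 Hd Hb r0 t tT.
have cr : {within `[- T, T], continuous (fun t => `|r t|)}.
  apply/continuous_in_subspaceT => s; rewrite inE/= in_itv/= -ler_norml => sT.
  apply: continuous_comp; last exact: norm_continuous.
  by apply/differentiable_continuous/derivable1_diffP; have [] := Hd _ sT.
have [|c cT Hc] := EVT_max (_ : - T <= T) cr; first lra.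
rewrite in_itv/= -ler_norml in cT.
have rc s : `|s| <= T -> `|r s| <= `|r c|.
  by move=> sT; apply: Hc; rewrite in_itv/= -ler_norml.
have H : `|r c - r 0| <= (4^-1 * `|r c| + e) * `|c - 0|.
  have between s : Num.min 0 c <= s <= Num.max 0 c -> `|s| <= T.
    move: cT; rewrite !ler_norml; case: (leP 0 c) => _ /andP[c1 c2] /andP[s1 s2];
    apply/andP; split; lra.
  apply: (@mean_value_norm _ _ dr) => s /between sT; first exact: Hd.
  by apply: le_trans (Hb _ sT) _; rewrite lerD2r ler_wpM2l ?invr_ge0// rc.
have c2 : `|c| <= 2 by exact: le_trans cT T2.
have rc0 : 0 <= `|r c| by [].
have H2 : `|r c| <= `|r 0| + `|r c - r 0| by rewrite -lerBlDl lerB_dist.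
rewrite subr0 in H.
have : (4^-1 * `|r c| + e) * `|c| <= (4^-1 * `|r c| + e) * 2.
  by apply: ler_wpM2l => //; rewrite addr_ge0// mulr_ge0.
have := rc _ tT; lra.
Qed.

(** The integral starts at -3 so that 0 is interior to the interval on which the
    fundamental theorem of calculus is used. *)
Lemma antiderivative f : continuous f -> exists F : R -> R,
  F 0 = 0 /\ forall t : R, `|t| < 3 -> is_derive t 1 F (f t).
Proof.
move=> cf; pose F x := (\int[lebesgue_measure]_(t in [set` `[(-3)%R, x]]) (f t))%R.
have FD t : `|t| < 3 -> derivable F t 1 /\ derive1 F t = f t.
  rewrite ltr_norml => /andP[t3 t3'].
  apply: (@continuous_FTC1_closed R f (-3) t 3) => //; last exact: cf.
  apply: continuous_compact_integrable; first exact: segment_compact.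
  by apply: continuous_subspaceT => x; exact: cf.
clearbody F; exists (fun x => F x - F 0); split; first by rewrite subrr.
move=> t /FD[dF]; rewrite derive1E => vF.
rewrite -[f t]subr0; apply: is_deriveB; exact: DeriveDef.
Qed.

Definition clamp T (t : R) : R := Num.max (- T) (Num.min T t).

Lemma clamp_le T t : 0 <= T -> `|clamp T t| <= T.
Proof.
move=> T0; rewrite ler_norml /clamp le_max lexx/= ge_max ge_min lexx/= andbT; lra.
Qed.

Lemma clamp_id T t : `|t| <= T -> clamp T t = t.
Proof.
by rewrite ler_norml => /andP[t1 t2]; rewrite /clamp (min_idPr t2) (max_idPr t1).
Qed.

Lemma continuous_clamp T : continuous (clamp T).
Proof.
move=> t; apply: (@continuous_max _ _ (fun=> - T) (fun t => Num.min T t)).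
  exact: cst_continuous.
apply: (@continuous_min _ _ (fun=> T) id); [exact: cst_continuous|exact: cvg_id].
Qed.

End OneVariable.

Section Picard.
Context {R : realType}.
Variables (g : R -> R -> R) (c T : R).
Hypothesis T02 : 0 <= T <= 2.
Hypothesis g_cont : forall y : R -> R, continuous y ->
  forall t, `|t| <= T -> {for t, continuous (fun s => g s (y s))}.
Hypothesis g_lip : forall t y z, `|t| <= T ->
  `|g t y - g t z| <= 8^-1 * `|y - z|.

Let T0 : 0 <= T. Proof. by case/andP: T02. Qed.
Let T3 (t : R) : `|t| <= T -> `|t| < 3. Proof. by case/andP: T02 => _ ? ?; lra. Qed.

(* the indefinite integral of [g s (y s)], frozen outside of the interval *)
Let is_step (y z : R -> R) := exists F : R -> R,
  [/\ F 0 = 0, forall t : R, `|t| <= T -> is_derive t 1 F (g t (y t)) &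
      forall t, z t = c + F (clamp T t)].

Let step_ex y : continuous y -> exists z, is_step y z.
Proof.
move=> cy; pose phi t := g (clamp T t) (y (clamp T t)).
have [t|F [F0 dF]] := @antiderivative R phi.
  apply: (@continuous_comp _ _ _ (clamp T) (fun s => g s (y s))).
    exact: continuous_clamp.
  by apply: g_cont => //; exact: clamp_le.
exists (fun t => c + F (clamp T t)), F; split => // t tT.
by have := dF _ (T3 tT); rewrite /phi clamp_id.
Qed.

Let step_cont y z : is_step y z -> continuous z.
Proof.
move=> [F [F0 dF zE]] t; rewrite (_ : z = fun t => c + F (clamp T t)); last exact/funext.
apply: continuousD; first exact: cst_continuous.
apply: continuous_comp; first exact: continuous_clamp.
by apply/differentiable_continuous/derivable1_diffP; have [] := dF _ (clamp_le t T0).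
Qed.

Let between t s : `|t| <= T -> Num.min 0 t <= s <= Num.max 0 t -> `|s| <= T.
Proof.
rewrite !ler_norml; case: (leP 0 t) => _ /andP[c1 c2] /andP[s1 s2];
apply/andP; split; lra.
Qed.

Let step_contract y1 y2 z1 z2 e : is_step y1 z1 -> is_step y2 z2 -> 0 <= e ->
  (forall t, `|y1 t - y2 t| <= e) -> forall t, `|z1 t - z2 t| <= e / 2.
Proof.
move=> [F [F0 dF zE]] [G [G0 dG z'E]] e0 H t.
rewrite zE z'E opprD addrACA subrr add0r.
have cT := clamp_le t T0; set s := clamp T t in cT *.
have := @mean_value_norm R (fun t => F t - G t)
  (fun t => g t (y1 t) - g t (y2 t)) 0 s (8^-1 * e).
rewrite F0 G0 !subr0 => Hm.
have : `|F s - G s| <= 8^-1 * e * `|s|.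
  apply: Hm => u /(between cT) uT.
    by apply: is_deriveB; [exact: dF|exact: dG].
  by apply: le_trans (g_lip _ _ uT) _; rewrite ler_wpM2l ?invr_ge0.
move/le_trans; apply; have s2 : `|s| <= 2 by case/andP: T02 => _; exact: le_trans.
have : 8^-1 * e * `|s| <= 8^-1 * e * 2 by rewrite ler_wpM2l// mulr_ge0// invr_ge0.
lra.
Qed.

(** Picard iteration: on an interval of radius at most 2 and with Lipschitz
    constant 1/8 the integral operator halves distances. *)
Lemma picard : exists y : R -> R,
  y 0 = c /\ forall t : R, `|t| < T -> is_derive t 1 y (g t (y t)).
Proof.
have /choice[S HS] (y : R -> R) : exists z : R -> R, continuous y -> is_step y z.
  have [/step_ex[z Hz]|ncy] := pselect (continuous y); first by exists z.
  by exists y.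
pose Y n := iter n S (fun=> c).
have cY n : continuous (Y n).
  elim: n => [|n IH]; first exact: cst_continuous.
  by apply: step_cont (HS _ IH).
have sY n : is_step (Y n) (Y n.+1) by exact: HS.
have [K K0 HK] : exists2 K, 0 <= K & forall t, `|Y 1%N t - Y 0%N t| <= K.
  have [F [F0 dF YE]] := sY 0%N.
  have cF : {within `[- T, T], continuous (fun t => `|F t|)}.
    apply/continuous_in_subspaceT => s; rewrite inE/= in_itv/= -ler_norml => sT.
    apply: continuous_comp; last exact: norm_continuous.
    by apply/differentiable_continuous/derivable1_diffP; have [] := dF _ sT.
  have [|s sT Hs] := EVT_max (_ : - T <= T) cF; first by have := T0; lra.
  exists `|F s| => // t; rewrite YE /Y/= addrAC subrr add0r; apply: Hs.
  by rewrite in_itv/= -ler_norml; exact: clamp_le.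
have dY n t : `|Y n.+1 t - Y n t| <= K * 2^-1 ^+ n.
  elim: n t => [|n IH] t; first by rewrite expr0 mulr1.
  rewrite exprSr mulrA; apply: (step_contract (sY n.+1) (sY n)) => //.
  by rewrite mulr_ge0// exprn_ge0.
(* the n-th iterate minus, resp. plus, a bound for the sum of the remaining
   increments is increasing, resp. decreasing, and the common limit is the
   solution *)
pose a t n := Y n t - 2 * K * 2^-1 ^+ n; pose b t n := Y n t + 2 * K * 2^-1 ^+ n.
have e0 n : 0 <= K * 2^-1 ^+ n by rewrite mulr_ge0// exprn_ge0.
have a_nd t : {homo a t : m n / (m <= n)%N >-> m <= n}.
  apply: homo_leq => [x|x y z|n] //; first exact: le_trans.
  have := dY n t; rewrite ler_norml /a exprSr => /andP[+ _]; lra.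
have b_ni t : {homo b t : m n / (m <= n)%N >-> n <= m}.
  apply: (@homo_leq _ _ (fun x y => y <= x)) => [x|x y z xy yz|n] //.
    exact: le_trans yz xy.
  have := dY n t; rewrite ler_norml /b exprSr => /andP[_]; lra.
have ab t m n : a t m <= b t n.
  apply: (le_trans (a_nd t m (maxn m n) (leq_maxl _ _))).
  apply: (le_trans _ (b_ni t n (maxn m n) (leq_maxr _ _))).
  by rewrite /a /b; have := e0 (maxn m n); lra.
pose y t := sup (range (a t)).
have yY n t : `|y t - Y n t| <= 2 * K * 2^-1 ^+ n.
  have ay : a t n <= y t.
    apply: ub_le_sup; last by exists n.
    by exists (b t 0%N) => _ [m _ <-].
  have yb : y t <= b t n.
    apply: ge_sup; first by exists (a t 0%N), 0%N.
    by move=> _ [m _ <-].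
  by rewrite ler_norml; move: ay yb; rewrite /a /b; lra.
have small e : 0 < e -> exists n, 2 * K * 2^-1 ^+ n < e.
  move=> ep; have K1 : 0 < e / (2 * K + 1) by rewrite divr_gt0//; lra.
  have [n _ /(_ n (leqnn n)) /= Hn] := near_infty_natSinv_expn_lt (PosNum K1).
  exists n; move: Hn; rewrite /= ltr_pdivlMr; last lra.
  rewrite mulrC div1r -exprVn => /(le_lt_trans _); apply; rewrite ler_wpM2r ?exprn_ge0//; lra.
have cy : continuous y.
  move=> t; apply/cvgrPdist_lt => e ep.
  have [n Hn] := small (e / 3) (divr_gt0 ep (ltr0n _ 3)).
  have /cvgrPdist_lt /(_ (e / 3) (divr_gt0 ep (ltr0n _ 3))) := cY n t.
  apply: filterS => s Hs.
  have := yY n t; have := yY n s; move: Hs Hn.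
  set k := 2 * K * _ => Hs Hn; rewrite (distrC _ (Y n s)) => H1 H2.
  have -> : y t - y s = (y t - Y n t) + (Y n t - Y n s) + (Y n s - y s) by ring.
  apply: le_lt_trans (ler_normD _ _) _.
  apply: le_lt_trans (lerD (ler_normD _ _) (lexx _)) _; lra.
have Sy : y = S y.
  apply/funext => t; apply/eqP; rewrite -subr_eq0 -normr_le0.
  apply/ler_addgt0Pr => e ep; rewrite add0r.
  have [n Hn] := small e ep.
  have H1 := yY n.+1 t.
  have H2 := step_contract (HS _ cy) (sY n) (mulr_ge0 (mulr_ge0 (ler0n _ 2) K0) (exprn_ge0 n (_ : 0 <= 2^-1))) (yY n) t.
  have {}H2 := H2 ltac:(by rewrite invr_ge0).
  have -> : y t - S y t = (y t - Y n.+1 t) + (Y n.+1 t - S y t) by ring.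
  apply: le_trans (ler_normD _ _) _; rewrite [X in _ + X <= _]distrC.
  by move: H1 H2 Hn; rewrite exprSr; set k := _ ^+ n; nra.
have [F [F0 dF yE]] := HS _ cy.
have yE' t : y t = c + F (clamp T t) by rewrite {1}Sy yE.
exists y; split; first by rewrite yE' clamp_id ?normr0// F0 addr0.
move=> t tT; apply: (@near_eq_is_derive _ _ _ (fun t => c + F t)).
  have /cvgrPdist_lt /(_ (T - `|t|)) := @cvg_id _ (nbhs t).
  rewrite subr_gt0 => /(_ tT); apply: filterS => s Hs; rewrite yE' clamp_id//.
  have : `|s| <= `|s - t| + `|t| by rewrite -{1}(subrK t s) ler_normD.
  rewrite distrC in Hs; lra.
rewrite -[g _ _]add0r; apply: is_deriveD; exact/dF/ltW.
Qed.

End Picard.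

Section OneParameter.
Context {R : realType}.

(** If a family of solutions depends on a real parameter and its equation can be
    linearized along the solution at parameter 0, uniformly in time, then the
    solution of the linearized equation is the derivative of the family. *)
Lemma ode_param_derive (v g : R -> R -> R) (al be w : R -> R) (T M : R) :
  0 <= T <= 2 ->
  (exists2 d, 0 < d & forall s, `|s| < d -> forall t : R, `|t| <= T ->
     is_derive t 1 (v s) (g s t)) ->
  (forall t : R, `|t| <= T -> is_derive t 1 w (al t * w t + be t)) ->
  (forall t, `|t| <= T -> `|al t| <= 8^-1) ->
  (forall t, `|t| <= T -> `|be t| <= M) ->
  is_derive (0 : R) 1 (v^~ 0) (w 0) ->
  (forall e, 0 < e -> exists2 d, 0 < d & forall s, `|s| < d ->
     forall t, `|t| <= T ->
     `|g s t - g 0 t - al t * (v s t - v 0 t) - be t * s|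
        <= e * (`|s| + `|v s t - v 0 t|)) ->
  forall t, `|t| <= T -> is_derive (0 : R) 1 (v^~ t) (w t).
Proof.
move=> T02 [d0 d00 dv] dw alb beb /is_derive_normP v0 lin.
have dv0 : forall t : R, `|t| <= T -> is_derive t 1 (v 0) (g 0 t).
  by apply: dv; rewrite normr0.
have M0 : 0 <= M by have := beb 0; rewrite normr0 => /(_ (proj1 (andP T02))); apply: le_trans.
(* a first use of the estimate bounds the increment [v s t - v 0 t] by [C * |s|] *)
pose C := 2 * ((`|w 0| + 1) + 2 * (M + 1)).
have C0 : 0 <= C by have : 0 <= `|w 0| by []; rewrite /C; lra.
have e8 : (0 : R) < 8^-1 by rewrite invr_gt0.
have [d1 d10 lin1] := lin _ e8.
have [d2 d20 lin2] := v0 1 ltr01.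
have bound s t : `|s| < Num.min d0 (Num.min d1 d2) -> `|t| <= T ->
    `|v s t - v 0 t| <= C * `|s|.
  rewrite !lt_min => /and3P[s0 s1 s2] tT.
  have := @ode_estimate R (fun t => v s t - v 0 t) (fun t => g s t - g 0 t) T
    ((`|w 0| + 1) * `|s|) ((M + 1) * `|s|) T02.
  have -> : C * `|s| = 2 * ((`|w 0| + 1) * `|s| + 2 * ((M + 1) * `|s|)).
    by rewrite /C; ring.
  apply => //; first by rewrite mulr_ge0//; lra.
  - move=> u uT; apply: is_deriveB; [exact: dv|exact: dv0].
  - move=> u uT; have := lin1 s s1 u uT; have := alb _ uT; have := beb _ uT.
    set D := v s u - v 0 u => h1 h2 h3.
    have -> : g s u - g 0 u = (g s u - g 0 u - al u * D - be u * s) + al u * D + be u * s by ring.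
    apply: le_trans (ler_normD _ _) _; apply: le_trans (lerD (ler_normD _ _) (lexx _)) _.
    rewrite !normrM.
    have : `|al u| * `|D| <= 8^-1 * `|D| by rewrite ler_wpM2r.
    have : `|be u| * `|s| <= M * `|s| by rewrite ler_wpM2r.
    have : 0 <= `|s| by [].
    by move: h3; lra.
  - have := lin2 s s2; rewrite add0r => h.
    have -> : v s 0 - v 0 0 = (v s 0 - v 0 0 - s * w 0) + s * w 0 by ring.
    apply: le_trans (ler_normD _ _) _; rewrite normrM; move: h; lra.
move=> t tT; apply/is_derive_normP => e e0.
(* a second one bounds the error of the linear approximation [s * w t] *)
have e'0 : 0 < e / (2 * (1 + 2 * (1 + C))) by rewrite divr_gt0//; lra.
set e' := e / _ in e'0.
have eE : 2 * (e' + 2 * (e' * (1 + C))) = e.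
  by rewrite /e'; field; rewrite gt_eqF//; lra.
have [d3 d30 lin3] := lin _ e'0; have [d4 d40 lin4] := v0 _ e'0.
exists (Num.min (Num.min d0 (Num.min d1 d2)) (Num.min d3 d4)).
  by rewrite !lt_min d00 d10 d20 d30 d40.
move=> s; rewrite lt_min => /andP[s012]; rewrite lt_min => /andP[s3 s4].
have := @ode_estimate R (fun t => v s t - v 0 t - s * w t)
  (fun t => g s t - g 0 t - s * (al t * w t + be t)) T
    (e' * `|s|) (e' * (1 + C) * `|s|) T02.
have -> : e * `|s| = 2 * (e' * `|s| + 2 * (e' * (1 + C) * `|s|)).
  by rewrite -{1}eE; ring.
rewrite add0r; apply => //.
- by rewrite mulr_ge0// mulr_ge0//; lra.
- move=> u uT; apply: is_deriveB; last first.
    have dwu := dw u uT.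
    rewrite (_ : (fun x => s * w x) = s *: w)//; exact: is_deriveZ.
  apply: is_deriveB; [|exact: dv0].
  by apply: dv => //; move: s012; rewrite !lt_min => /and3P[].
- move=> u uT; have := lin3 s s3 u uT; have := alb _ uT; have := bound s u s012 uT.
  set D := v s u - v 0 u => h1 h2 h3.
  have -> : g s u - g 0 u - s * (al u * w u + be u) =
     (g s u - g 0 u - al u * D - be u * s) + al u * (D - s * w u) by ring.
  apply: le_trans (ler_normD _ _) _; rewrite normrM.
  have : `|al u| * `|D - s * w u| <= 8^-1 * `|D - s * w u| by rewrite ler_wpM2r.
  have : e' * (`|s| + `|D|) <= e' * (`|s| + C * `|s|) by rewrite ler_pM2l// lerD2l.
  have : 0 <= `|D - s * w u| by [].
  move: h3; rewrite [e' * (1 + C) * _](_ : _ = e' * (`|s| + C * `|s|)); last by ring.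
  lra.
- by have := lin4 s s4; rewrite add0r.
Qed.

End OneParameter.

Section Cons.
Context {R : realType} {n : nat}.

Definition vcons (y : R) (b : 'rV[R]_n) : 'rV[R]_n.+1 :=
  \row_j (if unlift ord0 j is Some k then b 0 k else y).

Definition vtail (c : 'rV[R]_n.+1) : 'rV[R]_n := \row_j c 0 (lift ord0 j).

Lemma vcons0 y b : vcons y b 0 ord0 = y.
Proof. by rewrite mxE unlift_none. Qed.

Lemma vconsS y b j : vcons y b 0 (lift ord0 j) = b 0 j.
Proof. by rewrite mxE liftK. Qed.

Lemma vconsK y b : vtail (vcons y b) = b.
Proof. by apply/rowP => j; rewrite mxE vconsS. Qed.

Lemma vcons_tail (c : 'rV[R]_n.+1) : vcons (c 0 ord0) (vtail c) = c.
Proof.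
apply/rowP => j; case: (unliftP ord0 j) => [k|] ->; last by rewrite vcons0.
by rewrite vconsS mxE.
Qed.

Lemma vconsD y b z e : vcons y b + vcons z e = vcons (y + z) (b + e).
Proof.
apply/rowP => j; rewrite mxE; case: (unliftP ord0 j) => [k|] ->; last by rewrite !vcons0.
by rewrite !vconsS mxE.
Qed.

Lemma vconsZ s y b : s *: vcons y b = vcons (s * y) (s *: b).
Proof.
apply/rowP => j; rewrite mxE; case: (unliftP ord0 j) => [k|] ->; last by rewrite !vcons0.
by rewrite !vconsS mxE.
Qed.

Lemma delta_vcons0 : delta_mx 0 ord0 = vcons 1 0 :> 'rV[R]_n.+1.
Proof.
apply/rowP => j; rewrite mxE eqxx/=; case: (unliftP ord0 j) => [k|] ->.
  by rewrite vconsS mxE.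
by rewrite vcons0 eqxx.
Qed.

Lemma delta_vconsS j : delta_mx 0 (lift ord0 j) = vcons 0 (delta_mx 0 j) :> 'rV[R]_n.+1.
Proof.
apply/rowP => k; rewrite mxE eqxx/=; case: (unliftP ord0 k) => [l|] ->.
  by rewrite vconsS mxE eqxx (inj_eq lift_inj).
by rewrite vcons0.
Qed.

Lemma vcons_line0 y b s : vcons y b + s *: delta_mx 0 ord0 = vcons (y + s) b.
Proof. by rewrite delta_vcons0 vconsZ vconsD mulr1 scaler0 addr0. Qed.

Lemma vcons_lineS y b s j :
  vcons y b + s *: delta_mx 0 (lift ord0 j) = vcons y (b + s *: delta_mx 0 j).
Proof. by rewrite delta_vconsS vconsZ vconsD mulr0 addr0. Qed.

End Cons.

Section ConsTopology.
Context {R : realType} {n : nat}.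

Lemma continuous_vcons {T : topologicalType} (f : T -> R) (h : T -> 'rV[R]_n.+1) x :
  {for x, continuous f} -> {for x, continuous h} ->
  {for x, continuous (fun u => vcons (f u) (h u))}.
Proof.
move=> cf ch; apply: continuous_rV => j; case: (unliftP ord0 j) => [k|] ->.
  rewrite (_ : (fun b => _) = fun b => h b 0 k); last first.
    by apply/funext => b; rewrite vconsS.
  apply: (@continuous_comp _ _ _ h (fun u : 'rV[R]_n.+1 => u 0 k)) => //.
  exact: coord_continuous.
by rewrite (_ : (fun b => _) = f)//; apply/funext => b; rewrite vcons0.
Qed.

Lemma continuous_vtail (c : 'rV[R]_n.+2) : {for c, continuous (@vtail R n.+1)}.
Proof.
apply: continuous_rV => j; have -> : (fun b : 'rV[R]_n.+2 => vtail b 0 j) = fun b => b 0 (lift ord0 j).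
  by apply/funext => b; rewrite mxE.
exact: coord_continuous.
Qed.

Lemma smooth_vtail (V : set 'rV[R]_n.+2) k j :
  Ck k V (fun c : 'rV[R]_n.+2 => vtail c 0 j).
Proof.
have -> : (fun b : 'rV[R]_n.+2 => vtail b 0 j) = fun b => b 0 (lift ord0 j).
  by apply/funext => b; rewrite mxE.
exact: Ck_coord.
Qed.

Lemma Ck_vcons (m k : nat) (V : set 'rV[R]_m.+1) (f : 'rV[R]_m.+1 -> R)
    (h : 'rV[R]_m.+1 -> 'rV[R]_n.+1) : Ck k V f ->
  (forall j, Ck k V (fun c => h c 0 j)) ->
  forall j, Ck k V (fun c => vcons (f c) (h c) 0 j).
Proof.
move=> cf ch j; case: (unliftP ord0 j) => [l|] ->.
  rewrite (_ : (fun b => _) = fun b => h b 0 l)//.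
  by apply/funext => b; rewrite vconsS.
by rewrite (_ : (fun b => _) = f)//; apply/funext => b; rewrite vcons0.
Qed.

End ConsTopology.

Section ODE.
Context {R : realType} {n : nat}.
Local Notation E := 'rV[R]_n.+1.

(** The first coordinate is the time, the others are the parameters.  The
    right-hand side of an equation is a function [G] of the value of the unknown,
    the time and the parameters, in this order. *)
Definition cyl (B : set E) : set 'rV[R]_n.+2 :=
  [set c : 'rV[R]_n.+2 | `|c 0 ord0| < 2 /\ B (vtail c)].

Lemma open_cyl B : open B -> open (cyl B).
Proof.
move=> oB; rewrite openE => c [c2 Bc]; apply: filterI.
  have /cvgrPdist_lt /(_ (2 - `|c 0 ord0|)) := @coord_continuous R 1 n.+2 0 ord0 c.
  rewrite subr_gt0 => /(_ c2); apply: filterS => d.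
  by have := ler_dist_dist (c 0 ord0) (d 0 ord0); rewrite ler_norml; lra.
by apply: continuous_vtail; apply: open_nbhs_nbhs.
Qed.

Lemma cyl_vcons B t b : `|t| < 2 -> B b -> cyl B (vcons t b).
Proof. by move=> t2 Bb; split; rewrite ?vcons0 ?vconsK. Qed.

Lemma C1_lip (G : 'rV[R]_n.+3 -> R) (D : set 'rV[R]_n.+3) : Ck 1 D G ->
  (forall c y1 y2 z, D (vcons y1 c) -> D (vcons y2 c) ->
     Num.min y1 y2 <= z <= Num.max y1 y2 -> D (vcons z c)) ->
  (forall d, D d -> `|partial ord0 G d| <= 8^-1) ->
  forall c y1 y2, D (vcons y1 c) -> D (vcons y2 c) ->
  `|G (vcons y1 c) - G (vcons y2 c)| <= 8^-1 * `|y1 - y2|.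
Proof.
move=> G_C1 D_conv G_al c y2 y1 D1 D2.
apply: (@mean_value_norm R (fun z => G (vcons z c))
  (fun z => partial ord0 G (vcons z c))) => z zy; last first.
  by apply: G_al; exact: D_conv zy.
have -> : (fun z => G (vcons z c)) = (fun z => G (vcons 0 c + z *: delta_mx 0 ord0)).
  by apply/funext => u; rewrite vcons_line0 add0r.
apply: (@is_derive_line R _ R G (vcons 0 c) (delta_mx 0 ord0) z _).1.
rewrite vcons_line0 add0r; apply: DeriveDef => //.
by have [+ _] := G_C1 ord0; apply; exact: D_conv zy.
Qed.

Section Solution.
Variables (B : set E) (G : 'rV[R]_n.+3 -> R) (D : set 'rV[R]_n.+3).
Variables (v : 'rV[R]_n.+2 -> R) (h : E -> R).
Hypothesis oB : open B.
Hypothesis oD : open D.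
Hypothesis G_cont : forall d, D d -> {for d, continuous G}.
Hypothesis vD : forall c, cyl B c -> D (vcons (v c) c).
Hypothesis G_lip : forall c y1 y2, D (vcons y1 c) -> D (vcons y2 c) ->
  `|G (vcons y1 c) - G (vcons y2 c)| <= 8^-1 * `|y1 - y2|.
Hypothesis v_ode : forall c, cyl B c ->
  is_derive c (delta_mx 0 ord0) v (G (vcons (v c) c)).
Hypothesis v_ini : forall b, B b -> v (vcons 0 b) = h b.

Lemma ode_time b (t : R) : B b -> `|t| < 2 ->
  is_derive t 1 (fun s => v (vcons s b)) (G (vcons (v (vcons t b)) (vcons t b))).
Proof.
move=> Bb t2.
have -> : (fun s => v (vcons s b)) = (fun s => v (vcons 0 b + s *: delta_mx 0 ord0)).
  by apply/funext => u; rewrite vcons_line0 add0r.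
apply: (@is_derive_line R _ R v (vcons 0 b) (delta_mx 0 ord0) t _).1.
by rewrite vcons_line0 add0r; apply: v_ode; exact: cyl_vcons.
Qed.

Lemma ode_time_cont b (t : R) : B b -> `|t| < 2 ->
  {for t, continuous (fun s => v (vcons s b))}.
Proof.
move=> Bb t2; apply/differentiable_continuous/derivable1_diffP.
by have [] := ode_time Bb t2.
Qed.

(* along a solution, a change of the parameters perturbs the right-hand side
   little, uniformly in time since the time interval is compact *)
Let uniform_source b0 T e : B b0 -> T < 2 -> 0 < e ->
  \forall b \near b0, forall t, `|t| <= T ->
    D (vcons (v (vcons t b0)) (vcons t b)) /\
    `|G (vcons (v (vcons t b0)) (vcons t b)) - G (vcons (v (vcons t b0)) (vcons t b0))|
      <= e.
Proof.
move=> Bb T2 e0.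
have /compact_near_coveringP cov := @segment_compact R (- T) T.
have := cov E (nbhs b0) (fun b t => D (vcons (v (vcons t b0)) (vcons t b)) /\
    `|G (vcons (v (vcons t b0)) (vcons t b)) - G (vcons (v (vcons t b0)) (vcons t b0))|
      <= e) _.
move=> /(_ (nbhs_filter b0)) H.
suff /H : forall t1, `[- T, T]%classic t1 -> \forall t \near t1 & b \near nbhs b0,
    D (vcons (v (vcons t b0)) (vcons t b)) /\
    `|G (vcons (v (vcons t b0)) (vcons t b)) - G (vcons (v (vcons t b0)) (vcons t b0))|
      <= e.
  have Fb := nbhs_filter b0; apply: filterS => b Hb t tT.
  by apply: Hb; rewrite /= in_itv/= -ler_norml.
move=> t1; rewrite /= in_itv/= -ler_norml => tT.
have t12 : `|t1| < 2 by exact: le_lt_trans tT T2.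
pose P1 (p : R * E) := vcons (v (vcons p.1 b0)) (vcons p.1 p.2).
pose P2 (p : R * E) := vcons (v (vcons p.1 b0)) (vcons p.1 b0).
have cv : {for (t1, b0), continuous (fun p : R * E => v (vcons p.1 b0))}.
  apply: (@continuous_comp _ _ _ fst (fun s => v (vcons s b0))); first exact: cvg_fst.
  exact: ode_time_cont.
have c1 : {for (t1, b0), continuous P1}.
  by apply: continuous_vcons => //; apply: continuous_vcons; [exact: cvg_fst|exact: cvg_snd].
have c2 : {for (t1, b0), continuous P2}.
  apply: continuous_vcons => //; apply: continuous_vcons; first exact: cvg_fst.
  exact: cst_continuous.
pose d1 := vcons (v (vcons t1 b0)) (vcons t1 b0).
have Dd1 : D d1 by apply: vD; exact: cyl_vcons.
have nD : nbhs d1 [set d | D d /\ `|G d - G d1| < e / 2].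
  apply: filterI; first exact: open_nbhs_nbhs.
  have /continuous_nearP /(_ (e / 2)) := G_cont Dd1.
  rewrite divr_gt0// => /(_ isT); exact.
have Fp := nbhs_filter (t1, b0).
have n1 : nbhs (t1, b0) (P1 @^-1` [set d | D d /\ `|G d - G d1| < e / 2]) by exact: c1.
have n2 : nbhs (t1, b0) (P2 @^-1` [set d | D d /\ `|G d - G d1| < e / 2]) by exact: c2.
have : nbhs (t1, b0) [set p | D (P1 p) /\ `|G (P1 p) - G (P2 p)| <= e].
  apply: filterS2 n1 n2 => p [D1 G1] [D2 G2]; split => //.
  have -> : G (P1 p) - G (P2 p) = (G (P1 p) - G d1) - (G (P2 p) - G d1) by ring.
  apply: le_trans (ler_normB _ _) _; move: G1 G2; rewrite -/d1; lra.
by [].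
Qed.

(** The solution at a nearby parameter satisfies the equation at the given
    parameter up to a small error, so the two remain close. *)
Lemma ode_C0 : (forall b, B b -> {for b, continuous h}) ->
  forall c, cyl B c -> {for c, continuous v}.
Proof.
move=> ch c [c2 Bc]; set t0 := c 0 ord0 in c2; set b0 := vtail c in Bc.
pose T := (`|t0| + 2) / 2.
have T2 : T < 2 by rewrite /T; lra.
have T0 : 0 <= T by rewrite /T; have : 0 <= `|t0| by []; lra.
have t0T : `|t0| < T by rewrite /T; lra.
apply/continuous_nearP => e e0.
have e60 : 0 < e / 8 by rewrite divr_gt0.
have n1 : nbhs c [set d : 'rV[R]_n.+2 | `|d 0 ord0| <= T].
  have /cvgrPdist_lt /(_ (T - `|t0|)) := @coord_continuous R 1 n.+2 0 ord0 c.
  rewrite subr_gt0 => /(_ t0T); apply: filterS => d /=.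
  by have := ler_dist_dist (c 0 ord0) (d 0 ord0); rewrite ler_norml -/t0; lra.
have n2 : nbhs c [set d : 'rV[R]_n.+2 | `|v (vcons (d 0 ord0) b0) - v c| < e / 8].
  have : {for c, continuous (fun d : 'rV[R]_n.+2 => v (vcons (d 0 ord0) b0))}.
    apply: (@continuous_comp _ _ _ (fun d : 'rV[R]_n.+2 => d 0 ord0) (fun s => v (vcons s b0))).
      exact: coord_continuous.
    exact: ode_time_cont.
  move=> /cvgrPdist_lt /(_ _ e60); apply: filterS => d.
  by rewrite distrC /t0 /b0 vcons_tail.
have n3 : nbhs c [set d : 'rV[R]_n.+2 | forall t, `|t| <= T ->
    D (vcons (v (vcons t b0)) (vcons t (vtail d))) /\
    `|G (vcons (v (vcons t b0)) (vcons t (vtail d))) - G (vcons (v (vcons t b0)) (vcons t b0))|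
      <= e / 8].
  have := uniform_source Bc T2 e60; exact: continuous_vtail.
have n4 : nbhs c [set d : 'rV[R]_n.+2 | B (vtail d)].
  by apply: continuous_vtail; exact: open_nbhs_nbhs.
have n5 : nbhs c [set d : 'rV[R]_n.+2 | `|h (vtail d) - h b0| < e / 8].
  have : \forall b \near b0, `|h b - h b0| < e / 8.
    have /cvgrPdist_lt /(_ _ e60) := ch _ Bc.
    by apply: filterS => b; rewrite distrC.
  exact: continuous_vtail.
near=> d.
have dT : `|d 0 ord0| <= T by near: d.
have Bd : B (vtail d) by near: d.
have H2 : `|v (vcons (d 0 ord0) b0) - v c| < e / 8 by near: d.
have H3 : forall t, `|t| <= T ->
    D (vcons (v (vcons t b0)) (vcons t (vtail d))) /\
    `|G (vcons (v (vcons t b0)) (vcons t (vtail d))) - G (vcons (v (vcons t b0)) (vcons t b0))|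
      <= e / 8 by near: d.
have H5 : `|h (vtail d) - h b0| < e / 8 by near: d.
have T02 : 0 <= T <= 2 by rewrite T0 ltW.
have := @ode_estimate R (fun t => v (vcons t (vtail d)) - v (vcons t b0))
  (fun t => G (vcons (v (vcons t (vtail d))) (vcons t (vtail d)))
            - G (vcons (v (vcons t b0)) (vcons t b0))) T (e / 8) (e / 8) T02 (ltW e60).
have tT2 (t : R) : `|t| <= T -> `|t| < 2 by move=> tT; exact: le_lt_trans tT T2.
move=> H; have {}H := H _ _ _ _ dT; rewrite vcons_tail in H.
have : `|v d - v (vcons (d 0 ord0) b0)| <= 2 * (e / 8 + 2 * (e / 8)).
  apply: H.
  - by move=> t /tT2 t2; apply: is_deriveB; exact: ode_time.
  - move=> t tT; have [D1 G1] := H3 t tT; have t2 := tT2 _ tT.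
    have := G_lip (vD (cyl_vcons t2 Bd)) D1.
    set x := G _; set y := G _ in G1 *; set z := G _ in G1 *.
    have -> : x - z = (x - y) + (y - z) by ring.
    move=> h1; apply: le_trans (ler_normD _ _) _.
    have : 0 <= `|v (vcons t (vtail d)) - v (vcons t b0)| by [].
    by move: h1 G1; lra.
  - by rewrite !v_ini//; exact: ltW.
have -> : v d - v c = (v d - v (vcons (d 0 ord0) b0)) + (v (vcons (d 0 ord0) b0) - v c) by ring.
move=> h1; apply: le_lt_trans (ler_normD _ _) _; move: h1 H2; lra.
Unshelve. all: by end_near. Qed.

Section Derivatives.
Hypothesis G_C1 : Ck 1 D G.
Hypothesis G_al : forall d, D d -> `|partial ord0 G d| <= 8^-1.
Hypothesis h_C1 : Ck 1 B h.

Let gam b t := vcons (v (vcons t b)) (vcons t b).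

Let gam_D b t : B b -> `|t| < 2 -> D (gam b t).
Proof. by move=> Bb t2; apply: vD; exact: cyl_vcons. Qed.

Let gam_cont b t : B b -> `|t| < 2 -> {for t, continuous (gam b)}.
Proof.
move=> Bb t2; apply: continuous_vcons; first exact: ode_time_cont.
by apply: continuous_vcons; [exact: cvg_id|exact: cst_continuous].
Qed.

Let partial_gam_cont j b t : B b -> `|t| < 2 ->
  {for t, continuous (fun s => partial j G (gam b s))}.
Proof.
move=> Bb t2; apply: (@continuous_comp _ _ _ (gam b) (partial j G)); first exact: gam_cont.
by have [_ +] := G_C1 j; apply; exact: gam_D.
Qed.

Let linear_error (X A A1 b b1 dv s e : R) : 0 < e -> `|A - A1| < e / 3 ->
  `|b - b1| < e / 3 -> `|X - (dv * A1 + s * b1)| <= e / 3 * (`|s| + `|dv|) ->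
  `|X - A * dv - b * s| <= e * (`|s| + `|dv|).
Proof.
move=> e0 h3 h4 h6.
have -> : X - A * dv - b * s =
  (X - (dv * A1 + s * b1)) - (A - A1) * dv - (b - b1) * s by ring.
apply: le_trans (ler_normB _ _) _; apply: le_trans (lerD (ler_normB _ _) (lexx _)) _.
rewrite !normrM.
have : `|A - A1| * `|dv| <= e / 3 * `|dv| by rewrite ler_wpM2r// ltW.
have : `|b - b1| * `|s| <= e / 3 * `|s| by rewrite ler_wpM2r// ltW.
have : 0 <= e * (`|s| + `|dv|) by rewrite mulr_ge0 ?addr_ge0// ltW.
move: h6; lra.
Qed.

(* the equation is linearized uniformly along a solution, by compactness of the
   time interval and strict differentiability of the right-hand side *)
Let uniform_linear b0 k T e : B b0 -> T < 2 -> 0 < e ->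
  \forall s \near (0 : R), forall t, `|t| <= T ->
    `|G (gam (b0 + s *: delta_mx 0 k) t) - G (gam b0 t)
      - partial ord0 G (gam b0 t)
          * (v (vcons t (b0 + s *: delta_mx 0 k)) - v (vcons t b0))
      - partial (lift ord0 (lift ord0 k)) G (gam b0 t) * s|
    <= e * (`|s| + `|v (vcons t (b0 + s *: delta_mx 0 k)) - v (vcons t b0)|).
Proof.
move=> Bb T2 e0.
pose al t := partial ord0 G (gam b0 t).
pose be t := partial (lift ord0 (lift ord0 k)) G (gam b0 t).
pose bs s := b0 + s *: delta_mx 0 k.
pose P (s t : R) := `|G (gam (bs s) t) - G (gam b0 t)
      - al t * (v (vcons t (bs s)) - v (vcons t b0)) - be t * s|
    <= e * (`|s| + `|v (vcons t (bs s)) - v (vcons t b0)|).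
have /compact_near_coveringP cov := @segment_compact R (- T) T.
have := cov R (nbhs (0 : R)) P _.
suff H : forall t1, `[- T, T]%classic t1 -> \forall t \near t1 & s \near nbhs (0 : R), P s t.
  move=> /(_ (nbhs_filter _) H); apply: filterS => s Hs t tT.
  by apply: Hs; rewrite /= in_itv/= -ler_norml.
move=> t1; rewrite /= in_itv/= -ler_norml => tT.
have t12 : `|t1| < 2 by exact: le_lt_trans tT T2.
pose p1 (p : R * R) := gam (bs p.2) p.1.
pose p2 (p : R * R) := gam b0 p.1.
have c0 : {for (t1, 0), continuous (fun p : R * R => vcons p.1 (bs p.2))}.
  apply: continuous_vcons; first exact: cvg_fst.
  apply: continuousD; first exact: cst_continuous.
  apply: continuousZr_tmp; exact: cvg_snd.
have bs0 : bs 0 = b0 by rewrite /bs scale0r addr0.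
have c1 : {for (t1, 0), continuous p1}.
  apply: continuous_vcons => //.
  apply: (@continuous_comp _ _ _ (fun p : R * R => vcons p.1 (bs p.2)) v) => //.
  rewrite /= bs0; apply: ode_C0; last exact: cyl_vcons.
  by move=> b Bb'; have := Ck_pred oB h_C1; exact.
have c2 : {for (t1, 0), continuous p2}.
  apply: (@continuous_comp _ _ _ fst (gam b0)); first exact: cvg_fst.
  exact: gam_cont.
have e30 : 0 < e / 3 by rewrite divr_gt0.
have [r r0 Hr] := C1_strict oD G_C1 (gam_D Bb t12) e30.
have Fp := nbhs_filter (t1, 0 : R).
have ball_nbhs : nbhs (gam b0 t1) [set d : 'rV[R]_n.+3 | `|d - gam b0 t1| < r].
  by apply/nbhs_rVP; exists r.
have n1 : nbhs (t1, 0 : R) (p1 @^-1` [set d | `|d - gam b0 t1| < r]).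
  by apply: c1; rewrite /p1/= bs0.
have n2 : nbhs (t1, 0 : R) (p2 @^-1` [set d | `|d - gam b0 t1| < r]) by exact: c2.
have near_partial j : nbhs (t1, 0 : R)
    [set p : R * R | `|partial j G (gam b0 p.1) - partial j G (gam b0 t1)| < e / 3].
  have : \forall t \near t1, `|partial j G (gam b0 t) - partial j G (gam b0 t1)| < e / 3.
    by have /continuous_nearP := @partial_gam_cont j b0 t1 Bb t12; exact.
  exact: (@cvg_fst _ _ (nbhs t1) (nbhs (0 : R))).
suff : nbhs (t1, 0 : R) [set p | P p.2 p.1] by [].
apply: filterS2 (filterI n1 n2) (filterI (near_partial ord0)
  (near_partial (lift ord0 (lift ord0 k)))) => -[t s] /= [h1 h2] [h3 h4].
have := Hr _ _ h1 h2.
set dv := v (vcons t (bs s)) - v (vcons t b0).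
have -> : p1 (t, s) - p2 (t, s) = vcons dv (vcons 0 (s *: delta_mx 0 k)).
  rewrite /p1 /p2 /gam/= -scaleN1r !vconsZ !vconsD !mulN1r subrr /bs scaleN1r.
  by rewrite addrAC subrr add0r.
rewrite (_ : \sum_j _ = dv * partial ord0 G (gam b0 t1)
   + s * partial (lift ord0 (lift ord0 k)) G (gam b0 t1)); last first.
  rewrite big_ord_recl vcons0; congr (_ + _).
  rewrite big_ord_recl/= !vconsS vcons0 mul0r add0r (bigD1 k)//= big1 ?addr0.
    by rewrite !vconsS !mxE !eqxx mulr1.
  by move=> j jk; rewrite !vconsS !mxE (negPf jk) andbF mulr0 mul0r.
have nle : `|vcons dv (vcons 0 (s *: delta_mx 0 k)) : 'rV[R]_n.+3| <= `|s| + `|dv|.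
  apply: coords_le; first by rewrite addr_ge0.
  move=> j; case: (unliftP ord0 j) => [l|] ->; last by rewrite vcons0 lerDr.
  rewrite vconsS; case: (unliftP ord0 l) => [m|] ->.
    by rewrite vconsS !mxE eqxx/=; case: (m == k); rewrite ?mulr1 ?mulr0 ?normr0 ?addr_ge0// lerDl.
  by rewrite vcons0 normr0 addr_ge0.
move=> h5; rewrite /P -/dv /al /be.
have h6 := le_trans h5 (ler_wpM2l (ltW e30) nle).
exact: linear_error e0 h3 h4 h6.
Qed.

(* the solution of the linearized equation is the derivative of the solution with
   respect to the parameter *)
Let ode_deriv b0 k T : B b0 -> 0 <= T < 2 -> exists w : R -> R,
  [/\ w 0 = partial k h b0,
     forall t : R, `|t| <= T -> is_derive t 1 w (partial ord0 G (gam b0 t) * w t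
       + partial (lift ord0 (lift ord0 k)) G (gam b0 t)) &
     forall t : R, `|t| <= T ->
       is_derive (vcons t b0) (delta_mx 0 (lift ord0 k)) v (w t)].
Proof.
move=> Bb /andP[T0 T2].
pose al t := partial ord0 G (gam b0 t).
pose be t := partial (lift ord0 (lift ord0 k)) G (gam b0 t).
(* the equation is solved on a slightly longer interval, in whose interior the
   closed interval of radius [T] lies *)
pose T' := (T + 2) / 2.
have T'2 : T' < 2 by rewrite /T'; lra.
have TT' : T < T' by rewrite /T'; lra.
have al8 t : `|t| < 2 -> `|al t| <= 8^-1 by move=> t2; apply/G_al/gam_D.
have [|y cy t tT|t y z tT|w [w0 dw]] := @picard R (fun t y => al t * y + be t)
  (partial k h b0) T'.
- by rewrite ltW ?andbT//; lra.
- have t2 : `|t| < 2 by exact: le_lt_trans tT T'2.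
  apply: continuousD; last exact: partial_gam_cont.
  by apply: continuousM; [exact: partial_gam_cont|exact: cy].
- rewrite [X in `|X|](_ : _ = al t * (y - z)); last by ring.
  rewrite normrM ler_wpM2r// al8//; exact: le_lt_trans tT T'2.
have {}dw (t : R) : `|t| <= T -> is_derive t 1 w (al t * w t + be t).
  by move=> tT; apply: dw; exact: le_lt_trans tT TT'.
exists w; split => // t tT.
have T02 : 0 <= T <= 2 by rewrite T0 ltW.
have [M beM] : exists M, forall t, `|t| <= T -> `|be t| <= M.
  have cb : {within `[- T, T], continuous (fun t => `|be t|)}.
    apply/continuous_in_subspaceT => s; rewrite inE/= in_itv/= -ler_norml => sT.
    apply: continuous_comp; last exact: norm_continuous.
    by apply: partial_gam_cont => //; exact: le_lt_trans sT T2.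
  have [|s sT Hs] := EVT_max (_ : - T <= T) cb; first lra.
  by exists `|be s| => u uT; apply: Hs; rewrite in_itv/= -ler_norml.
have [r r0 Br] := open_norm oB Bb.
have line_le (s : R) : `|b0 + s *: delta_mx 0 k - b0| <= `|s|.
  apply: coords_le => // j; rewrite addrAC subrr add0r !mxE eqxx/=.
  by case: (j == k); rewrite ?mulr1 ?mulr0 ?normr0.
have Bs s : `|s| < r -> B (b0 + s *: delta_mx 0 k).
  by move=> sr; apply: Br; exact: le_lt_trans (line_le s) sr.
have := @ode_param_derive R (fun s t => v (vcons t (b0 + s *: delta_mx 0 k)))
  (fun s t => G (gam (b0 + s *: delta_mx 0 k) t)) al be w T M T02 _ dw _ beM.
move=> H.
have := @is_derive_line R _ R v (vcons t b0) (delta_mx 0 (lift ord0 k)) 0 (w t).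
rewrite scale0r addr0 => -[_ +]; apply.
have -> : (fun s => v (vcons t b0 + s *: delta_mx 0 (lift ord0 k))) =
    (fun s => v (vcons t (b0 + s *: delta_mx 0 k))).
  by apply/funext => s; rewrite vcons_lineS.
apply: H => //.
- exists r => // s sr u uT; apply: ode_time; first exact: Bs.
  exact: le_lt_trans uT T2.
- by move=> u uT; apply: al8; exact: le_lt_trans uT T2.
- apply: (@near_eq_is_derive _ _ _ (fun s : R => h (b0 + s *: delta_mx 0 k))).
    apply/nbhs_ballP; exists r => //= s; rewrite /ball/= sub0r normrN => sr.
    by rewrite v_ini//; exact: Bs.
  apply: (@is_derive_line R _ R h b0 (delta_mx 0 k) 0 _).1.
  rewrite scale0r addr0 w0; apply: DeriveDef => //.
  by have [+ _] := h_C1 k; exact.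
- move=> e e0; have /nbhs_ballP[d /= d0 Hd] := uniform_linear k Bb T2 e0.
  exists d => // s sd u uT; rewrite scale0r addr0; apply: Hd => //.
  by rewrite /ball/= sub0r normrN.
Qed.

Lemma ode_derivable k c : cyl B c -> derivable v c (delta_mx 0 (lift ord0 k)).
Proof.
move=> [c2 Bc]; have : 0 <= `|c 0 ord0| < 2 by rewrite normr_ge0.
move=> /(ode_deriv k Bc)[w [_ _ /(_ (c 0 ord0) (lexx _))]].
by rewrite vcons_tail => -[].
Qed.

Lemma ode_derivative_ini k b : B b ->
  partial (lift ord0 k) v (vcons 0 b) = partial k h b.
Proof.
move=> Bb; have : 0 <= (0 : R) < 2 by rewrite lexx/= ltr0n.
by move=> /(ode_deriv k Bb)[w [<- _ /(_ 0)]]; rewrite normr0 lexx => /(_ isT)[_ <-].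
Qed.

Lemma ode_derivative k c : cyl B c ->
  is_derive c (delta_mx 0 ord0) (partial (lift ord0 k) v)
    (partial ord0 G (vcons (v c) c) * partial (lift ord0 k) v c
     + partial (lift ord0 (lift ord0 k)) G (vcons (v c) c)).
Proof.
move=> [c2 Bc]; set t0 := c 0 ord0 in c2; set b0 := vtail c in Bc.
have tT : `|t0| < (`|t0| + 2) / 2 by lra.
have T02 : 0 <= (`|t0| + 2) / 2 < 2.
  by apply/andP; split; [have : 0 <= `|t0| by []|]; lra.
have [w [w0 dw dvw]] := ode_deriv k Bc T02.
have vw t : `|t| <= (`|t0| + 2) / 2 -> partial (lift ord0 k) v (vcons t b0) = w t.
  by move=> /dvw[].
have := @is_derive_line R _ R (partial (lift ord0 k) v) (vcons 0 b0) (delta_mx 0 ord0) t0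
  (partial ord0 G (vcons (v c) c) * partial (lift ord0 k) v c
     + partial (lift ord0 (lift ord0 k)) G (vcons (v c) c)).
rewrite vcons_line0 add0r vcons_tail => -[_]; apply.
apply: (@near_eq_is_derive _ _ _ w).
  have /continuous_nearP /(_ ((`|t0| + 2) / 2 - `|t0|)) := @cvg_id _ (nbhs t0).
  rewrite subr_gt0 => /(_ tT); apply: filterS => s /= Hs.
  rewrite vcons_line0 add0r vw//.
  have : `|s| <= `|s - t0| + `|t0| by rewrite -{1}(subrK t0 s) ler_normD.
  by move: Hs; lra.
have := dw t0 (ltW tT); rewrite /gam -vw; last exact: ltW.
by rewrite vcons_tail.
Qed.

End Derivatives.
End Solution.

(** The derivatives of the solution of a linear equation solve linear equations
    with the same leading coefficient, so regularity propagates by induction. *)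
Lemma ode_linear_Ck k (B : set E) (al be w : 'rV[R]_n.+2 -> R) (h : E -> R) :
  open B -> Ck k (cyl B) al -> Ck k (cyl B) be -> Ck k B h ->
  (forall c, cyl B c -> `|al c| <= 8^-1) ->
  (forall c, cyl B c -> is_derive c (delta_mx 0 ord0) w (al c * w c + be c)) ->
  (forall b, B b -> w (vcons 0 b) = h b) -> Ck k (cyl B) w.
Proof.
move=> oB; have oC := open_cyl oB.
elim: k be h w => [|k IH] be h w Cal Cbe Ch al8 dw w0.
  pose G (d : 'rV[R]_n.+3) := al (vtail d) * d 0 ord0 + be (vtail d).
  pose D : set 'rV[R]_n.+3 := [set d | cyl B (vtail d)].
  have oD : open D.
    by apply: open_comp => // d _; exact: continuous_vtail.
  apply: (@ode_C0 B G D w h) => //.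
  - move=> d Dd; apply: continuousD.
      apply: continuousM; last exact: coord_continuous.
      apply: (@continuous_comp _ _ _ (@vtail R n.+2) al); first exact: continuous_vtail.
      exact: Cal.
    apply: (@continuous_comp _ _ _ (@vtail R n.+2) be); first exact: continuous_vtail.
    exact: Cbe.
  - by move=> c Bc; rewrite /D/= vconsK.
  - move=> c y1 y2; rewrite /D/= vconsK => Bc _; rewrite /G !vconsK !vcons0.
    rewrite [X in `|X|](_ : _ = al c * (y1 - y2)); last by ring.
    by rewrite normrM ler_wpM2r// al8.
  - by move=> c Bc; rewrite /G vconsK vcons0; exact: dw.
have Hw : Ck k (cyl B) w.
  by apply: (IH be h w) => //; exact: Ck_pred.
pose G (d : 'rV[R]_n.+3) := al (vtail d) * d 0 ord0 + be (vtail d).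
pose D : set 'rV[R]_n.+3 := [set d | cyl B (vtail d)].
have oD : open D.
  by apply: open_comp => // d _; exact: continuous_vtail.
have G1 : Ck 1 D G.
  apply: CkD => //; first apply: CkM => //; last 1 first.
  - apply: (@Ck_comp _ _ _ 1 D (cyl B)) => //; first exact: (@Ck_le _ _ _ k.+1).
    by move=> j; exact: smooth_vtail.
  - apply: (@Ck_comp _ _ _ 1 D (cyl B)) => //; first exact: (@Ck_le _ _ _ k.+1).
    by move=> j; exact: smooth_vtail.
  - exact: Ck_coord.
have Dv c : cyl B c -> D (vcons (w c) c) by move=> Bc; rewrite /D/= vconsK.
have lineG y c j : cyl B c -> is_derive (vcons y c) (delta_mx 0 (lift ord0 j)) G
    (partial j al c * y + partial j be c).
  move=> Bc; have := @is_derive_line R _ R G (vcons y c) (delta_mx 0 (lift ord0 j)) 0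
    (partial j al c * y + partial j be c).
  rewrite scale0r addr0 => -[_]; apply.
  rewrite (_ : (fun s => _) = fun s : R => al (c + s *: delta_mx 0 j) * y + be (c + s *: delta_mx 0 j)); last first.
    by apply/funext => s; rewrite vcons_lineS /G vconsK vcons0.
  have d1 (f : 'rV[R]_n.+2 -> R) : Ck k.+1 (cyl B) f ->
      is_derive (0 : R) 1 (fun s => f (c + s *: delta_mx 0 j)) (partial j f c).
    move=> Hf; apply: (@is_derive_line R _ R f c (delta_mx 0 j) 0 _).1.
    by rewrite scale0r addr0; apply: DeriveDef => //; have [+ _] := Hf j; exact.
  apply: is_deriveD; last exact: d1.
  have da := d1 _ Cal.
  apply: is_derive_eq; rewrite scale0r addr0 scaler0 add0r /GRing.scale/= mulrC//.
have lineG0 y c : cyl B c -> partial ord0 G (vcons y c) = al c.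
  move=> Bc; have : is_derive (vcons y c) (delta_mx 0 ord0) G (al c).
    have := @is_derive_line R _ R G (vcons y c) (delta_mx 0 ord0) 0 (al c).
    rewrite scale0r addr0 => -[_]; apply.
    rewrite (_ : (fun s => _) = fun s : R => al c * (y + s) + be c); last first.
      by apply/funext => s; rewrite vcons_line0 /G vconsK vcons0.
    apply: is_derive_eq; rewrite /GRing.scale/=; ring.
  by move=> -[_].
have Glip c y1 y2 : D (vcons y1 c) -> D (vcons y2 c) ->
    `|G (vcons y1 c) - G (vcons y2 c)| <= 8^-1 * `|y1 - y2|.
  rewrite /D/= vconsK => Bc _; rewrite /G !vconsK !vcons0.
  rewrite [X in `|X|](_ : _ = al c * (y1 - y2)); last by ring.
  by rewrite normrM ler_wpM2r// al8.
have dw' c : cyl B c -> is_derive c (delta_mx 0 ord0) w (G (vcons (w c) c)).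
  by move=> Bc; rewrite /G vconsK vcons0; exact: dw.
have Gal d : D d -> `|partial ord0 G d| <= 8^-1.
  by move=> Dd; rewrite -(vcons_tail d) lineG0//; exact: al8.
have h1 : Ck 1 B h by exact: (@Ck_le _ _ _ k.+1).
have Gc d : D d -> {for d, continuous G}.
  by move=> Dd; have := Ck_pred oD G1; exact.
move=> i; case: (unliftP ord0 i) => [j|] ->; split.
- move=> c Bc; exact: (@ode_derivable B G D w h).
- apply: (IH (fun c => partial (lift ord0 j) al c * w c + partial (lift ord0 j) be c)
    (partial j h)) => //.
  + exact: Ck_pred.
  + by apply: CkD => //; [apply: CkM => //; have [] := Cal (lift ord0 j)|have [] := Cbe (lift ord0 j)].
  + by have [] := Ch j.
  + move=> c Bc; have := @ode_derivative B G D w h oB oD Gc Dv Glip dw' w0 G1 Gal h1 j c Bc.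
    rewrite lineG0//; have [_] := lineG (w c) c (lift ord0 j) Bc.
    by rewrite -/(partial _ _ _) => ->.
  + by move=> b Bb; exact: (@ode_derivative_ini B G D w h).
- by move=> c Bc; have [] := dw c Bc.
- apply: Ck_eq (CkD oC (CkM oC (Ck_pred oC Cal) Hw) (Ck_pred oC Cbe)) => // c Bc.
  by have [_ <-] := dw c Bc.
Qed.

(** The derivatives of the solution satisfy linear equations whose coefficients
    are as regular as the solution, so each degree of regularity gives the next
    one. *)
Lemma ode_smooth (B : set E) (G : 'rV[R]_n.+3 -> R) (D : set 'rV[R]_n.+3)
    (v : 'rV[R]_n.+2 -> R) (h : E -> R) :
  open B -> open D -> smooth D G -> smooth B h ->
  (forall c, cyl B c -> D (vcons (v c) c)) ->
  (forall c y1 y2 z, D (vcons y1 c) -> D (vcons y2 c) ->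
     Num.min y1 y2 <= z <= Num.max y1 y2 -> D (vcons z c)) ->
  (forall d, D d -> `|partial ord0 G d| <= 8^-1) ->
  (forall c, cyl B c -> is_derive c (delta_mx 0 ord0) v (G (vcons (v c) c))) ->
  (forall b, B b -> v (vcons 0 b) = h b) -> smooth (cyl B) v.
Proof.
move=> oB oD sG sh Dv Dconv Gal dv v0; have oC := open_cyl oB.
have Glip := C1_lip (sG 1%N) Dconv Gal.
have Gc d : D d -> {for d, continuous G} by move=> Dd; exact: smooth_continuous sG Dd.
elim=> [|k IH].
  apply: (@ode_C0 B G D v h) => // b Bb; exact: smooth_continuous sh Bb.
have comp (f : 'rV[R]_n.+3 -> R) : smooth D f -> Ck k (cyl B) (fun c => f (vcons (v c) c)).
  move=> sf; apply: (@Ck_comp _ _ _ k (cyl B) D) => //.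
  by apply: Ck_vcons => // j; exact: Ck_coord.
move=> i; case: (unliftP ord0 i) => [j|] ->; split.
- by move=> c Bc; exact: (@ode_derivable B G D v h).
- apply: (@ode_linear_Ck k B (fun c => partial ord0 G (vcons (v c) c))
    (fun c => partial (lift ord0 (lift ord0 j)) G (vcons (v c) c)) _ (partial j h)) => //.
  + by apply: comp; exact: smooth_partial.
  + by apply: comp; exact: smooth_partial.
  + by have [] := sh k.+1 j.
  + by move=> c Bc; apply: Gal; exact: Dv.
  + by move=> c Bc; exact: (@ode_derivative B G D v h).
  + by move=> b Bb; exact: (@ode_derivative_ini B G D v h).
- by move=> c Bc; have [] := dv c Bc.
- apply: Ck_eq (comp _ sG) => // c Bc.
  by have [_ <-] := dv c Bc.
Qed.

End ODE.

(** * Integrable hyperplane fields *)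

Lemma nbhs_forall {T : topologicalType} {I : finType} (P : I -> set T) (a : T) :
  (forall i, nbhs a (P i)) -> nbhs a [set x | forall i, P i x].
Proof. exact: filter_forall. Qed.

Lemma is_derive_bigsum {R : realType} {V W : normedModType R} (x v : V)
    (I : Type) (s : seq I) (P : pred I) (h : I -> V -> W) (dh : I -> W) :
  (forall i, P i -> is_derive x v (h i) (dh i)) ->
  is_derive x v (fun y => \sum_(i <- s | P i) h i y) (\sum_(i <- s | P i) dh i).
Proof.
move=> H; elim: s => [|i s IH].
  rewrite big_nil (_ : (fun y => _) = cst 0); first exact: is_derive_cst.
  by apply/funext => y; rewrite big_nil.
rewrite big_cons; have [Pi|nPi] := boolP (P i).
  rewrite (_ : (fun y => _) = h i + (fun y => \sum_(j <- s | P j) h j y)).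
    by have Hi := H i Pi; exact: is_deriveD.
  by apply/funext => y; rewrite big_cons Pi.
rewrite (_ : (fun y => _) = (fun y => \sum_(j <- s | P j) h j y))//.
by apply/funext => y; rewrite big_cons (negPf nPi).
Qed.

Lemma is_derive_mul {R : realType} {V : normedModType R} (f g : V -> R) (x v : V)
    (df dg : R) : is_derive x v f df -> is_derive x v g dg ->
  is_derive x v (fun y => f y * g y) (df * g x + f x * dg).
Proof.
move=> Hf Hg; apply: (is_derive_eq (is_deriveM Hf Hg)).
by rewrite addrC /GRing.scale/= [g x * _]mulrC.
Qed.

Lemma is_derive_mulr {R : realType} {V : normedModType R} (f : V -> R) (x v : V)
    (df k : R) : is_derive x v f df -> is_derive x v (fun y => f y * k) (df * k).
Proof.
move=> Hf; apply: (is_derive_eq (is_derive_mul Hf (is_derive_cst k x v))).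
by rewrite mulr0 addr0.
Qed.

Lemma is_derive_coord {R : realType} {m : nat} (c v : 'rV[R]_m.+1) i :
  is_derive c v (fun x : 'rV[R]_m.+1 => x 0 i) (v 0 i).
Proof.
have did := @derivable_id R 'rV[R]_m.+1 c v.
apply: DeriveDef; first by have /derivable_mxP := did; exact.
have := derive_mx did; rewrite derive_id => /(congr1 (fun M : 'rV[R]_m.+1 => M 0 i)).
by rewrite mxE => <-.
Qed.

Lemma partial_vconsS {R : realType} {m : nat} {W : normedModType R}
    (f : 'rV[R]_m.+2 -> W) (t : R) (b : 'rV[R]_m.+1) k :
  partial k (fun x => f (vcons t x)) b = partial (lift ord0 k) f (vcons t b).
Proof.
have E : (fun h : R => h^-1 *: (f (vcons t (h *: delta_mx 0 k + b)) - f (vcons t b)))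
  = (fun h => h^-1 *: (f (h *: delta_mx 0 (lift ord0 k) + vcons t b) - f (vcons t b))).
  apply/funext => h; congr (_ *: (f _ - _)).
  by rewrite addrC -vcons_lineS addrC.
by rewrite /partial /derive E.
Qed.

Lemma clamp_lip {R : realType} (T y z : R) : 0 <= T ->
  `|clamp T y - clamp T z| <= `|y - z|.
Proof.
move=> T0; rewrite /clamp.
have mT : Num.max (- T) T = T by apply/max_idPr; lra.
have b1 := ler_norm (y - z); have b2 := ler_norm (- (y - z)); rewrite normrN in b2.
case: (leP T y) => hy; case: (leP T z) => hz; rewrite ?mT.
- by rewrite subrr normr0.
- case: (leP (- T) z) => h; rewrite ler_norml; apply/andP; split; lra.
- case: (leP (- T) y) => h; rewrite ler_norml; apply/andP; split; lra.
- case: (leP (- T) y) => h; case: (leP (- T) z) => h'; rewrite ler_norml;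
  apply/andP; split; lra.
Qed.

Section Mayer.
Context {R : realType} {n : nat}.
Local Notation E := 'rV[R]_n.+1.
Variables (F : 'I_n.+1 -> E -> R) (a : E) (i0 : 'I_n.+1) (r M : R).
Hypothesis r0 : 0 < r.
Hypothesis M0 : 0 <= M.
Let W0 : set E := [set x | `|x - a| < r].
Hypothesis sF : forall j, smooth W0 (F j).
Hypothesis F_le : forall j x, W0 x -> `|F j x| <= M.
Hypothesis dF_le : forall j x, W0 x -> `|partial i0 (F j) x| <= M.
Hypothesis F_integrable : forall j k x, j != i0 -> k != i0 -> W0 x ->
  partial j (F k) x + F j x * partial i0 (F k) x
  = partial k (F j) x + F k x * partial i0 (F j) x.

(* the equation along the rays has a Lipschitz constant and a speed at most [s] for
   end points in the ball of radius [rho]: the first makes the theorem on smooth dependence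
   applicable, the second keeps the solutions within distance [r] during time 2 *)
Let s := Num.min 8^-1 (r / 16).
Let rho := Num.min (r / 8) (s / (n.+1%:R * M + 1)).
Let B : set E := [set b | `|b - a| < rho].

Let s0 : 0 < s. Proof. by rewrite lt_min invr_gt0 divr_gt0// ltr0n. Qed.
Let NM0 : 0 < n.+1%:R * M + 1.
Proof. by rewrite ltr_wpDl// mulr_ge0. Qed.
Let rho0 : 0 < rho. Proof. by rewrite lt_min !divr_gt0. Qed.
Let rho_r : rho <= r / 8. Proof. by rewrite ge_min lexx. Qed.

Let sum_le (P : pred 'I_n.+1) (u b : 'I_n.+1 -> R) :
  (forall j, `|u j| <= M) -> (forall j, `|b j| <= rho) ->
  `|\sum_(j | P j) u j * b j| <= s.
Proof.
move=> uM br; apply: le_trans (ler_norm_sum _ _ _) _.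
have : \sum_(j | P j) `|u j * b j| <= \sum_(j < n.+1) M * rho.
  rewrite big_mkcond; apply: ler_sum => j _; case: ifP => _.
    by rewrite normrM ler_pM.
  by rewrite mulr_ge0// ltW.
move/le_trans; apply; rewrite sumr_const card_ord -mulr_natl.
have : rho <= s / (n.+1%:R * M + 1) by rewrite ge_min lexx orbT.
rewrite ler_pdivlMr// => H; apply: le_trans H.
by rewrite mulrA mulrC ler_wpM2l ?(ltW rho0)// lerDl.
Qed.

(* the point of the segment from [b] to [a] at time [t], except for the
   distinguished coordinate [y] *)
Let gam (y t : R) (b : E) : E :=
  \row_j (if j == i0 then y else a 0 j + (1 - t) * (b 0 j - a 0 j)).

Let gam_in y t b : `|y - a 0 i0| < r -> `|t| < 3 -> B b -> W0 (gam y t b).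
Proof.
move=> yr t3 br; apply: coords_lt => // j; rewrite !mxE.
have [->//|_] := eqVneq j i0; rewrite addrAC subrr add0r normrM.
have h1 : `|b 0 j - a 0 j| <= rho.
  by apply: le_trans (ltW br); have := coord_le (b - a) j; rewrite !mxE.
have h2 : `|1 - t| <= 4 by apply: le_trans (ler_normB _ _) _; rewrite normr1; lra.
apply: (@le_lt_trans _ _ (4 * rho)); first by rewrite ler_pM.
move: rho_r r0; lra.
Qed.

(* the same point as a function of the value, the time and the end point *)
Let gamd (d : 'rV[R]_n.+3) : E := \row_j (if j == i0 then d 0 ord0
  else a 0 j + (1 - d 0 (lift ord0 ord0)) * (d 0 (lift ord0 (lift ord0 j)) - a 0 j)).

Let gamd_vcons y t b : gamd (vcons y (vcons t b)) = gam y t b.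
Proof. by apply/rowP => j; rewrite [LHS]mxE [RHS]mxE !vconsS !vcons0. Qed.

Let G (d : 'rV[R]_n.+3) : R := - \sum_(j | j != i0)
  F j (gamd d) * (d 0 (lift ord0 (lift ord0 j)) - a 0 j).

Let G_vcons y t b : G (vcons y (vcons t b)) =
  - \sum_(j | j != i0) F j (gam y t b) * (b 0 j - a 0 j).
Proof.
by rewrite /G gamd_vcons; congr (- _); apply: eq_bigr => j _; rewrite !vconsS.
Qed.

Let D : set 'rV[R]_n.+3 := [set d : 'rV[R]_n.+3 | [/\ `|d 0 ord0 - a 0 i0| < r,
  `|d 0 (lift ord0 ord0)| < 3 & B (vtail (vtail d))]].

Let D_vcons y t b : D (vcons y (vcons t b)) <->
  [/\ `|y - a 0 i0| < r, `|t| < 3 & B b].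
Proof. by rewrite /D/= !vconsK vconsS !vcons0. Qed.

Let coord_lt_open (m : nat) (j : 'I_m.+1) (y e : R) :
  open [set d : 'rV[R]_m.+1 | `|d 0 j - y| < e].
Proof.
apply: (@open_comp _ _ (fun d : 'rV[R]_m.+1 => `|d 0 j - y|) [set u | u < e]).
  move=> d _; apply: (@continuous_comp _ _ _ (fun d : 'rV[R]_m.+1 => d 0 j - y) Num.norm).
    apply: continuousD; [exact: coord_continuous|exact: cst_continuous].
  exact: norm_continuous.
exact: open_lt.
Qed.

Let oB : open B.
Proof.
rewrite openE => b Bb; apply/nbhs_rVP; exists (rho - `|b - a|); first by rewrite subr_gt0.
move=> x xb; rewrite /B/= -(subrKA b); apply: le_lt_trans (ler_normD _ _) _.
by rewrite -ltrBrDr.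
Qed.

Let oW0 : open W0.
Proof.
rewrite openE => b Bb; apply/nbhs_rVP; exists (r - `|b - a|); first by rewrite subr_gt0.
move=> x xb; rewrite /W0/= -(subrKA b); apply: le_lt_trans (ler_normD _ _) _.
by rewrite -ltrBrDr.
Qed.

Let oD : open D.
Proof.
have -> : D = [set d : 'rV[R]_n.+3 | `|d 0 ord0 - a 0 i0| < r] `&`
  [set d : 'rV[R]_n.+3 | `|d 0 (lift ord0 ord0) - 0| < 3] `&`
  ((@vtail R n.+2) @^-1` ((@vtail R n.+1) @^-1` B)).
  apply/seteqP; split => d; rewrite /D/= subr0; first by move=> [h1 h2 h3]; split.
  by move=> [[h1 h2] h3]; split.
apply: openI; first by apply: openI; exact: coord_lt_open.
apply: open_comp; first by move=> d _; exact: continuous_vtail.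
by apply: open_comp => // d _; exact: continuous_vtail.
Qed.

Let gamd_in d : D d -> W0 (gamd d).
Proof.
rewrite -(vcons_tail d) -(vcons_tail (vtail d)) gamd_vcons => /D_vcons[y t b].
exact: gam_in.
Qed.

Let sgamd : smooth D gamd.
Proof.
apply: (smooth_mx gamd oD).2 => j; rewrite (_ : (fun d => _) = fun d : 'rV[R]_n.+3 =>
  if j == i0 then d 0 ord0
  else a 0 j + (1 - d 0 (lift ord0 ord0)) * (d 0 (lift ord0 (lift ord0 j)) - a 0 j)).
  case: (j == i0); first exact: smooth_coord.
  apply: smoothD => //; first exact: smooth_cst.
  apply: smoothM => //; apply: smoothB => //; do ?[exact: smooth_cst|exact: smooth_coord].
by apply/funext => d; rewrite mxE.
Qed.

Let sG : smooth D G.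
Proof.
apply: smoothN => //.
apply: (@smooth_sum _ _ D _ _ (fun j => j != i0)
  (fun j d => F j (gamd d) * (d 0 (lift ord0 (lift ord0 j)) - a 0 j))) => // j _.
apply: smoothM => //.
  exact: (smooth_comp oD oW0 gamd_in (sF j) sgamd).
by apply: smoothB => //; [exact: smooth_coord|exact: smooth_cst].
Qed.

Let B_coord b : B b -> forall j, `|b 0 j - a 0 j| <= rho.
Proof.
by move=> Bb j; apply: le_trans (ltW Bb); have := coord_le (b - a) j; rewrite !mxE.
Qed.

Let partial_G y t b : D (vcons y (vcons t b)) ->
  partial ord0 G (vcons y (vcons t b)) =
  - \sum_(j | j != i0) partial i0 (F j) (gam y t b) * (b 0 j - a 0 j).
Proof.
move=> /D_vcons[yr t3 Bb]; set c := vcons t b.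
suff [] : is_derive (vcons y c) (delta_mx 0 ord0) G
  (- \sum_(j | j != i0) partial i0 (F j) (gam y t b) * (b 0 j - a 0 j)) by [].
have := @is_derive_line R _ R G (vcons y c) (delta_mx 0 ord0) 0 (- \sum_(j | j != i0) partial i0 (F j) (gam y t b) * (b 0 j - a 0 j)).
rewrite scale0r addr0 => -[_]; apply.
rewrite (_ : (fun s => _) = (fun s => - \sum_(j | j != i0)
    F j (gam y t b + s *: delta_mx 0 i0) * (b 0 j - a 0 j))); last first.
  apply/funext => u; rewrite vcons_line0 G_vcons; congr (- _); apply: eq_bigr => j _.
  congr (F j _ * _); apply/rowP => k; rewrite !mxE eqxx/=.
  by case: (k == i0); rewrite ?mulr1 ?mulr0 ?addr0.
apply: is_deriveN; apply: is_derive_bigsum => j ji.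
apply: is_derive_mulr.
apply: (@is_derive_line R _ R (F j) (gam y t b) (delta_mx 0 i0) 0 _).1.
rewrite scale0r addr0; apply: DeriveDef => //.
by apply: smooth_derivable (sF j) _; exact: gam_in.
Qed.

Let G_al d : D d -> `|partial ord0 G d| <= 8^-1.
Proof.
rewrite -(vcons_tail d) -(vcons_tail (vtail d)) => /[dup] Dd /D_vcons[y t b].
rewrite partial_G// normrN; apply: (@le_trans _ _ s); last by rewrite ge_min lexx.
by apply: sum_le => j; [apply: dF_le; exact: gam_in|exact: B_coord].
Qed.

Let G_small d : D d -> `|G d| <= r / 16.
Proof.
rewrite -(vcons_tail d) -(vcons_tail (vtail d)) => /D_vcons[y t b].
rewrite G_vcons normrN; apply: (@le_trans _ _ s); last by rewrite ge_min lexx orbT.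
by apply: sum_le => j; [apply: F_le; exact: gam_in|exact: B_coord].
Qed.

Let D_conv c y1 y2 z : D (vcons y1 c) -> D (vcons y2 c) ->
  Num.min y1 y2 <= z <= Num.max y1 y2 -> D (vcons z c).
Proof.
rewrite -(vcons_tail c) => /D_vcons[h1 h2 h3] /D_vcons[h4 _ _] hz.
apply/D_vcons; split => //; move: h1 h4 hz; rewrite !ltr_norml.
case: (leP y1 y2) => _ /andP[? ?] /andP[? ?] /andP[? ?]; apply/andP; split; lra.
Qed.

(* the right-hand side is only controlled for values at distance less than [r], so
   the value is clamped; the solution then turns out never to reach the clamp *)
Let solution b : B b -> exists y : R -> R, y 0 = b 0 i0 /\
  forall t : R, `|t| < 2 -> `|y t - a 0 i0| < r /\
    is_derive t 1 y (G (vcons (y t) (vcons t b))).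
Proof.
move=> Bb; pose cl y := a 0 i0 + clamp (r / 2) (y - a 0 i0).
have r2 : 0 <= r / 2 by rewrite divr_ge0// ltW.
have cl_in y : `|cl y - a 0 i0| < r.
  rewrite /cl addrAC subrr add0r; apply: le_lt_trans (clamp_le _ r2) _.
  by move: r0; lra.
have Dcl y t : `|t| < 3 -> D (vcons (cl y) (vcons t b)) by move=> t3; apply/D_vcons.
have [|y cy t tT|t y z tT|y [y0 dy]] := @picard R
    (fun t y => G (vcons (cl y) (vcons t b))) (b 0 i0) 2.
- by rewrite lexx andbT ler0n.
- apply: (@continuous_comp _ _ _ (fun t => vcons (cl (y t)) (vcons t b)) G); last first.
    by apply: smooth_continuous sG _; apply: Dcl; lra.
  apply: continuous_vcons; last first.
    by apply: continuous_vcons; [exact: cvg_id|exact: cst_continuous].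
  apply: continuousD; first exact: cst_continuous.
  apply: (@continuous_comp _ _ _ (fun t => y t - a 0 i0) (clamp (r / 2))).
    by apply: continuousD; [exact: cy|exact: cst_continuous].
  exact: continuous_clamp.
- have t3 : `|t| < 3 by lra.
  apply: le_trans (C1_lip (sG 1%N) D_conv G_al (Dcl y t t3) (Dcl z t t3)) _.
  rewrite ler_wpM2l ?invr_ge0// /cl opprD addrACA subrr add0r.
  by apply: le_trans (clamp_lip _ _ r2) _; rewrite opprB addrA subrK.
exists y; split => // t t2.
have yr : `|y t - a 0 i0| < r / 2.
  have : `|y t - y 0| <= r / 16 * `|t - 0|.
    apply: (@mean_value_norm R y (fun t => G (vcons (cl (y t)) (vcons t b)))) => u ut.
      apply: dy; move: t2 ut; rewrite !ltr_norml.
      case: (leP 0 t) => _ /andP[? ?] /andP[? ?]; apply/andP; split; lra.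
    apply: G_small; apply: Dcl; move: t2 ut; rewrite !ltr_norml.
    case: (leP 0 t) => _ /andP[? ?] /andP[? ?]; apply/andP; split; lra.
  have h1 := B_coord Bb i0.
  have : r / 16 * `|t - 0| <= r / 16 * 2.
    by rewrite subr0 ler_wpM2l ?divr_ge0 ?ltW.
  have -> : y t - a 0 i0 = (y t - y 0) + (b 0 i0 - a 0 i0) by rewrite y0; ring.
  move=> h2 h3; apply: le_lt_trans (ler_normD _ _) _; move: rho_r r0 h1 h2 h3; lra.
split; first by move: r0; lra.
by have := dy _ t2; rewrite /cl clamp_id ?(ltW yr)// addrC subrK.
Qed.


(** Mayer's method: solving the total differential equation [du = sum F_j dx_j]
    backwards along the rays towards [a] yields the value of [u] at [a] as a
    function of the end point.  The derivatives of that function in the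
    directions tangent to the distribution satisfy the same linear equation along
    a ray as [(1 - t) F_k], because of the integrability condition; so they
    vanish at the end of the ray. *)
Lemma mayer : exists f : E -> R, exists2 e, 0 < e <= r &
  smooth [set b | `|b - a| < e] f /\
  forall b, `|b - a| < e -> partial i0 f b != 0 /\
    forall k, k != i0 -> partial k f b = - F k b * partial i0 f b.
Proof.
have /choice[Y HY] (b : E) : exists y : R -> R, B b -> y 0 = b 0 i0 /\
  forall t : R, `|t| < 2 -> `|y t - a 0 i0| < r /\
    is_derive t 1 y (G (vcons (y t) (vcons t b))).
  have [/solution[y Hy]|nBb] := pselect (B b); first by exists y.
  by exists (fun=> 0).
pose v (c : 'rV[R]_n.+2) := Y (vtail c) (c 0 ord0).
have vE t b : v (vcons t b) = Y b t by rewrite /v vconsK vcons0.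
have oC := open_cyl oB.
have dv c : cyl B c -> is_derive c (delta_mx 0 ord0) v (G (vcons (v c) c)).
  rewrite -(vcons_tail c); set t := c 0 ord0; set b := vtail c => -[].
  rewrite vcons0 vconsK => t2 Bb; rewrite vE.
  have := @is_derive_line R _ R v (vcons t b) (delta_mx 0 ord0) 0 (G (vcons (Y b t) (vcons t b))).
  rewrite scale0r addr0 => -[_]; apply.
  rewrite (_ : (fun s => _) = (fun s => Y b (t + s *: 1))); last first.
    by apply/funext => u; rewrite vcons_line0 vE [u *: 1]mulr1.
  apply: (@is_derive_line R R R (Y b) t 1 0 _).1; rewrite scale0r addr0.
  by have [_ /(_ t t2)[]] := HY b Bb.
have vD c : cyl B c -> D (vcons (v c) c).
  rewrite -(vcons_tail c); set t := c 0 ord0; set b := vtail c => -[].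
  rewrite vcons0 vconsK => t2 Bb; rewrite vE; apply/D_vcons; split => //.
    by have [_ /(_ t t2)[]] := HY b Bb.
  by lra.
have v0 b : B b -> v (vcons 0 b) = b 0 i0 by move=> Bb; rewrite vE; have [] := HY b Bb.
have sv : smooth (cyl B) v.
  exact: (@ode_smooth R n B G D v (fun b => b 0 i0) oB oD sG (smooth_coord B i0) vD
    D_conv G_al dv v0).
pose gh (c : 'rV[R]_n.+2) := gam (v c) (c 0 ord0) (vtail c).
have gh_in c : cyl B c -> W0 (gh c).
  by move=> /vD; rewrite -{2}(vcons_tail c) => /D_vcons[y t b]; exact: gam_in.
pose Phi j c := F j (gh c).
have dvE c : cyl B c -> partial ord0 v c =
    - \sum_(j | j != i0) Phi j c * (c 0 (lift ord0 j) - a 0 j).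
  move=> /dv[_]; rewrite /partial => ->; rewrite -{2}(vcons_tail c) G_vcons.
  by congr (- _); apply: eq_bigr => j _; rewrite [vtail c 0 j]mxE.
have dgh c u l : cyl B c -> is_derive c u (fun c => gh c 0 l)
   (if l == i0 then 'D_u v c
    else - u 0 ord0 * (c 0 (lift ord0 l) - a 0 l) + (1 - c 0 ord0) * u 0 (lift ord0 l)).
  move=> Bc; have [li|li] := eqVneq l i0.
    rewrite (_ : (fun c => _) = v); last by apply/funext => d; rewrite mxE li eqxx.
    by apply/derivableP/diff_derivable/(C1_differentiable oC (sv 1%N) Bc).
  rewrite (_ : (fun c => _) = (fun c : 'rV[R]_n.+2 => a 0 l + (1 - c 0 ord0) * (c 0 (lift ord0 l) - a 0 l))).
    rewrite -[X in is_derive _ _ _ X]add0r; apply: is_deriveD.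
    rewrite -[- u 0 ord0]add0r -[u 0 (lift _ _)]subr0.
    apply: is_derive_mul; apply: is_deriveB; exact: is_derive_coord.
  by apply/funext => d; rewrite mxE (negPf li) [vtail d 0 l]mxE.
have sgh : smooth (cyl B) gh.
  apply: (smooth_mx gh oC).2 => l; have [li|li] := eqVneq l i0.
    by rewrite (_ : (fun c => _) = v)//; apply/funext => d; rewrite mxE li eqxx.
  rewrite (_ : (fun c => _) = (fun c : 'rV[R]_n.+2 => a 0 l + (1 - c 0 ord0) * (c 0 (lift ord0 l) - a 0 l))).
    apply: smoothD => //; first exact: smooth_cst.
    apply: smoothM => //; apply: smoothB => //; do ?[exact: smooth_cst|exact: smooth_coord].
  by apply/funext => d; rewrite mxE (negPf li) [vtail d 0 l]mxE.
have dPhi c u j : cyl B c -> is_derive c u (Phi j)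
   ('D_u v c * partial i0 (F j) (gh c) + \sum_(l | l != i0)
     (- u 0 ord0 * (c 0 (lift ord0 l) - a 0 l) + (1 - c 0 ord0) * u 0 (lift ord0 l))
      * partial l (F j) (gh c)).
  move=> Bc; have dg : derivable gh c u.
    by apply/derivable_mxP => x l; rewrite ord1; have [] := dgh c u l Bc.
  apply: (is_derive_eq (is_derive_comp_coord oW0 (sF j 1%N) (gh_in c Bc) dg)).
  rewrite (bigD1 i0)//=; congr (_ * _ + _).
    by have [_ ->] := dgh c u i0 Bc; rewrite eqxx.
  by apply: eq_bigr => l li; have [_ ->] := dgh c u l Bc; rewrite (negPf li).
exists (fun b => v (vcons 1 b)), rho.
  rewrite rho0/=; move: rho_r r0; lra.
have cyl1 b t : `|t| <= 1 -> B b -> cyl B (vcons t b).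
  by move=> t1 Bb; apply: cyl_vcons => //; lra.
have n1 : `|1 : R| <= 1 by rewrite normr1.
split.
  apply: (smooth_comp (V' := cyl B)) => // [b Bb|]; first exact: cyl1.
  move=> k; apply/Ck_mx => // j; apply: Ck_vcons => [|l]; first exact: Ck_cst.
  exact: Ck_coord.
(* all the derivatives [V k] of the solution obey a linear equation with the same
   coefficient [al] *)
move=> b Bb; pose V k t := partial (lift ord0 k) v (vcons t b).
pose al t := - \sum_(j | j != i0) partial i0 (F j) (gh (vcons t b)) * (b 0 j - a 0 j).
have al_le t : `|t| <= 1 -> `|al t| <= 8^-1.
  move=> t1; rewrite normrN; apply: (@le_trans _ _ s); last by rewrite ge_min lexx.
  by apply: sum_le => j; [apply/dF_le/gh_in/cyl1|exact: B_coord].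
have dV k (t : R) : `|t| <= 1 -> is_derive t 1 (V k) (al t * V k t
   - (if k == i0 then 0 else \sum_(j | j != i0)
     (1 - t) * partial k (F j) (gh (vcons t b)) * (b 0 j - a 0 j) + Phi k (vcons t b))).
  move=> t1; have Bc := cyl1 _ _ t1 Bb; set c := vcons t b in Bc *.
  have := @is_derive_line R _ R (partial (lift ord0 k) v) (vcons 0 b) (delta_mx 0 ord0) t
     (partial (lift ord0 k) (partial ord0 v) c).
  rewrite (_ : (fun s => _) = V k); last first.
    by apply/funext => u; rewrite vcons_line0 add0r.
  rewrite vcons_line0 add0r -/c => -[H _].
  apply: (is_derive_eq (H _)).
    rewrite -(partial_comm _ _ oC (sv 2%N) Bc).
    by apply: DeriveDef => //; apply: smooth_derivable Bc; exact: smooth_partial.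
  rewrite (partial_eq _ oC Bc dvE) [LHS]/partial.
  suff [_ ->] : is_derive c (delta_mx 0 (lift ord0 k))
    (fun c : 'rV[R]_n.+2 => - \sum_(j | j != i0) Phi j c * (c 0 (lift ord0 j) - a 0 j))
    (- \sum_(j | j != i0) ((V k t * partial i0 (F j) (gh c) +
       (if k == i0 then 0 else (1 - t) * partial k (F j) (gh c))) * (b 0 j - a 0 j)
      + Phi j c * (j == k)%:R)).
    rewrite big_split/= (eq_bigr (fun j => V k t * (partial i0 (F j) (gh c) * (b 0 j - a 0 j))
      + (if k == i0 then 0 else (1 - t) * partial k (F j) (gh c)  * (b 0 j - a 0 j)))); last first.
      by move=> j _; case: ifP => _; ring.
    rewrite big_split/= -mulr_sumr /al -/c; have [ki|ki] := eqVneq k i0.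
      have -> : \sum_(j | j != i0) Phi j c * (j == k)%:R = 0.
        by apply: big1 => j ji; rewrite ki (negPf ji) mulr0.
      by rewrite big1_eq; ring.
    have -> : \sum_(j | j != i0) Phi j c * (j == k)%:R = Phi k c.
      rewrite (bigD1 k)//= eqxx mulr1 big1 ?addr0//.
      by move=> j /andP[_ /negPf ->]; rewrite mulr0.
    ring.
  apply: is_deriveN; apply: is_derive_bigsum => j ji.
  rewrite -[(j == k)%:R]subr0.
  have -> : b 0 j = c 0 (lift ord0 j) by rewrite vconsS.
  apply: is_derive_mul; last first.
    apply: is_deriveB; apply: (is_derive_eq (is_derive_coord _ _ _)).
    by rewrite coord_delta (inj_eq lift_inj).
  apply: (is_derive_eq (dPhi c _ j Bc)); congr (_ + _).
  have [ki|ki] := eqVneq k i0.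
    apply: big1 => l li; rewrite !coord_delta (inj_eq lift_inj) ki (negPf li).
    by rewrite /= mulr0 addr0 oppr0 mul0r mul0r.
  rewrite (bigD1 k)//= big1 ?addr0.
    by rewrite !coord_delta !eqxx /= oppr0 mul0r add0r mulr1 vcons0.
  move=> l /andP[_ lk]; rewrite !coord_delta (inj_eq lift_inj) (negPf lk) /=.
  by rewrite oppr0 mul0r mulr0 addr0 mul0r.
(* at time 0 the ray is at [b], and the initial value is the distinguished
   coordinate of [b] *)
have V0 k : V k 0 = (k == i0)%:R.
  rewrite /V -partial_vconsS (partial_eq _ oB Bb v0) partial_coord eq_sym.
  by [].
have T02 : 0 <= (1 : R) <= 2 by rewrite ler01 ler1n.
have al_gen (x : R -> R) (t : R) : `|t| <= 1 -> `|al t * x t| <= 8^-1 * `|x t|.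
  by move=> t1; rewrite normrM ler_wpM2r// al_le.
rewrite !partial_vconsS -/(V i0 1); split.
  (* [V i0] starts at 1 and moves by less than 1 *)
  have := @ode_estimate R (fun t => V i0 t - 1) (fun t => al t * V i0 t) 1 0 8^-1 T02.
  rewrite invr_ge0 ler0n => /(_ isT) H.
  have : `|V i0 1 - 1| <= 2 * (0 + 2 * 8^-1).
    apply: H => // [t t1|t t1|].
    - rewrite -[_ * _]subr0; apply: is_deriveB.
      by apply: (is_derive_eq (dV i0 t t1)); rewrite eqxx subr0.
    - rewrite (_ : al t * V i0 t = al t * (V i0 t - 1) + al t); last by ring.
      apply: le_trans (ler_normD _ _) _.
      have := al_gen (fun t => V i0 t - 1) t t1; have := al_le t t1.
      have : 0 <= `|V i0 t - 1| by []; lra.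
    - by rewrite V0 eqxx subrr normr0.
  by apply: contraTneq => ->; rewrite sub0r normrN normr1 -ltNge; lra.
move=> k ki; rewrite partial_vconsS -/(V k 1) -/(V i0 1).
(* the defect [w] solves [w' = al w] with [w 0 = 0] *)
pose w t := V k t + F k b * V i0 t - (1 - t) * Phi k (vcons t b).
suff : w 1 = 0 by rewrite /w subrr mul0r subr0 mulNr => /eqP; rewrite addr_eq0 => /eqP.
have := @ode_estimate R w (fun t => al t * w t) 1 0 0 T02 (lexx _).
move=> H; apply/eqP; rewrite -normr_le0; have : `|w 1| <= 2 * (0 + 2 * 0).
  apply: H => // [t t1|t t1|]; last 2 first.
  - have := al_gen w t t1; have : 0 <= `|w t| by []; lra.
  - rewrite /w !V0 eqxx (negPf ki) mulr1 add0r subr0 mul1r /Phi.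
    rewrite (_ : gh _ = b) ?subrr ?normr0//.
    rewrite /gh v0// vcons0 vconsK; apply/rowP => l; rewrite mxE subr0 mul1r addrC subrK.
    by case: eqVneq => // ->.
  have Bc := cyl1 _ _ t1 Bb; set c := vcons t b in Bc.
  have dPk : is_derive t 1 (fun s => Phi k (vcons s b))
     (- \sum_(l | l != i0) (b 0 l - a 0 l)
        * (partial l (F k) (gh c) + Phi l c * partial i0 (F k) (gh c))).
    have := @is_derive_line R _ R (Phi k) (vcons 0 b) (delta_mx 0 ord0) t
     (- \sum_(l | l != i0) (b 0 l - a 0 l)
        * (partial l (F k) (gh c) + Phi l c * partial i0 (F k) (gh c))).
    rewrite (_ : (fun s => _) = (fun s => Phi k (vcons s b))); last first.
      by apply/funext => u; rewrite vcons_line0 add0r.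
    rewrite vcons_line0 add0r -/c => -[H' _]; apply: H'.
    apply: (is_derive_eq (dPhi c _ k Bc)).
    rewrite -/(partial ord0 v c) dvE// mulNr mulr_suml -sumrN -big_split/= -sumrN.
    apply: eq_bigr => l li; rewrite !coord_delta eqxx /= vconsS; ring.
  have dw : is_derive t 1 w (al t * V k t
   - (\sum_(j | j != i0)
     (1 - t) * partial k (F j) (gh c) * (b 0 j - a 0 j) + Phi k c)
   + F k b * (al t * V i0 t)
   - (-1 * Phi k c + (1 - t) * (- \sum_(l | l != i0) (b 0 l - a 0 l)
        * (partial l (F k) (gh c) + Phi l c * partial i0 (F k) (gh c))))).
    apply: is_deriveB; first apply: is_deriveD.
    - by apply: (is_derive_eq (dV k t t1)); rewrite (negPf ki).
    - have dVi : is_derive t 1 (V i0) (al t * V i0 t).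
        by apply: (is_derive_eq (dV i0 t t1)); rewrite eqxx subr0.
      rewrite (_ : (fun t => F k b * V i0 t) = F k b *: V i0)//; exact: is_deriveZ.
    - apply: is_derive_mul => //; rewrite -[-1]add0r; apply: is_deriveB.
  apply: (is_derive_eq dw); rewrite /w -/c /al -/c; set S0 := \sum_(j | j != i0) partial i0 (F j) (gh c) * (b 0 j - a 0 j).
  have -> : \sum_(l | l != i0) (b 0 l - a 0 l)
        * (partial l (F k) (gh c) + Phi l c * partial i0 (F k) (gh c))
     = \sum_(l | l != i0) partial k (F l) (gh c) * (b 0 l - a 0 l) + Phi k c * S0.
    rewrite mulr_sumr -big_split/=; apply: eq_bigr => l li.
    by rewrite (F_integrable li ki (gh_in _ Bc)) -/(Phi k c); ring.
  rewrite (eq_bigr (fun j => (1 - t) * (partial k (F j) (gh c) * (b 0 j - a 0 j)))).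
    by rewrite -mulr_sumr; ring.
  by move=> j _; rewrite mulrA.
by rewrite mulr0 addr0 mulr0.
Qed.

End Mayer.

Section Frobenius.
Context {R : realType} {n : nat}.
Local Notation E := 'rV[R]_n.+1.

(** A nowhere zero 1-form whose kernel is involutive is locally a multiple of an
    exact form: where its coefficient at index [i0] does not vanish, its kernel
    is the graph of a total differential equation. *)
Lemma frobenius_hyperplane (W : set E) (theta : E -> E) (a : E) :
  open W -> W a -> smooth W theta -> theta a != 0 ->
  is_involutive W (fun b => [set v | pairing (theta b) v = 0]) ->
  exists (W' : set E) (f : E -> R) (h : E -> R),
    [/\ [/\ open W', W' a & W' `<=` W], smooth W' f, smooth W' h &
        forall b, W' b -> h b != 0 /\ theta b = h b *: dfun f b].
Proof.
move=> oW Wa sth tha inv.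
have [i0 th0] : exists i0, theta a 0 i0 != 0.
  by have /rV0Pn := tha.
have sthj j : smooth W (fun b => theta b 0 j) by apply: (smooth_mx theta oW).1.
pose W1 := W `&` [set b | theta b 0 i0 != 0].
have oW1 : open W1 by exact: open_neq0.
have W1W : W1 `<=` W by move=> b [].
pose F j b := - (theta b 0 j / theta b 0 i0).
have sF j : smooth W1 (F j).
  apply: smoothN => //; apply: smoothM => //; first exact: smooth_sub W1W (sthj j).
  by apply: smoothV => // [b []//|]; exact: smooth_sub W1W (sthj i0).
(* for [j] different from [i0], the fields [X j] frame the kernel; the component at
   [i0] of their brackets is the integrability condition of [mayer] *)
pose X j b : E := delta_mx 0 j + F j b *: delta_mx 0 i0.
have XE j b l : X j b 0 l = (l == j)%:R + F j b * (l == i0)%:R by rewrite !mxE eqxx.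
have sX j : smooth W1 (X j).
  apply: (smooth_mx (X j) oW1).2 => l; rewrite (_ : (fun b => _) = fun b => (l == j)%:R + F j b * (l == i0)%:R).
    apply: smoothD => //; first exact: smooth_cst.
    by apply: smoothM => //; exact: smooth_cst.
  by apply/funext => b; rewrite XE.
have thX j b : W1 b -> pairing (theta b) (X j b) = 0.
  move=> [_ tb]; rewrite /pairing (eq_bigr (fun l => theta b 0 l * (l == j)%:R + F j b * (theta b 0 l * (l == i0)%:R))).
    rewrite big_split/= -mulr_sumr.
    have d1 i : \sum_l theta b 0 l * (l == i)%:R = theta b 0 i.
      by rewrite (bigD1 i)//= eqxx mulr1 big1 ?addr0// => l /negPf ->; rewrite mulr0.
    by rewrite !d1 /F mulNr divfK// subrr.
  by move=> l _; rewrite XE; ring.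
have dXl j l i b : W1 b -> partial i (fun c => X j c 0 l) b = (l == i0)%:R * partial i (F j) b.
  move=> Wb; rewrite (_ : (fun c => _) = fun c => (l == j)%:R + F j c * (l == i0)%:R); last first.
    by apply/funext => c; rewrite XE.
  suff [_] : is_derive b (delta_mx 0 i) (fun c => (l == j)%:R + F j c * (l == i0)%:R)
      (0 + partial i (F j) b * (l == i0)%:R) by rewrite add0r mulrC.
  apply: is_deriveD; apply: is_derive_mulr; apply: DeriveDef => //.
  exact: smooth_derivable (sF j) Wb.
have integ j k b : j != i0 -> k != i0 -> W1 b ->
    partial j (F k) b + F j b * partial i0 (F k) b
    = partial k (F j) b + F k b * partial i0 (F j) b.
  move=> ji ki Wb.
  have := inv W1 (X j) (X k) oW1 W1W (conj (sX j) (thX j)) (conj (sX k) (thX k)) b Wb.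
  rewrite /= /pairing.
  have brE l : bracket (X j) (X k) b 0 l = (l == i0)%:R *
      ((partial j (F k) b + F j b * partial i0 (F k) b)
       - (partial k (F j) b + F k b * partial i0 (F j) b)).
    rewrite mxE (eq_bigr (fun i => (l == i0)%:R * ((i == j)%:R * partial i (F k) b + F j b * ((i == i0)%:R * partial i (F k) b)
      - ((i == k)%:R * partial i (F j) b + F k b * ((i == i0)%:R * partial i (F j) b))))); last first.
      by move=> i _; rewrite !dXl// !XE; ring.
    rewrite -mulr_sumr; congr (_ * _).
    have d1 u (f : 'I_n.+1 -> R) : \sum_i (i == u)%:R * f i = f u.
      by rewrite (bigD1 u)//= eqxx mul1r big1 ?addr0// => i /negPf ->; rewrite mul0r.
    rewrite sumrB !big_split/= -!mulr_sumr.
    by rewrite (d1 j (fun i => partial i (F k) b)) (d1 k (fun i => partial i (F j) b))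
      (d1 i0 (fun i => partial i (F k) b)) (d1 i0 (fun i => partial i (F j) b)).
  rewrite (bigD1 i0)//= big1 ?addr0; last first.
    by move=> l li; rewrite brE (negPf li) mul0r mulr0.
  rewrite brE eqxx mul1r => /eqP; rewrite mulf_eq0 subr_eq0.
  by case: Wb => _ /negPf -> /= /eqP.
have W1a : W1 a by [].
have bounded (g : E -> R) : smooth W1 g -> exists2 M, 0 <= M & \forall b \near a, `|g b| <= M.
  move=> sg; exists (`|g a| + 1); first by rewrite addr_ge0.
  have /continuous_nearP /(_ 1 ltr01) := smooth_continuous sg W1a.
  apply: filterS => b Hb; have : `|g b| <= `|g b - g a| + `|g a| by rewrite -{1}(subrK (g a) (g b)) ler_normD.
  by lra.
have /choice[M1 HM1] (j : 'I_n.+1) : exists M, 0 <= M /\ \forall b \near a, `|F j b| <= M.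
  by have [M M0 HM] := bounded _ (sF j); exists M.
have /choice[M2 HM2] (j : 'I_n.+1) : exists M, 0 <= M /\ \forall b \near a, `|partial i0 (F j) b| <= M.
  by have [M M0 HM] := bounded _ (smooth_partial i0 (sF j)); exists M.
pose M := \sum_j (M1 j + M2 j).
have MM j : M1 j + M2 j <= M.
  rewrite /M (bigD1 j)//= lerDl sumr_ge0// => i _.
  by rewrite addr_ge0//; [have [] := HM1 i|have [] := HM2 i].
have M0 : 0 <= M.
  rewrite sumr_ge0// => i _.
  by rewrite addr_ge0//; [have [] := HM1 i|have [] := HM2 i].
have near_a : \forall b \near a, W1 b /\ forall j, `|F j b| <= M /\ `|partial i0 (F j) b| <= M.
  have Fa := nbhs_filter a; apply: filterI; first exact: open_nbhs_nbhs.
  apply: nbhs_forall => j; have [m1 n1] := HM1 j; have [m2 n2] := HM2 j.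
  by apply: filterS2 n1 n2 => b b1 b2; have := MM j; split; lra.
have [r r0 Hr] := (nbhs_rVP _ _).1 near_a.
have rW1 : [set x | `|x - a| < r] `<=` W1 by move=> x /Hr[].
have [|j x /Hr[_ /(_ j)[]]//|j x /Hr[_ /(_ j)[]]//|j k x ji ki xr|f [e /andP[e0 er] [sf Hf]]] :=
  @mayer R n F a i0 r M r0 M0.
- by move=> j; exact: smooth_sub rW1 (sF j).
- by apply: integ => //; exact: rW1.
pose W' := [set b | `|b - a| < e].
have W'W1 : W' `<=` W1.
  by move=> b be; apply: rW1; exact: lt_le_trans be er.
have oW' : open W'.
  rewrite openE => b Bb; apply/nbhs_rVP; exists (e - `|b - a|); first by rewrite subr_gt0.
  move=> x xb; rewrite /W'/= -(subrKA b); apply: le_lt_trans (ler_normD _ _) _.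
  by rewrite -ltrBrDr.
exists W', f, (fun b => theta b 0 i0 / partial i0 f b); split => //.
- by split => //; [rewrite /W'/= subrr normr0|move=> b /W'W1[]].
- apply: smoothM => //; first exact: smooth_sub W'W1 (smooth_sub W1W (sthj i0)).
  by apply: smoothV => // [b /Hf[]//|]; exact: smooth_partial.
move=> b be; have [fb Hk] := Hf b be; have [_ tb] := W'W1 b be.
split; first by rewrite mulf_neq0// invr_neq0.
apply/rowP => k; rewrite !mxE; have [->|ki] := eqVneq k i0; first by rewrite divfK.
rewrite (Hk k ki) /F; have tb' : theta b 0 i0 != 0 by [].
by field; rewrite fb tb'.
Qed.

End Frobenius.

(** * Vector fields, forms and brackets *)

Section Pairing.
Context {R : realType} {n : nat}.
Local Notation E := 'rV[R]_n.+1.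
Implicit Types (al be u v w : E).

Lemma pairingDr al v w : pairing al (v + w) = pairing al v + pairing al w.
Proof. by rewrite /pairing -big_split; apply: eq_bigr => i _; rewrite mxE mulrDr. Qed.

Lemma pairingZr al c v : pairing al (c *: v) = c * pairing al v.
Proof. by rewrite /pairing mulr_sumr; apply: eq_bigr => i _; rewrite mxE mulrCA. Qed.

Lemma pairingDl al be v : pairing (al + be) v = pairing al v + pairing be v.
Proof. by rewrite /pairing -big_split; apply: eq_bigr => i _; rewrite mxE mulrDl. Qed.

Lemma pairingZl al c v : pairing (c *: al) v = c * pairing al v.
Proof. by rewrite /pairing mulr_sumr; apply: eq_bigr => i _; rewrite mxE mulrA. Qed.

Lemma pairing0r al : pairing al 0 = 0.
Proof. by rewrite -(scale0r 0) pairingZr mul0r. Qed.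

Lemma pairing0l v : pairing 0 v = 0.
Proof. by rewrite -(scale0r 0) pairingZl mul0r. Qed.

Lemma pairingBr al v w : pairing al (v - w) = pairing al v - pairing al w.
Proof. by rewrite -scaleN1r pairingDr pairingZr mulN1r. Qed.

Lemma pairingC al v : pairing al v = pairing v al.
Proof. by apply: eq_bigr => i _; rewrite mulrC. Qed.

Lemma pairing_delta j v : pairing (delta_mx 0 j) v = v 0 j.
Proof.
rewrite /pairing (bigD1 j)//= coord_delta eqxx mul1r big1 ?addr0//.
by move=> i ij; rewrite coord_delta (negPf ij) mul0r.
Qed.

Lemma pairing_inj al be : (forall v, pairing al v = pairing be v) -> al = be.
Proof.
move=> H; apply/rowP => j.
by rewrite -(pairing_delta j al) -(pairing_delta j be) pairingC H pairingC.
Qed.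

Lemma pairing_self_neq0 v : v != 0 -> pairing v v != 0.
Proof.
apply: contraNneq => /eqP; rewrite psumr_eq0 => [/allP H|i _]; last first.
  by rewrite -expr2 sqr_ge0.
apply/eqP/rowP => i; rewrite mxE; have := H i (mem_index_enum i).
by rewrite mulf_eq0 orbb => /eqP.
Qed.

(** A form vanishing on the kernel of another one is a multiple of it. *)
Lemma pairing_ker_sub al be : al != 0 ->
  (forall v, pairing al v = 0 -> pairing be v = 0) -> exists c, be = c *: al.
Proof.
move=> al0 H; have aa := pairing_self_neq0 al0.
exists (pairing be al / pairing al al); apply: pairing_inj => v.
have := H (v - (pairing al v / pairing al al) *: al).
rewrite !pairingBr !pairingZr divfK// subrr => /(_ erefl)/eqP.
by rewrite subr_eq0 pairingZl => /eqP ->; rewrite mulrAC [RHS]mulrAC [pairing al v * _]mulrC.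
Qed.

Lemma linspan_ind (S : set E) (Q : E -> Prop) :
  Q 0 -> (forall c u v, Q u -> Q v -> Q (c *: u + v)) ->
  (forall v, S v -> Q v) -> forall v, linspan S v -> Q v.
Proof.
move=> Q0 QL QS v [s Hs]; elim: s v Hs => [|u s IH] v Hs.
  by rewrite span_nil memv0 => /eqP ->.
rewrite span_cons => /memv_addP[x /vlineP[c ->] [y ys ->]].
apply: QL; first by apply/QS/Hs; rewrite mem_head.
by apply: IH ys => w ws; apply: Hs; rewrite inE ws orbT.
Qed.

Lemma sub_linspan (S : set E) v : S v -> linspan S v.
Proof.
by move=> Sv; exists [:: v]; rewrite ?span_seq1 ?memv_line// => u; rewrite inE => /eqP ->.
Qed.

Lemma linspan_comb (S : set E) c u v : S u -> S v -> linspan S (c *: u + v).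
Proof.
move=> Su Sv; exists [:: u; v].
  by move=> w; rewrite !inE => /orP[] /eqP ->.
by rewrite memvD ?memvZ// memv_span// !inE eqxx ?orbT.
Qed.

End Pairing.

Section VectorFields.
Context {R : realType} {n : nat}.
Local Notation E := 'rV[R]_n.+1.
Implicit Types (X Y al be : E -> E) (V : set E).

Lemma smooth_comp_coord V X j : open V -> smooth V X -> smooth V (fun b => X b 0 j).
Proof. by move=> oV sX; apply: (smooth_mx X oV).1. Qed.

Lemma smooth_row V X (c : 'I_n.+1 -> E -> R) : open V ->
  (forall j b, V b -> X b 0 j = c j b) -> (forall j, smooth V (c j)) -> smooth V X.
Proof.
move=> oV XE sc; apply/smooth_mx => // j.
by apply: smooth_eq (sc j) => // b Vb; rewrite XE.
Qed.

Lemma smooth_pairing V al X : open V -> smooth V al -> smooth V X ->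
  smooth V (fun b => pairing (al b) (X b)).
Proof.
by move=> oV sa sX; apply: smooth_sum => // j _; apply: smoothM => //; exact: smooth_comp_coord.
Qed.

Lemma smooth_scale V (f : E -> R) X : open V -> smooth V f -> smooth V X ->
  smooth V (fun b => f b *: X b).
Proof.
move=> oV sf sX; apply: (@smooth_row V _ (fun j b => f b * X b 0 j)) => // [j b _|j].
  by rewrite mxE.
by apply: smoothM => //; exact: smooth_comp_coord.
Qed.

Lemma smooth_add V X Y : open V -> smooth V X -> smooth V Y ->
  smooth V (fun b => X b + Y b).
Proof.
move=> oV sX sY; apply: (@smooth_row V _ (fun j b => X b 0 j + Y b 0 j)) => // [j b _|j].
  by rewrite mxE.
by apply: smoothD => //; exact: smooth_comp_coord.
Qed.

Lemma smooth_bracket V X Y : open V -> smooth V X -> smooth V Y ->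
  smooth V (bracket X Y).
Proof.
move=> oV sX sY; apply: (@smooth_row V _ (fun j b => bracket X Y b 0 j)) => // j.
rewrite (_ : (fun b => _) = fun b => \sum_i (X b 0 i * partial i (fun c => Y c 0 j) b
    - Y b 0 i * partial i (fun c => X c 0 j) b)); last by apply/funext => b; rewrite mxE.
apply: smooth_sum => // i _.
by apply: smoothB => //; apply: smoothM => //;
  do ?apply: smooth_partial; exact: smooth_comp_coord.
Qed.

Lemma smooth_lie V X al : open V -> smooth V X -> smooth V al ->
  smooth V (lie_form X al).
Proof.
move=> oV sX sa; apply: (@smooth_row V _ (fun j b => lie_form X al b 0 j)) => // j.
rewrite (_ : (fun b => _) = fun b => \sum_i (X b 0 i * partial i (fun c => al c 0 j) b
    + al b 0 i * partial j (fun c => X c 0 i) b)); last by apply/funext => b; rewrite mxE.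
apply: smooth_sum => // i _.
by apply: smoothD => //; apply: smoothM => //;
  do ?apply: smooth_partial; exact: smooth_comp_coord.
Qed.

Lemma smooth_dfun V (f : E -> R) : open V -> smooth V f -> smooth V (dfun f).
Proof.
move=> oV sf; apply: (@smooth_row V _ (fun j b => partial j f b)) => // [j b _|j].
  by rewrite mxE.
exact: smooth_partial.
Qed.

Lemma partial_pairing V al X i a : open V -> smooth V al -> smooth V X -> V a ->
  partial i (fun b => pairing (al b) (X b)) a =
  \sum_j (partial i (fun b => al b 0 j) a * X a 0 j
          + al a 0 j * partial i (fun b => X b 0 j) a).
Proof.
move=> oV sa sX Va.
suff [] : is_derive a (delta_mx 0 i) (fun b => pairing (al b) (X b))
  (\sum_j (partial i (fun b => al b 0 j) a * X a 0 j
          + al a 0 j * partial i (fun b => X b 0 j) a)) by [].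
apply: is_derive_bigsum => j _; apply: is_derive_mul; apply: DeriveDef => //.
  exact: smooth_derivable (smooth_comp_coord j oV sa) Va.
exact: smooth_derivable (smooth_comp_coord j oV sX) Va.
Qed.

Lemma pairing_dfun_pairing V al X v a : open V -> smooth V al -> smooth V X -> V a ->
  pairing (dfun (fun b => pairing (al b) (X b)) a) v =
  \sum_i \sum_j (partial i (fun b => al b 0 j) a * X a 0 j * v 0 i
          + al a 0 j * partial i (fun b => X b 0 j) a * v 0 i).
Proof.
move=> oV sa sX Va; apply: eq_bigr => i _.
rewrite mxE (partial_pairing _ oV sa sX Va) mulr_suml.
by apply: eq_bigr => j _; rewrite mulrDl.
Qed.

(** Leibniz rule for the Lie derivative of a function [<al, Y>]. *)
Lemma pairing_lie V X al Y a : open V -> smooth V al -> smooth V Y -> V a ->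
  pairing (lie_form X al a) (Y a) =
  pairing (dfun (fun b => pairing (al b) (Y b)) a) (X a)
  - pairing (al a) (bracket X Y a).
Proof.
move=> oV sa sY Va; rewrite (pairing_dfun_pairing _ oV sa sY Va) exchange_big /=.
have -> : pairing (lie_form X al a) (Y a) =
   \sum_j \sum_i X a 0 i * partial i (fun b => al b 0 j) a * Y a 0 j
   + \sum_j \sum_i al a 0 j * partial i (fun b => X b 0 j) a * Y a 0 i.
  rewrite [X in _ + X]exchange_big -big_split; apply: eq_bigr => j _ /=.
  by rewrite mxE mulr_suml -big_split; apply: eq_bigr => i _; rewrite mulrDl.
rewrite /pairing -big_split -sumrB; apply: eq_bigr => j _ /=.
rewrite mxE mulr_sumr -big_split -sumrB; apply: eq_bigr => i _ /=; ring.
Qed.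

Lemma dformE al a v w : dform al a v w =
  \sum_i \sum_j partial i (fun b => al b 0 j) a * (v 0 i * w 0 j - w 0 i * v 0 j).
Proof.
rewrite exchange_big; apply: eq_bigr => j _; rewrite /wedge !pairing_delta.
rewrite /pairing !mulr_suml -sumrB; apply: eq_bigr => i _.
by rewrite mxE; ring.
Qed.

(** Cartan's formula for the exterior derivative of a 1-form. *)
Lemma pairing_bracket V X Y al a : open V -> smooth V al -> smooth V X ->
  smooth V Y -> V a ->
  pairing (al a) (bracket X Y a) =
  pairing (dfun (fun b => pairing (al b) (Y b)) a) (X a)
  - pairing (dfun (fun b => pairing (al b) (X b)) a) (Y a)
  - dform al a (X a) (Y a).
Proof.
move=> oV sa sX sY Va.
rewrite (pairing_dfun_pairing _ oV sa sY Va) (pairing_dfun_pairing _ oV sa sX Va).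
rewrite dformE -!sumrB /pairing.
rewrite (eq_bigr (fun j => \sum_i al a 0 j * (X a 0 i * partial i (fun b => Y b 0 j) a
  - Y a 0 i * partial i (fun b => X b 0 j) a))); last first.
  by move=> j _; rewrite mxE mulr_sumr.
rewrite exchange_big/=; apply: eq_bigr => i _; rewrite -!sumrB; apply: eq_bigr => j _.
by ring.
Qed.

Lemma pairing_dfun0 V (f : E -> R) a v : open V -> V a -> (forall b, V b -> f b = 0) ->
  pairing (dfun f a) v = 0.
Proof.
move=> oV Va f0; apply: big1 => i _; rewrite mxE (partial_eq _ oV Va f0).
by rewrite /partial derive_cst mul0r.
Qed.

(** On sections of the kernel of a form, the value of the form on a bracket only
    depends on the values of the sections. *)
Lemma pairing_bracket0 V X Y al a : open V -> smooth V al -> smooth V X ->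
  smooth V Y -> V a -> (forall b, V b -> pairing (al b) (X b) = 0) ->
  (forall b, V b -> pairing (al b) (Y b) = 0) ->
  pairing (al a) (bracket X Y a) = - dform al a (X a) (Y a).
Proof.
move=> oV sa sX sY Va X0 Y0; rewrite (pairing_bracket oV sa sX sY Va).
by rewrite (pairing_dfun0 _ oV Va X0) (pairing_dfun0 _ oV Va Y0) subrr sub0r.
Qed.

Lemma pairing_lie0 V X al Y a : open V -> smooth V al -> smooth V Y -> V a ->
  (forall b, V b -> pairing (al b) (Y b) = 0) ->
  pairing (lie_form X al a) (Y a) = - pairing (al a) (bracket X Y a).
Proof.
move=> oV sa sY Va Y0; rewrite (pairing_lie X oV sa sY Va).
by rewrite (pairing_dfun0 _ oV Va Y0) sub0r.
Qed.

(** The exterior derivative of an exact form is zero, by symmetry of the second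
    derivatives. *)
Lemma dform_dfun V (f : E -> R) a v w : open V -> smooth V f -> V a ->
  dform (dfun f) a v w = 0.
Proof.
move=> oV sf Va.
have dfE i j : partial i (fun b => dfun f b 0 j) a = partial i (partial j f) a.
  by congr (partial i _ a); apply/funext => b; rewrite mxE.
rewrite dformE; under eq_bigr do under eq_bigr do rewrite dfE mulrBr.
under eq_bigr do rewrite sumrB.
rewrite sumrB [X in _ - X]exchange_big/= -sumrB big1// => i _; rewrite -sumrB big1// => j _.
by rewrite (partial_comm _ _ oV (sf 2%N) Va) [w 0 j * _]mulrC subrr.
Qed.

Lemma bracket_kernel V (f : E -> R) X Y a : open V -> smooth V f -> smooth V X ->
  smooth V Y -> V a -> (forall b, V b -> pairing (dfun f b) (X b) = 0) ->
  (forall b, V b -> pairing (dfun f b) (Y b) = 0) ->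
  pairing (dfun f a) (bracket X Y a) = 0.
Proof.
move=> oV sf sX sY Va X0 Y0.
rewrite (pairing_bracket0 oV (smooth_dfun oV sf) sX sY Va X0 Y0).
by rewrite (dform_dfun _ _ oV sf Va) oppr0.
Qed.

Lemma bracketxx X a : bracket X X a = 0.
Proof. by apply/rowP => j; rewrite !mxE big1// => i _; rewrite subrr. Qed.

Lemma dform_comb2 al a (x y : E) c1 c2 d1 d2 :
  dform al a (c1 *: x + c2 *: y) (d1 *: x + d2 *: y) =
  (c1 * d2 - c2 * d1) * dform al a x y.
Proof.
rewrite !dformE mulr_sumr; under [RHS]eq_bigr do rewrite mulr_sumr.
apply: eq_bigr => i _; apply: eq_bigr => j _; rewrite !mxE; ring.
Qed.

End VectorFields.

(** * Linear algebra of the contact distribution *)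

Section ContactAlgebra.
Context {R : realType}.
Local Notation J1 := 'rV[R]_5.
Implicit Types (a v w x y : J1).

(** The symplectic form [dU]; its coefficients are constant. *)
Definition sg v w : R := v 0 jx * w 0 jp - v 0 jp * w 0 jx
  + v 0 jy * w 0 jq - v 0 jq * w 0 jy.

(** The contraction of [v] with [dU], as a row of coefficients. *)
Definition flat v : J1 := v 0 jx *: dp - v 0 jp *: dx + v 0 jy *: dq - v 0 jq *: dy.

Lemma sum5 (f : 'I_5 -> R) :
  \sum_i f i = f jx + f jy + f jz + f jp + f jq.
Proof.
rewrite !big_ord_recl big_ord0 addr0 !addrA.
by congr (f _ + f _ + f _ + f _ + f _); exact: val_inj.
Qed.

Lemma row5P v w : v 0 jx = w 0 jx -> v 0 jy = w 0 jy -> v 0 jz = w 0 jz ->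
  v 0 jp = w 0 jp -> v 0 jq = w 0 jq -> v = w.
Proof.
move=> hx hy hz hp hq; apply/rowP => -[[|[|[|[|[|//]]]]] Hj].
- by have -> : Ordinal Hj = jx by exact: val_inj.
- by have -> : Ordinal Hj = jy by exact: val_inj.
- by have -> : Ordinal Hj = jz by exact: val_inj.
- by have -> : Ordinal Hj = jp by exact: val_inj.
- by have -> : Ordinal Hj = jq by exact: val_inj.
Qed.

Lemma UE a : [/\ U a 0 jx = - a 0 jp, U a 0 jy = - a 0 jq, U a 0 jz = 1,
  U a 0 jp = 0 & U a 0 jq = 0].
Proof. by rewrite /U /dx /dy /dz !mxE -!val_eqE /=; split; ring. Qed.

Lemma flatE v : [/\ flat v 0 jx = - v 0 jp, flat v 0 jy = - v 0 jq, flat v 0 jz = 0,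
  flat v 0 jp = v 0 jx & flat v 0 jq = v 0 jy].
Proof. by rewrite /flat /dx /dy /dp /dq !mxE -!val_eqE /=; split; ring. Qed.

Lemma pairing_U a v : pairing (U a) v = v 0 jz - a 0 jp * v 0 jx - a 0 jq * v 0 jy.
Proof. by rewrite /pairing sum5; have [-> -> -> -> ->] := UE a; ring. Qed.

Lemma pairing_flat v w : pairing (flat v) w = sg v w.
Proof. by rewrite /pairing sum5 /sg; have [-> -> -> -> ->] := flatE v; ring. Qed.

Lemma sgDl v w x : sg (v + w) x = sg v x + sg w x.
Proof. by rewrite /sg !mxE; ring. Qed.

Lemma sgZl c v x : sg (c *: v) x = c * sg v x.
Proof. by rewrite /sg !mxE; ring. Qed.

Lemma sgC v w : sg v w = - sg w v.
Proof. by rewrite /sg; ring. Qed.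

Lemma sgxx v : sg v v = 0.
Proof. by rewrite /sg; ring. Qed.

Lemma sgDr v w x : sg x (v + w) = sg x v + sg x w.
Proof. by rewrite /sg !mxE; ring. Qed.

Lemma sgZr c v x : sg x (c *: v) = c * sg x v.
Proof. by rewrite /sg !mxE; ring. Qed.

Lemma contactE a v : contact a v <-> v 0 jz = a 0 jp * v 0 jx + a 0 jq * v 0 jy.
Proof.
rewrite /contact/= pairing_U; split=> [/eqP|->]; last by ring.
by rewrite subr_eq0 subr_eq => /eqP ->; rewrite addrC.
Qed.

(** A contact vector is determined by its components other than the third. *)
Definition lift_contact a (vx vy vp vq : R) : J1 :=
  vx *: dx + vy *: dy + (a 0 jp * vx + a 0 jq * vy) *: dz + vp *: dp + vq *: dq.

Lemma lift_contactE a vx vy vp vq : [/\ lift_contact a vx vy vp vq 0 jx = vx,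
  lift_contact a vx vy vp vq 0 jy = vy,
  lift_contact a vx vy vp vq 0 jz = a 0 jp * vx + a 0 jq * vy,
  lift_contact a vx vy vp vq 0 jp = vp & lift_contact a vx vy vp vq 0 jq = vq].
Proof.
by rewrite /lift_contact /dx /dy /dz /dp /dq !mxE -!val_eqE /=; split; ring.
Qed.

Lemma lift_contactP a vx vy vp vq : contact a (lift_contact a vx vy vp vq).
Proof. by apply/contactE; have [-> -> -> _ _] := lift_contactE a vx vy vp vq. Qed.

Lemma contact_eq a v w : contact a v -> contact a w -> v 0 jx = w 0 jx ->
  v 0 jy = w 0 jy -> v 0 jp = w 0 jp -> v 0 jq = w 0 jq -> v = w.
Proof.
by move=> /contactE cv /contactE cw hx hy hp hq; apply: row5P => //; rewrite cv cw hx hy.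
Qed.

Lemma contact_comb a c v w : contact a v -> contact a w -> contact a (c *: v + w).
Proof. by rewrite /contact/= pairingDr pairingZr => -> ->; rewrite mulr0 addr0. Qed.

Lemma contact0 a : contact a 0.
Proof. by rewrite /contact/= pairing0r. Qed.

Lemma contactZ a c v : contact a v -> contact a (c *: v).
Proof. by move=> cv; rewrite -[_ *: _]addr0; apply: contact_comb => //; exact: contact0. Qed.

Lemma sg_nondegenerate a v : contact a v -> v != 0 ->
  exists2 w, contact a w & sg v w != 0.
Proof.
move=> cv; apply: contra_neqP => H.
have H' w : contact a w -> sg v w = 0.
  by move=> cw; apply/eqP; apply: contrapT => /negP h; apply: H; exists w.
have e vx vy vp vq := H' _ (lift_contactP a vx vy vp vq).
have e1 := e 1 0 0 0; have e2 := e 0 1 0 0; have e3 := e 0 0 1 0; have e4 := e 0 0 0 1.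
move: e1 e2 e3 e4; rewrite /sg.
have [-> -> _ -> ->] := lift_contactE a 1 0 0 0; have [-> -> _ -> ->] := lift_contactE a 0 1 0 0.
have [-> -> _ -> ->] := lift_contactE a 0 0 1 0; have [-> -> _ -> ->] := lift_contactE a 0 0 0 1.
move=> e1 e2 e3 e4.
by apply: (contact_eq cv (contact0 a)); rewrite !mxE; lra.
Qed.

Lemma smooth_U (V : set J1) : open V -> smooth V (U : J1 -> J1).
Proof.
move=> oV; apply: (smooth_row (c := fun j a => (j == jz)%:R - a 0 jp * (j == jx)%:R - a 0 jq * (j == jy)%:R)) => //.
  by move=> j b _; rewrite /U /dx /dy /dz !mxE eqxx.
by move=> j; apply: smoothB => //; [apply: smoothB => //; first exact: smooth_cst|];
  apply: smoothM => //; first [exact: smooth_coord|exact: smooth_cst].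
Qed.

Lemma partial_U i j a : partial i (fun b => U b 0 j : R) a =
  - ((i == jp) && (j == jx))%:R - ((i == jq) && (j == jy))%:R.
Proof.
suff [] : is_derive a (delta_mx 0 i) (fun b : J1 => U b 0 j : R)
  (0 - (jp == i)%:R * (j == jx)%:R - (jq == i)%:R * (j == jy)%:R).
  by move=> _; rewrite /partial => ->; rewrite sub0r -!natrM !mulnb ![_ == i]eq_sym.
rewrite (_ : (fun b => _) = fun b : J1 => (j == jz)%:R - b 0 jp * (j == jx)%:R - b 0 jq * (j == jy)%:R).
  apply: is_deriveB; first apply: is_deriveB;
  by apply: is_derive_mulr; apply: (is_derive_eq (is_derive_coord _ _ _)); rewrite coord_delta.
by apply/funext => b; rewrite /U /dx /dy /dz !mxE eqxx.
Qed.

Lemma dform_U a v w : dform U a v w = sg v w.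
Proof.
rewrite dformE; under eq_bigr do rewrite sum5.
rewrite sum5 !partial_U -!val_eqE /= /sg; ring.
Qed.

(** Cartan's formula: the term [d (U(X))] vanishes. *)
Lemma lie_U (V : set J1) (X : J1 -> J1) a : open V -> smooth V X ->
  (forall b, V b -> contact b (X b)) -> V a -> lie_form X U a = flat (X a).
Proof.
move=> oV sX cX Va; apply/rowP => j.
have H : \sum_i (partial j (fun b => U b 0 i) a * X a 0 i
          + U a 0 i * partial j (fun b => X b 0 i) a) = 0.
  rewrite -(partial_pairing j oV (smooth_U oV) sX Va) (partial_eq _ oV Va cX).
  exact: derive_cst.
rewrite mxE big_split/=; move: H; rewrite big_split/= => /eqP.
rewrite addrC addr_eq0 => /eqP ->; rewrite -pairing_delta pairingC.
rewrite -sumrB sum5 !partial_U /pairing sum5 !coord_delta.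
have [-> -> -> -> ->] := flatE (X a).
by case: j => [[|[|[|[|[|//]]]]] Hj]; rewrite -!val_eqE /=; ring.
Qed.


(** [x] and [y] form a basis of a lagrangian plane: they are independent and the
    plane they span is its own orthogonal. *)
Definition lagrangian_basis a (P : set J1) x y :=
  [/\ (forall c d, c *: x + d *: y = 0 -> c = 0 /\ d = 0),
      P `<=` contact a,
      (forall c d, P (c *: x + d *: y)),
      (forall v, P v -> exists c d, v = c *: x + d *: y) &
      (forall v, contact a v -> P v <-> sg x v = 0 /\ sg y v = 0)].

Section LagrangianBasis.
Variables (a : J1) (P : set J1) (x y : J1).
Hypothesis xyP : lagrangian_basis a P x y.

Lemma basis_contact v : P v -> contact a v.
Proof. by case: xyP => _ + _ _ _; apply. Qed.

Lemma basis_l : P x.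
Proof. by case: xyP => _ _ /(_ 1 0) + _ _; rewrite scale1r scale0r addr0. Qed.

Lemma basis_r : P y.
Proof. by case: xyP => _ _ /(_ 0 1) + _ _; rewrite scale1r scale0r add0r. Qed.

Lemma basis_orth v w : P v -> P w -> sg v w = 0.
Proof.
move=> Pv Pw; case: xyP => _ _ _ /(_ v Pv)[c [d ->]] /(_ w (basis_contact Pw))[+ _].
by move=> /(_ Pw)[sx sy]; rewrite sgDl !sgZl sx sy !mulr0 addr0.
Qed.

Lemma basis_comb c v w : P v -> P w -> P (c *: v + w).
Proof.
case: xyP => _ _ Pc Pe _ /Pe[c1 [d1 ->]] /Pe[c2 [d2 ->]].
rewrite (_ : _ + _ = (c * c1 + c2) *: x + (c * d1 + d2) *: y)//.
by rewrite !scalerDl scalerDr !scalerA addrACA.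
Qed.

Lemma basis0 : P 0.
Proof. by case: xyP => _ _ /(_ 0 0) + _ _; rewrite !scale0r addr0. Qed.

Lemma basis_change c1 d1 c2 d2 : c1 * d2 - d1 * c2 != 0 ->
  lagrangian_basis a P (c1 *: x + d1 *: y) (c2 *: x + d2 *: y).
Proof.
move=> D0; case: (xyP) => ind Pc Pl Pe Ps; split=> [c d H||c d|v /Pe[c [d ->]]|v cv].
- have /ind[h1 h2] : (c * c1 + d * c2) *: x + (c * d1 + d * d2) *: y = 0.
    by rewrite -H !scalerDr !scalerA !scalerDl addrACA.
  have hc : c * (c1 * d2 - d1 * c2) = 0.
    rewrite (_ : _ * _ = (c * c1 + d * c2) * d2 - (c * d1 + d * d2) * c2); last by ring.
    by rewrite h1 h2 !mul0r subrr.
  have hd : d * (c1 * d2 - d1 * c2) = 0.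
    rewrite (_ : _ * _ = (c * d1 + d * d2) * c1 - (c * c1 + d * c2) * d1); last by ring.
    by rewrite h1 h2 !mul0r subrr.
  by move/eqP: hc; move/eqP: hd; rewrite !mulf_eq0 (negPf D0) !orbF => /eqP -> /eqP ->.
- exact: Pc.
- rewrite (_ : _ + _ = (c * c1 + d * c2) *: x + (c * d1 + d * d2) *: y)//.
  by rewrite !scalerDr !scalerA !scalerDl addrACA.
- exists ((c * d2 - d * c2) / (c1 * d2 - d1 * c2)), ((d * c1 - c * d1) / (c1 * d2 - d1 * c2)).
  rewrite !scalerDr !scalerA addrACA -!scalerDl; congr (_ *: _ + _ *: _); field; exact: D0.
- rewrite Ps// !sgDl !sgZl; split=> [[-> ->]|[h1 h2]]; first by rewrite !mulr0 addr0.
  have hc : sg x v * (c1 * d2 - d1 * c2) = 0.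
    rewrite [LHS](_ : _ = (c1 * sg x v + d1 * sg y v) * d2 - (c2 * sg x v + d2 * sg y v) * d1); last by ring.
    by rewrite h1 h2 !mul0r subrr.
  have hd : sg y v * (c1 * d2 - d1 * c2) = 0.
    rewrite [LHS](_ : _ = (c2 * sg x v + d2 * sg y v) * c1 - (c1 * sg x v + d1 * sg y v) * c2); last by ring.
    by rewrite h1 h2 !mul0r subrr.
  by move/eqP: hc; move/eqP: hd; rewrite !mulf_eq0 (negPf D0) !orbF => /eqP -> /eqP ->.
Qed.

Lemma basis_has_dim : has_dim P 2.
Proof.
case: (xyP) => ind _ Pl Pe _; exists (span [:: x; y]).
  have : free [:: x; y]; last by move/eqP.
  apply/freeP => k; rewrite big_ord_recl big_ord1 /= => /ind[h0 h1] [[|[|//]] Hi].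
    by rewrite -h0; congr k; exact: val_inj.
  by rewrite -h1; congr k; exact: val_inj.
apply/seteqP; split => v.
  by move=> /Pe[c [d ->]] /=; rewrite memvD// memvZ// memv_span// !inE eqxx ?orbT.
rewrite /= span_cons span_seq1 => /memv_addP[u /vlineP[c ->] [w /vlineP[d ->] ->]].
exact: Pl.
Qed.

End LagrangianBasis.
End ContactAlgebra.

(** * The characteristic distribution *)

Section Characteristic.
Context {R : realType}.
Local Notation J1 := 'rV[R]_5.
Variables (N A B C D : J1 -> R).
Let omega := ma_form N A B C D.
Let P := characteristic omega.

Lemma wedge_delta i j (v w : J1) :
  wedge (delta_mx 0 i) (delta_mx 0 j) v w = v 0 i * w 0 j - w 0 i * v 0 j.
Proof. by rewrite /wedge !pairing_delta. Qed.

Lemma omegaE a v w : omega a v w =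
  D a * (v 0 jx * w 0 jy - w 0 jx * v 0 jy)
  + B a / 2 * (v 0 jx * w 0 jp - w 0 jx * v 0 jp)
  + C a * (v 0 jx * w 0 jq - w 0 jx * v 0 jq)
  - A a * (v 0 jy * w 0 jp - w 0 jy * v 0 jp)
  - B a / 2 * (v 0 jy * w 0 jq - w 0 jy * v 0 jq)
  + N a * (v 0 jp * w 0 jq - w 0 jp * v 0 jq).
Proof. by rewrite /omega /ma_form /dx /dy /dp /dq !wedge_delta. Qed.

(* the contractions of [omega] with the coordinate directions of the contact
   hyperplane, up to sign *)
Let m1 a (v : J1) := D a * v 0 jy + B a / 2 * v 0 jp + C a * v 0 jq.
Let m2 a (v : J1) := D a * v 0 jx + A a * v 0 jp + B a / 2 * v 0 jq.
Let m3 a (v : J1) := B a / 2 * v 0 jx - A a * v 0 jy - N a * v 0 jq.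
Let m4 a (v : J1) := C a * v 0 jx - B a / 2 * v 0 jy + N a * v 0 jp.

Lemma characteristicE a v : P a v <->
  contact a v /\ [/\ m1 a v = 0, m2 a v = 0, m3 a v = 0 & m4 a v = 0].
Proof.
split=> [[cv H]|[cv [h1 h2 h3 h4]]]; split => //.
  have e vx vy vp vq := H _ (lift_contactP a vx vy vp vq).
  move: (e 1 0 0 0) (e 0 1 0 0) (e 0 0 1 0) (e 0 0 0 1); rewrite !omegaE.
  have [-> -> _ -> ->] := lift_contactE a 1 0 0 0; have [-> -> _ -> ->] := lift_contactE a 0 1 0 0.
  have [-> -> _ -> ->] := lift_contactE a 0 0 1 0; have [-> -> _ -> ->] := lift_contactE a 0 0 0 1.
  by rewrite /m1 /m2 /m3 /m4 => e1 e2 e3 e4; split; lra.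
move=> w _; rewrite omegaE.
rewrite [LHS](_ : _ = w 0 jy * m2 a v - w 0 jx * m1 a v + w 0 jp * m3 a v + w 0 jq * m4 a v).
  by rewrite h1 h2 h3 h4 !mulr0 subrr !addr0.
by rewrite /m1 /m2 /m3 /m4; ring.
Qed.

(* the columns of the Hodge dual of the matrix of [omega] on the contact hyperplane;
   the product of the two matrices is the Pfaffian times the identity, and
   parabolicity is the vanishing of the Pfaffian *)
Let K1 a := lift_contact a 0 (N a) (B a / 2) (- A a).
Let K2 a := lift_contact a (- N a) 0 (C a) (- (B a / 2)).
Let K3 a := lift_contact a (- (B a / 2)) (- C a) 0 (D a).
Let K4 a := lift_contact a (A a) (B a / 2) (- D a) 0.

Let sgK1 a v : sg (K1 a) v = - m3 a v.
Proof. by rewrite /sg /K1; have [-> -> _ -> ->] := lift_contactE a 0 (N a) (B a / 2) (- A a); rewrite /m3; ring. Qed.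
Let sgK2 a v : sg (K2 a) v = - m4 a v.
Proof. by rewrite /sg /K2; have [-> -> _ -> ->] := lift_contactE a (- N a) 0 (C a) (- (B a / 2)); rewrite /m4; ring. Qed.
Let sgK3 a v : sg (K3 a) v = - m1 a v.
Proof. by rewrite /sg /K3; have [-> -> _ -> ->] := lift_contactE a (- (B a / 2)) (- C a) 0 (D a); rewrite /m1; ring. Qed.
Let sgK4 a v : sg (K4 a) v = m2 a v.
Proof. by rewrite /sg /K4; have [-> -> _ -> ->] := lift_contactE a (A a) (B a / 2) (- D a) 0; rewrite /m2; ring. Qed.

Section AtPoint.
Variable a : J1.
Hypothesis par : B a ^+ 2 - 4 * A a * C a + 4 * N a * D a = 0.

Let PK1 : P a (K1 a).
Proof.
apply/characteristicE; split; first exact: lift_contactP.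
rewrite /m1 /m2 /m3 /m4 /K1; have [-> -> _ -> ->] := lift_contactE a 0 (N a) (B a / 2) (- A a).
by split; first [ring | rewrite -[RHS](mulr0 4^-1) -par; field | rewrite -[RHS](mulr0 (- 4^-1)) -par; field].
Qed.
Let PK2 : P a (K2 a).
Proof.
apply/characteristicE; split; first exact: lift_contactP.
rewrite /m1 /m2 /m3 /m4 /K2; have [-> -> _ -> ->] := lift_contactE a (- N a) 0 (C a) (- (B a / 2)).
by split; first [ring | rewrite -[RHS](mulr0 4^-1) -par; field | rewrite -[RHS](mulr0 (- 4^-1)) -par; field].
Qed.
Let PK3 : P a (K3 a).
Proof.
apply/characteristicE; split; first exact: lift_contactP.
rewrite /m1 /m2 /m3 /m4 /K3; have [-> -> _ -> ->] := lift_contactE a (- (B a / 2)) (- C a) 0 (D a).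
by split; first [ring | rewrite -[RHS](mulr0 4^-1) -par; field | rewrite -[RHS](mulr0 (- 4^-1)) -par; field].
Qed.
Let PK4 : P a (K4 a).
Proof.
apply/characteristicE; split; first exact: lift_contactP.
rewrite /m1 /m2 /m3 /m4 /K4; have [-> -> _ -> ->] := lift_contactE a (A a) (B a / 2) (- D a) 0.
by split; first [ring | rewrite -[RHS](mulr0 4^-1) -par; field | rewrite -[RHS](mulr0 (- 4^-1)) -par; field].
Qed.

Let P_comb c d v w : P a v -> P a w -> P a (c *: v + d *: w).
Proof.
move=> /characteristicE[cv [v1 v2 v3 v4]] /characteristicE[cw [w1 w2 w3 w4]].
apply/characteristicE; split; first by apply: contact_comb => //; exact: contactZ.
split.
- have -> : m1 a (c *: v + d *: w) = c * m1 a v + d * m1 a w by rewrite /m1 !mxE; ring.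
  by rewrite v1 w1 !mulr0 addr0.
- have -> : m2 a (c *: v + d *: w) = c * m2 a v + d * m2 a w by rewrite /m2 !mxE; ring.
  by rewrite v2 w2 !mulr0 addr0.
- have -> : m3 a (c *: v + d *: w) = c * m3 a v + d * m3 a w by rewrite /m3 !mxE; ring.
  by rewrite v3 w3 !mulr0 addr0.
- have -> : m4 a (c *: v + d *: w) = c * m4 a v + d * m4 a w by rewrite /m4 !mxE; ring.
  by rewrite v4 w4 !mulr0 addr0.
Qed.

(* two of the four equations suffice, once they determine a combination of two
   of the four fields *)
Let basis_of x y (e f : J1 -> R) : P a x -> P a y ->
  (forall v, sg x v = 0 <-> e v = 0) -> (forall v, sg y v = 0 <-> f v = 0) ->
  (forall v, P a v -> e v = 0 /\ f v = 0) ->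
  (forall c d, c *: x + d *: y = 0 -> c = 0 /\ d = 0) ->
  (forall v, contact a v -> e v = 0 -> f v = 0 -> exists c d, v = c *: x + d *: y) ->
  lagrangian_basis a (P a) x y.
Proof.
move=> Px Py se sf Pef ind sol; split => // [v []//|c d|v Pv|v cv].
- exact: P_comb.
- by have [ev fv] := Pef v Pv; apply: sol => //; case: Pv.
- split=> [/Pef[ev fv]|[/se ev /sf fv]]; first by split; [apply/se|apply/sf].
  by have [c [d ->]] := sol v cv ev fv; exact: P_comb.
Qed.

Let oppr_iff (x : R) : - x = 0 <-> x = 0.
Proof. by split=> [/eqP|->]; rewrite ?oppr0// oppr_eq0 => /eqP. Qed.

Let K1E := lift_contactE a 0 (N a) (B a / 2) (- A a).
Let K2E := lift_contactE a (- N a) 0 (C a) (- (B a / 2)).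
Let K3E := lift_contactE a (- (B a / 2)) (- C a) 0 (D a).
Let K4E := lift_contactE a (A a) (B a / 2) (- D a) 0.

Let coords_of (v : J1) : v = 0 -> [/\ v 0 jx = 0, v 0 jy = 0, v 0 jp = 0 & v 0 jq = 0].
Proof. by move=> ->; rewrite !mxE. Qed.

Let combE c d (x y : J1) j : (c *: x + d *: y) 0 j = c * x 0 j + d * y 0 j.
Proof. by rewrite !mxE. Qed.

Let mul_eq0l (k c : R) : k != 0 -> c * k = 0 -> c = 0.
Proof. by move=> k0 /eqP; rewrite mulf_eq0 (negPf k0) orbF => /eqP. Qed.

Lemma basis_N : N a != 0 -> lagrangian_basis a (P a) (K1 a) (K2 a).
Proof.
move=> N0; apply: (basis_of (e := m3 a) (f := m4 a)).
- exact: PK1.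
- exact: PK2.
- by move=> v; rewrite sgK1 oppr_iff.
- by move=> v; rewrite sgK2 oppr_iff.
- by move=> v /characteristicE[_ []].
- move=> c d /coords_of; rewrite !combE /K1 /K2; have [-> -> _ -> ->] := K1E; have [-> -> _ -> ->] := K2E.
  move=> [h1 h2 _ _]; split; apply: (mul_eq0l N0); lra.
- move=> v cv; rewrite /m3 /m4 => e3 e4; exists (v 0 jy / N a), (- (v 0 jx / N a)).
  have cK : contact a ((v 0 jy / N a) *: K1 a + (- (v 0 jx / N a)) *: K2 a).
    by apply: contact_comb; [|apply: contactZ]; exact: lift_contactP.
  have [x1 y1 _ p1 q1] := K1E; have [x2 y2 _ p2 q2] := K2E.
  apply: (contact_eq cv cK); rewrite !combE /K1 /K2 ?x1 ?x2 ?y1 ?y2 ?p1 ?p2 ?q1 ?q2.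
  + by field.
  + by field.
  + have -> : v 0 jp = (B a / 2 * v 0 jy - C a * v 0 jx) / N a; last by field.
    by apply: (mulIf N0); rewrite divfK//; lra.
  + have -> : v 0 jq = (B a / 2 * v 0 jx - A a * v 0 jy) / N a; last by field.
    by apply: (mulIf N0); rewrite divfK//; lra.
Qed.

Lemma basis_A : A a != 0 -> lagrangian_basis a (P a) (K1 a) (K4 a).
Proof.
move=> A0; apply: (basis_of (e := m3 a) (f := m2 a)).
- exact: PK1.
- exact: PK4.
- by move=> v; rewrite sgK1 oppr_iff.
- by move=> v; rewrite sgK4.
- by move=> v /characteristicE[_ []].
- move=> c d /coords_of; rewrite !combE /K1 /K4; have [-> -> _ -> ->] := K1E; have [-> -> _ -> ->] := K4E.
  move=> [h1 h2 h3 h4]; split; apply: (mul_eq0l A0); lra.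
- move=> v cv; rewrite /m3 /m2 => e3 e2; exists (- (v 0 jq / A a)), (v 0 jx / A a).
  have cK : contact a ((- (v 0 jq / A a)) *: K1 a + (v 0 jx / A a) *: K4 a).
    by apply: contact_comb; [|apply: contactZ]; exact: lift_contactP.
  have [x1 y1 _ p1 q1] := K1E; have [x2 y2 _ p2 q2] := K4E.
  apply: (contact_eq cv cK); rewrite !combE /K1 /K4 ?x1 ?x2 ?y1 ?y2 ?p1 ?p2 ?q1 ?q2.
  + by field.
  + have -> : v 0 jy = (B a / 2 * v 0 jx - N a * v 0 jq) / A a; last by field.
    by apply: (mulIf A0); rewrite divfK//; lra.
  + have -> : v 0 jp = - (D a * v 0 jx + B a / 2 * v 0 jq) / A a; last by field.
    by apply: (mulIf A0); rewrite divfK//; lra.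
  + by field.
Qed.

Lemma basis_C : C a != 0 -> lagrangian_basis a (P a) (K2 a) (K3 a).
Proof.
move=> C0; apply: (basis_of (e := m4 a) (f := m1 a)).
- exact: PK2.
- exact: PK3.
- by move=> v; rewrite sgK2 oppr_iff.
- by move=> v; rewrite sgK3 oppr_iff.
- by move=> v /characteristicE[_ []].
- move=> c d /coords_of; rewrite !combE /K2 /K3; have [-> -> _ -> ->] := K2E; have [-> -> _ -> ->] := K3E.
  move=> [h1 h2 h3 h4]; split; apply: (mul_eq0l C0); lra.
- move=> v cv; rewrite /m4 /m1 => e4 e1; exists (v 0 jp / C a), (- (v 0 jy / C a)).
  have cK : contact a ((v 0 jp / C a) *: K2 a + (- (v 0 jy / C a)) *: K3 a).
    by apply: contact_comb; [|apply: contactZ]; exact: lift_contactP.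
  have [x1 y1 _ p1 q1] := K2E; have [x2 y2 _ p2 q2] := K3E.
  apply: (contact_eq cv cK); rewrite !combE /K2 /K3 ?x1 ?x2 ?y1 ?y2 ?p1 ?p2 ?q1 ?q2.
  + have -> : v 0 jx = (B a / 2 * v 0 jy - N a * v 0 jp) / C a; last by field.
    by apply: (mulIf C0); rewrite divfK//; lra.
  + by field.
  + by field.
  + have -> : v 0 jq = - (D a * v 0 jy + B a / 2 * v 0 jp) / C a; last by field.
    by apply: (mulIf C0); rewrite divfK//; lra.
Qed.

Lemma basis_D : D a != 0 -> lagrangian_basis a (P a) (K3 a) (K4 a).
Proof.
move=> D0; apply: (basis_of (e := m1 a) (f := m2 a)).
- exact: PK3.
- exact: PK4.
- by move=> v; rewrite sgK3 oppr_iff.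
- by move=> v; rewrite sgK4.
- by move=> v /characteristicE[_ []].
- move=> c d /coords_of; rewrite !combE /K3 /K4; have [-> -> _ -> ->] := K3E; have [-> -> _ -> ->] := K4E.
  move=> [h1 h2 h3 h4]; split; apply: (mul_eq0l D0); lra.
- move=> v cv; rewrite /m1 /m2 => e1 e2; exists (v 0 jq / D a), (- (v 0 jp / D a)).
  have cK : contact a ((v 0 jq / D a) *: K3 a + (- (v 0 jp / D a)) *: K4 a).
    by apply: contact_comb; [|apply: contactZ]; exact: lift_contactP.
  have [x1 y1 _ p1 q1] := K3E; have [x2 y2 _ p2 q2] := K4E.
  apply: (contact_eq cv cK); rewrite !combE /K3 /K4 ?x1 ?x2 ?y1 ?y2 ?p1 ?p2 ?q1 ?q2.
  + have -> : v 0 jx = - (A a * v 0 jp + B a / 2 * v 0 jq) / D a; last by field.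
    by apply: (mulIf D0); rewrite divfK//; lra.
  + have -> : v 0 jy = - (B a / 2 * v 0 jp + C a * v 0 jq) / D a; last by field.
    by apply: (mulIf D0); rewrite divfK//; lra.
  + by field.
  + by field.
Qed.

Lemma basis_B : B a != 0 -> lagrangian_basis a (P a) (K1 a) (K3 a).
Proof.
move=> B0; apply: (basis_of (e := m3 a) (f := m1 a)).
- exact: PK1.
- exact: PK3.
- by move=> v; rewrite sgK1 oppr_iff.
- by move=> v; rewrite sgK3 oppr_iff.
- by move=> v /characteristicE[_ []].
- move=> c d /coords_of; rewrite !combE /K1 /K3; have [-> -> _ -> ->] := K1E; have [-> -> _ -> ->] := K3E.
  move=> [h1 h2 h3 h4]; split; apply: (mul_eq0l B0); lra.
- move=> v cv; rewrite /m3 /m1 => e3 e1.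
  exists (2 * v 0 jp / B a), (- (2 * v 0 jx / B a)).
  have cK : contact a ((2 * v 0 jp / B a) *: K1 a + (- (2 * v 0 jx / B a)) *: K3 a).
    by apply: contact_comb; [|apply: contactZ]; exact: lift_contactP.
  have BB : B a * B a = 4 * (A a * C a - N a * D a).
    by have := par; rewrite expr2 => p; lra.
  have hx : v 0 jx = 2 * (A a * v 0 jy + N a * v 0 jq) / B a.
    by apply: (mulIf B0); rewrite divfK//; lra.
  have hp : v 0 jp = - 2 * (D a * v 0 jy + C a * v 0 jq) / B a.
    by apply: (mulIf B0); rewrite divfK//; lra.
  have [x1 y1 _ p1 q1] := K1E; have [x2 y2 _ p2 q2] := K3E.
  apply: (contact_eq cv cK); rewrite !combE /K1 /K3 ?x1 ?x2 ?y1 ?y2 ?p1 ?p2 ?q1 ?q2.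
  + by field.
  + rewrite hx hp; apply: (mulIf B0); apply: (mulIf B0).
    rewrite [RHS](_ : _ = 4 * (A a * C a - N a * D a) * v 0 jy); last by field.
    by rewrite -mulrA BB mulrC.
  + by field.
  + rewrite hx hp; apply: (mulIf B0); apply: (mulIf B0).
    rewrite [RHS](_ : _ = 4 * (A a * C a - N a * D a) * v 0 jq); last by field.
    by rewrite -mulrA BB mulrC.
Qed.

End AtPoint.

Variable Om : set J1.
Hypothesis oOm : open Om.
Hypothesis sma : monge_ampere Om N A B C D.
Hypothesis par : parabolic Om N A B C D.

Let smooth_lift (vx vy vp vq : J1 -> R) : smooth Om vx -> smooth Om vy ->
  smooth Om vp -> smooth Om vq ->
  smooth Om (fun a => lift_contact a (vx a) (vy a) (vp a) (vq a)).
Proof.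
move=> sx sy sp sq; apply: (smooth_row (c := fun j a =>
   vx a * (j == jx)%:R + vy a * (j == jy)%:R + (a 0 jp * vx a + a 0 jq * vy a) * (j == jz)%:R
   + vp a * (j == jp)%:R + vq a * (j == jq)%:R)) => //.
  by move=> j b _; rewrite /lift_contact /dx /dy /dz /dp /dq !mxE eqxx.
by move=> j; do ?[apply: smoothD => //]; apply: smoothM => //; do ?[exact: smooth_cst];
  apply: smoothD => //; apply: smoothM => //; exact: smooth_coord.
Qed.

(** The four fields [K1], ..., [K4] are all characteristic, and where a coefficient
    of the equation does not vanish two of those that have it as an entry are
    independent. *)
Lemma characteristic_frame a : Om a -> exists (W : set J1) (X Y : J1 -> J1),
  [/\ [/\ open W, W a & W `<=` Om], smooth W X, smooth W Y &
      forall b, W b -> lagrangian_basis b (P b) (X b) (Y b)].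
Proof.
move=> Oa; have [[sN sA sB sC sD] nz] := sma.
have s0 : smooth Om (fun=> 0 : R) by exact: smooth_cst.
have sB2 : smooth Om (fun a => B a / 2) by apply: smoothM => //; exact: smooth_cst.
have sK1 : smooth Om K1 by apply: smooth_lift => //; exact: smoothN.
have sK2 : smooth Om K2 by apply: smooth_lift => //; exact: smoothN.
have sK3 : smooth Om K3 by apply: smooth_lift => //; exact: smoothN.
have sK4 : smooth Om K4 by apply: smooth_lift => //; exact: smoothN.
have frame (f : J1 -> R) X Y : smooth Om f -> smooth Om X -> smooth Om Y -> f a != 0 ->
  (forall b, Om b -> f b != 0 -> lagrangian_basis b (P b) (X b) (Y b)) ->
  exists (W : set J1) (X Y : J1 -> J1),
  [/\ [/\ open W, W a & W `<=` Om], smooth W X, smooth W Y &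
      forall b, W b -> lagrangian_basis b (P b) (X b) (Y b)].
  move=> sf sX sY fa H; exists (Om `&` [set b | f b != 0]), X, Y; split.
  - by split; [exact: open_neq0|split|move=> b []].
  - by apply: smooth_sub sX => b [].
  - by apply: smooth_sub sY => b [].
  - by move=> b [Ob fb]; exact: H.
have [N0|N0] := eqVneq (N a) 0; last first.
  by apply: (frame N K1 K2) => // b Ob Nb; apply: basis_N => //; exact: par.
have [A0|A0] := eqVneq (A a) 0; last first.
  by apply: (frame A K1 K4) => // b Ob Ab; apply: basis_A => //; exact: par.
have [B0|B0] := eqVneq (B a) 0; last first.
  by apply: (frame B K1 K3) => // b Ob Bb; apply: basis_B => //; exact: par.
have [C0|C0] := eqVneq (C a) 0; last first.
  by apply: (frame C K2 K3) => // b Ob Cb; apply: basis_C => //; exact: par.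
have [D0|D0] := eqVneq (D a) 0; last first.
  by apply: (frame D K3 K4) => // b Ob Db; apply: basis_D => //; exact: par.
by case: (nz a Oa).
Qed.

End Characteristic.

(** * The derived distribution of a lagrangian plane field *)

Section Dimension.
Context {R : realType}.
Local Notation J1 := 'rV[R]_5.

Lemma has_dim_le (S S' : set J1) k l : S `<=` S' -> has_dim S k -> has_dim S' l ->
  (k <= l)%N.
Proof.
move=> SS [W1 <- E1] [W2 <- E2]; apply: dimvS; apply/subvP => v.
by have := SS v; rewrite E1 E2 /=; exact.
Qed.

Lemma has_dim_eq (S S' : set J1) k : S `<=` S' -> has_dim S k -> has_dim S' k ->
  S = S'.
Proof.
move=> SS [W1 d1 E1] [W2 d2 E2].
have sub : (W1 <= W2)%VS by apply/subvP => v; have := SS v; rewrite E1 E2 /=; exact.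
have /eqP WW : W1 == W2 by rewrite eqEdim sub d1 d2 leqnn.
by rewrite E1 E2 WW.
Qed.

Lemma U_neq0 (b : J1) : U b != 0.
Proof.
apply/eqP => /(congr1 (fun v : J1 => v 0 jz)).
by have [_ _ -> _ _] := UE b; rewrite mxE => /eqP; rewrite oner_eq0.
Qed.

Lemma smooth_flat (V : set J1) (X : J1 -> J1) : open V -> smooth V X ->
  smooth V (fun b => flat (X b)).
Proof.
move=> oV sX; apply: (smooth_row (c := fun j b =>
  X b 0 jx * (j == jp)%:R - X b 0 jp * (j == jx)%:R + X b 0 jy * (j == jq)%:R
  - X b 0 jq * (j == jy)%:R)) => //.
  by move=> j b _; rewrite /flat /dx /dy /dp /dq !mxE eqxx.
have t i j : smooth V (fun b => X b 0 i * (j : bool)%:R).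
  by apply: smoothM => //; [exact: smooth_comp_coord|exact: smooth_cst].
by move=> j; do ?[apply: smoothB => // | apply: smoothD => //].
Qed.

Lemma smooth_sg (V : set J1) (X Y : J1 -> J1) : open V -> smooth V X -> smooth V Y ->
  smooth V (fun b => sg (X b) (Y b)).
Proof.
move=> oV sX sY; apply: smooth_eq (smooth_pairing oV (smooth_flat oV sX) sY) => // b _.
exact: pairing_flat.
Qed.

Lemma pairing_U_bracket (V : set J1) (X Y : J1 -> J1) b : open V -> smooth V X ->
  smooth V Y -> V b -> (forall c, V c -> contact c (X c)) ->
  (forall c, V c -> contact c (Y c)) ->
  pairing (U b) (bracket X Y b) = - sg (X b) (Y b).
Proof.
move=> oV sX sY Vb cX cY.
by rewrite (pairing_bracket0 oV (smooth_U oV) sX sY Vb cX cY) dform_U.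
Qed.

Section Annihilator.
Variables (b x : J1).
Hypothesis cx : contact b x.
Hypothesis x0 : x != 0.

Lemma free_U_flat : free [:: U b; flat x].
Proof.
have [w cw sw] := sg_nondegenerate cx x0.
apply/freeP => k; rewrite big_ord_recl big_ord1 /= => H.
have h1 : k (lift ord0 ord0) = 0.
  have := congr1 (fun u => pairing u w) H.
  rewrite pairingDl !pairingZl pairing0l pairing_flat [pairing (U b) w]cw mulr0 add0r.
  by move/eqP; rewrite mulf_eq0 (negPf sw) orbF => /eqP.
have h0 : k ord0 = 0.
  move: H; rewrite h1 scale0r addr0 => /eqP.
  by rewrite scaler_eq0 (negPf (U_neq0 b)) orbF => /eqP.
move=> [[|[|//]] Hi]; first by rewrite -h0; congr k; exact: val_inj.
by rewrite -h1; congr k; exact: val_inj.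
Qed.

(** The orthogonal of [x] in the contact space is the common kernel of the two
    independent forms [U] and [flat x]. *)
Lemma span_U_flat (be : J1) :
  (forall v, contact b v -> sg x v = 0 -> pairing be v = 0) ->
  be \in span [:: U b; flat x].
Proof.
move=> H; have [w cw sw] := sg_nondegenerate cx x0.
have [c] : exists c, be - (pairing be w / sg x w) *: flat x = c *: U b.
  apply: pairing_ker_sub; first exact: U_neq0.
  move=> v cv; rewrite -scaleNr pairingDl pairingZl pairing_flat mulNr.
  have := H (- (sg x v / sg x w) *: w + v) (contact_comb _ cw cv).
  rewrite sgDr sgZr mulNr divfK// addNr => /(_ erefl).
  by rewrite pairingDr pairingZr mulNr => /eqP; rewrite addrC subr_eq0 => /eqP ->; field.
move/eqP; rewrite subr_eq => /eqP ->.
by rewrite memvD// memvZ// memv_span// !inE eqxx ?orbT.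
Qed.

Lemma span_U_flat_kill (be v : J1) : be \in span [:: U b; flat x] ->
  contact b v -> sg x v = 0 -> pairing be v = 0.
Proof.
rewrite span_cons span_seq1 => /memv_addP[u /vlineP[c ->] [w /vlineP[d ->] ->]] cv sv.
by rewrite pairingDl !pairingZl pairing_flat sv [pairing (U b) v]cv !mulr0 addr0.
Qed.

End Annihilator.
End Dimension.

Section BracketModulo.
Context {R : realType}.
Local Notation J1 := 'rV[R]_5.
Variables (P : J1 -> set J1) (W : set J1) (X Y : J1 -> J1).
Hypothesis oW : open W.
Hypothesis sX : smooth W X.
Hypothesis sY : smooth W Y.
Hypothesis XYP : forall b, W b -> lagrangian_basis b (P b) (X b) (Y b).

Lemma frame_bracket_contact V S T b : open V -> V `<=` W -> is_section V P S ->
  is_section V P T -> V b -> contact b (bracket S T b).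
Proof.
move=> oV VW [sS PS] [sT PT] Vb; rewrite /contact/= (pairing_U_bracket oV sS sT Vb).
- by rewrite (basis_orth (XYP (VW _ Vb)) (PS _ Vb) (PT _ Vb)) oppr0.
- by move=> c Vc; exact: (basis_contact (XYP (VW _ Vc)) (PS _ Vc)).
- by move=> c Vc; exact: (basis_contact (XYP (VW _ Vc)) (PT _ Vc)).
Qed.

(** A lagrangian plane field is cut out by forms, so the bracket of two sections
    is, modulo the plane, a bilinear alternating function of their values. *)
Lemma bracket_modulo V S T b c1 d1 c2 d2 : open V -> V `<=` W ->
  is_section V P S -> is_section V P T -> V b ->
  S b = c1 *: X b + d1 *: Y b -> T b = c2 *: X b + d2 *: Y b ->
  P b (bracket S T b - (c1 * d2 - d1 * c2) *: bracket X Y b).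
Proof.
move=> oV VW sS sT Vb SE TE.
have PX : is_section V P X.
  by split; [exact: smooth_sub VW sX|move=> c /VW Wc; exact: basis_l (XYP Wc)].
have PY : is_section V P Y.
  by split; [exact: smooth_sub VW sY|move=> c /VW Wc; exact: basis_r (XYP Wc)].
have c1' := frame_bracket_contact oV VW sS sT Vb.
have c2' := frame_bracket_contact oV VW PX PY Vb.
have key (K : J1 -> J1) : is_section V P K ->
    sg (K b) (bracket S T b) = (c1 * d2 - d1 * c2) * sg (K b) (bracket X Y b).
  move=> [sK PK]; rewrite -!pairing_flat.
  have kill F : is_section V P F -> forall c, V c -> pairing (flat (K c)) (F c) = 0.
    move=> [_ PF] c Vc; rewrite pairing_flat.
    exact: (basis_orth (XYP (VW _ Vc)) (PK _ Vc) (PF _ Vc)).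
  rewrite (pairing_bracket0 oV (smooth_flat oV sK) sS.1 sT.1 Vb (kill _ sS) (kill _ sT)).
  rewrite (pairing_bracket0 oV (smooth_flat oV sK) PX.1 PY.1 Vb (kill _ PX) (kill _ PY)).
  by rewrite SE TE dform_comb2 mulrN.
have cc : contact b (bracket S T b - (c1 * d2 - d1 * c2) *: bracket X Y b).
  by rewrite -scaleNr addrC; exact: contact_comb.
case: (XYP (VW _ Vb)) => _ _ _ _ /(_ _ cc) [_]; apply.
by rewrite -scaleNr !sgDr !sgZr (key X PX) (key Y PY) !mulNr !subrr.
Qed.

Lemma section_value V S b : V `<=` W -> is_section V P S -> V b ->
  exists c d, S b = c *: X b + d *: Y b.
Proof.
move=> VW [_ PS] Vb; case: (XYP (VW _ Vb)) => _ _ _ H _; exact/H/PS.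
Qed.

(** Only one bracket has to be examined, that of the frame: the others are
    multiples of it modulo the plane. *)
Lemma derived_value b v (Q : J1 -> Prop) : W b -> Q 0 ->
  (forall c u w, Q u -> Q w -> Q (c *: u + w)) -> (forall u, P b u -> Q u) ->
  Q (bracket X Y b) -> derived P b v -> Q v.
Proof.
move=> Wb Q0 Qc QP QZ; apply: linspan_ind => // w [/QP//|].
move=> [V [S [T [oV Vb sS sT ->]]]].
have sub : W `&` V `<=` V by move=> c [].
have WV : W `&` V `<=` W by move=> c [].
have o : open (W `&` V) by exact: openI.
have sS' : is_section (W `&` V) P S.
  by case: sS => h1 h2; split; [exact: smooth_sub sub h1|move=> c /sub/h2].
have sT' : is_section (W `&` V) P T.
  by case: sT => h1 h2; split; [exact: smooth_sub sub h1|move=> c /sub/h2].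
have WVb : (W `&` V) b by [].
have [c1 [d1 SE]] := section_value WV sS' WVb.
have [c2 [d2 TE]] := section_value WV sT' WVb.
have := QP _ (bracket_modulo o WV sS' sT' WVb SE TE).
set k := c1 * d2 - d1 * c2; set Z := bracket X Y b => H.
rewrite (_ : bracket S T b = k *: Z + (bracket S T b - k *: Z)); first exact: Qc.
by rewrite addrC subrK.
Qed.

End BracketModulo.

(** * Type 2 sections of a lagrangian plane field *)

Lemma has_dim_lin {R : realType} (S : set 'rV[R]_5) k c u v : has_dim S k ->
  S u -> S v -> S (c *: u + v).
Proof. by move=> [W _ ->] /= Wu Wv; rewrite memvD ?memvZ. Qed.

Section LagrangianDistribution.
Context {R : realType}.
Local Notation J1 := 'rV[R]_5.
Variables (P : J1 -> set J1) (Om : set J1).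
Hypothesis oOm : open Om.
Hypothesis frames : forall a, Om a -> exists (W : set J1) (X Y : J1 -> J1),
  [/\ [/\ open W, W a & W `<=` Om], smooth W X, smooth W Y &
      forall b, W b -> lagrangian_basis b (P b) (X b) (Y b)].
Hypothesis rank' : constant_rank Om (derived P).
Hypothesis rank'' : forall a, Om a -> has_dim (derived (derived P) a) 4.

(** If the bracket of a frame were a section of the plane field at one point, the
    constant rank of the derived distribution would make the plane field
    involutive, and the second derived distribution would not grow. *)
Lemma frame_bracket_notin (W : set J1) (X Y : J1 -> J1) b : open W -> W `<=` Om -> smooth W X -> smooth W Y ->
  (forall b, W b -> lagrangian_basis b (P b) (X b) (Y b)) -> W b ->
  ~ P b (bracket X Y b).
Proof.
move=> oW WOm sX sY XYP Wb PZ; have Ob := WOm _ Wb.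
have P'b : derived P b = P b.
  apply/seteqP; split => v; last by move=> Pv; apply: sub_linspan; left.
  apply: (derived_value oW sX sY XYP Wb) => //; first exact: basis0 (XYP _ Wb).
  by move=> c u w Pu Pw; exact: (basis_comb (XYP _ Wb) c Pu Pw).
have d2 := basis_has_dim (XYP _ Wb).
have [k hk] := rank'.
have k2 : k = 2%N.
  have h := hk b Ob; rewrite P'b in h.
  by apply/eqP; rewrite eqn_leq (has_dim_le _ h d2)// (has_dim_le _ d2 h).
have P'P c : Om c -> derived P c = P c.
  move=> Oc; have [W1 [X1 [Y1 [[_ Wc _] _ _ H]]]] := frames Oc.
  apply/esym/(@has_dim_eq _ _ _ 2) => [v Pv||].
  - by apply: sub_linspan; left.
  - exact: basis_has_dim (H _ Wc).
  - by move: (hk c Oc); rewrite k2.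
suff /has_dim_le/(_ (rank'' Ob) d2) : derived (derived P) b `<=` P b by [].
move=> v; apply: linspan_ind => [|c u w|w].
- exact: basis0 (XYP _ Wb).
- by move=> Pu Pw; exact: (basis_comb (XYP _ Wb) c Pu Pw).
rewrite P'b => -[//|[V [S [T [oV Vb [sS PS] [sT PT] ->]]]]]; rewrite -P'b.
apply: sub_linspan; right; exists (V `&` Om), S, T.
have sub : V `&` Om `<=` V by move=> c [].
split => //; first exact: openI.
- by split; [exact: smooth_sub sub sS|move=> c [Vc Oc]; rewrite -P'P//; exact: PS].
- by split; [exact: smooth_sub sub sT|move=> c [Vc Oc]; rewrite -P'P//; exact: PT].
Qed.

(** The combination of the frame that is orthogonal to its bracket is orthogonal
    to the whole derived distribution; it is the direction sought. *)
Lemma adapted_frame a : Om a -> exists (W : set J1) (X Y : J1 -> J1),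
  [/\ [/\ open W, W a & W `<=` Om], smooth W X, smooth W Y &
      forall b, W b -> [/\ lagrangian_basis b (P b) (X b) (Y b),
        sg (X b) (bracket X Y b) = 0 & sg (Y b) (bracket X Y b) != 0]].
Proof.
move=> Oa; have [W [X1 [X2 [[oW Wa WOm] s1 s2 XYP]]]] := frames Oa.
set Z := bracket X1 X2.
have sZ : smooth W Z by exact: smooth_bracket.
pose e1 b := sg (X1 b) (Z b); pose e2 b := sg (X2 b) (Z b).
have se1 : smooth W e1 by exact: smooth_sg.
have se2 : smooth W e2 by exact: smooth_sg.
(* completing by the combination with constant coefficients [(e1 a, e2 a)] makes the
   determinant of the change of frame a sum of squares at [a] *)
pose D b := e2 b * e2 a + e1 b * e1 a.
have sD : smooth W D by exact: smoothD oW (smoothM oW se2 (smooth_cst _ _)) (smoothM oW se1 (smooth_cst _ _)).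
have P1 : is_section W P X1 by split=> // b Wb; exact: basis_l (XYP _ Wb).
have P2 : is_section W P X2 by split=> // b Wb; exact: basis_r (XYP _ Wb).
have cZ b : W b -> contact b (Z b) by exact: (frame_bracket_contact XYP oW).
have Da : D a != 0.
  apply/eqP => D0; apply: (frame_bracket_notin oW WOm s1 s2 XYP Wa).
  case: (XYP _ Wa) => _ _ _ _ /(_ _ (cZ _ Wa)) [_]; apply.
  move: D0; rewrite /D -/(e1 a) -/(e2 a) => /eqP.
  by rewrite paddr_eq0 -?expr2 ?sqr_ge0// !sqrf_eq0 => /andP[/eqP -> /eqP ->].
pose X b := e2 b *: X1 b + (- e1 b) *: X2 b.
pose Y b := e1 a *: X1 b + e2 a *: X2 b.
have sub : W `&` [set b | D b != 0] `<=` W by move=> b [].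
have o : open (W `&` [set b | D b != 0]) by exact: open_neq0.
have sX : smooth W X.
  exact: smooth_add oW (smooth_scale oW se2 s1) (smooth_scale oW (smoothN oW se1) s2).
have sY : smooth W Y.
  by apply: smooth_add oW (smooth_scale oW _ s1) (smooth_scale oW _ s2); exact: smooth_cst.
exists (W `&` [set b | D b != 0]), X, Y; split.
- by split => // b [/WOm].
- exact: smooth_sub sX.
- exact: smooth_sub sY.
move=> b [Wb Db]; have [_ _ Pc _ _] := XYP _ Wb.
have DE : e2 b * e2 a - (- e1 b) * e1 a = D b by rewrite mulNr opprK.
have PX : is_section W P X by split=> // c Wc; have [_ _ + _ _] := XYP _ Wc; apply.
have PY : is_section W P Y by split=> // c Wc; have [_ _ + _ _] := XYP _ Wc; apply.
have := bracket_modulo s1 s2 XYP oW (@subset_refl _ W) PX PY Wb erefl erefl.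
rewrite DE -/Z => Pr.
have brE : bracket X Y b = D b *: Z b + (bracket X Y b - D b *: Z b).
  by rewrite addrC subrK.
have sgb (K : J1 -> J1) : is_section W P K ->
    sg (K b) (bracket X Y b) = D b * sg (K b) (Z b).
  move=> [_ PK]; rewrite brE sgDr sgZr (basis_orth (XYP _ Wb) (PK _ Wb) Pr).
  by rewrite addr0.
split.
- by have := basis_change (XYP _ Wb) (c1 := e2 b) (d1 := - e1 b) (c2 := e1 a) (d2 := e2 a); rewrite DE; apply.
- rewrite (sgb X PX) /X sgDl !sgZl -/(e1 b) -/(e2 b).
  by rewrite [e2 b * _]mulrC mulNr subrr mulr0.
- rewrite (sgb Y PY) /Y sgDl !sgZl -/(e1 b) -/(e2 b).
  have -> : e1 a * e1 b + e2 a * e2 b = D b.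
    by rewrite addrC (mulrC (e2 a)) (mulrC (e1 a)).
  exact: (mulf_neq0 Db Db).
Qed.

Section Adapted.
Variables (W : set J1) (X Y : J1 -> J1).
Hypothesis oW : open W.
Hypothesis WOm : W `<=` Om.
Hypothesis sX : smooth W X.
Hypothesis sY : smooth W Y.
Hypothesis adapted : forall b, W b -> [/\ lagrangian_basis b (P b) (X b) (Y b),
        sg (X b) (bracket X Y b) = 0 & sg (Y b) (bracket X Y b) != 0].

Let Z := bracket X Y.
Let T := bracket Y Z.
Let XYP b : W b -> lagrangian_basis b (P b) (X b) (Y b).
Proof. by case/adapted. Qed.
Let sZ : smooth W Z. Proof. exact: smooth_bracket. Qed.
Let sT : smooth W T. Proof. exact: smooth_bracket. Qed.
Let PX b : W b -> P b (X b). Proof. by move/XYP/basis_l. Qed.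
Let PY b : W b -> P b (Y b). Proof. by move/XYP/basis_r. Qed.
Let cX b : W b -> contact b (X b).
Proof. by move=> Wb; exact: (basis_contact (XYP Wb) (PX Wb)). Qed.
Let cY b : W b -> contact b (Y b).
Proof. by move=> Wb; exact: (basis_contact (XYP Wb) (PY Wb)). Qed.
Lemma adapted_bracket_contact b : W b -> contact b (bracket X Y b).
Proof. by move=> Wb; apply: (frame_bracket_contact XYP oW). Qed.
Let cZ b : W b -> contact b (Z b) := @adapted_bracket_contact b.
Let XZ b : W b -> sg (X b) (Z b) = 0. Proof. by case/adapted. Qed.
Let YZ b : W b -> sg (Y b) (Z b) != 0. Proof. by case/adapted. Qed.

Lemma adapted_neq0 b : W b -> X b != 0.
Proof.
move=> Wb; apply/eqP => X0; have [ind _ _ _ _] := XYP Wb.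
have [] := ind 1 0; first by rewrite X0 scaler0 scale0r addr0.
by move/eqP; rewrite oner_eq0.
Qed.

Lemma adapted_decomposition b v : W b -> contact b v -> sg (X b) v = 0 ->
  exists2 p, P b p & v = (sg (Y b) v / sg (Y b) (Z b)) *: Z b + p.
Proof.
move=> Wb cv sv; exists (v - (sg (Y b) v / sg (Y b) (Z b)) *: Z b); last by rewrite addrC subrK.
have [_ _ _ _ /(_ (v - (sg (Y b) v / sg (Y b) (Z b)) *: Z b))[|_]] := XYP Wb.
  by rewrite addrC -scaleNr; apply: contact_comb => //; exact: cZ.
apply; rewrite -scaleNr !sgDr !sgZr sv XZ// mulr0 addr0; split => //.
by rewrite mulNr divfK ?subrr// YZ.
Qed.

(** Both sides contain the plane and the bracket [Z], and these exhaust a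
    hyperplane of the contact space. *)
Lemma derived_orth b v : W b ->
  derived P b v <-> contact b v /\ sg (X b) v = 0.
Proof.
move=> Wb; split=> [|[cv sv]].
  apply: (derived_value (Q := fun v => contact b v /\ sg (X b) v = 0) oW sX sY XYP Wb) =>
    [|c u w [cu su] [cw sw]|u Pu|].
  - by split; [exact: contact0|rewrite -pairing_flat pairing0r].
  - by split; [exact: contact_comb|rewrite sgDr sgZr su sw mulr0 addr0].
  - by split; [exact: (basis_contact (XYP Wb) Pu)|exact: (basis_orth (XYP Wb) (PX Wb) Pu)].
  - by split; [exact: cZ|exact: XZ].
have [p Pp ->] := adapted_decomposition Wb cv sv.
apply: linspan_comb; last by left.
by right; exists W, X, Y; split.
Qed.

Let sec_X : is_section W (derived P) X.
Proof. by split=> // b Wb; apply/(derived_orth _ Wb); split; [exact: cX|exact: sgxx]. Qed.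
Let sec_Y : is_section W (derived P) Y.
Proof.
split=> // b Wb; apply/(derived_orth _ Wb); split; first exact: cY.
exact: (basis_orth (XYP Wb) (PX Wb) (PY Wb)).
Qed.
Let sec_Z : is_section W (derived P) Z.
Proof. by split=> // b Wb; apply/(derived_orth _ Wb); split; [exact: cZ|exact: XZ]. Qed.

Let UT b : W b -> pairing (U b) (T b) = - sg (Y b) (Z b).
Proof. by move=> Wb; exact: (pairing_U_bracket oW sY sZ Wb cY cZ). Qed.

(** The multiple of the contact form is the one that makes the form vanish on
    the bracket of the second field of the frame with the bracket of the frame. *)
Definition annihilator b : J1 :=
  flat (X b) + (sg (X b) (T b) / sg (Y b) (Z b)) *: U b.

Lemma smooth_annihilator : smooth W annihilator.
Proof.
apply: smooth_add => //; first exact: smooth_flat.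
apply: smooth_scale => //; last exact: smooth_U.
apply: smoothM => //; first exact: smooth_sg.
by apply: smoothV => //; exact: smooth_sg.
Qed.

Lemma annihilator_contact b v : contact b v -> pairing (annihilator b) v = sg (X b) v.
Proof.
by move=> cv; rewrite pairingDl pairingZl pairing_flat [pairing (U b) v]cv mulr0 addr0.
Qed.

Lemma annihilator_neq0 b : W b -> annihilator b != 0.
Proof.
move=> Wb; have [w cw] := sg_nondegenerate (cX Wb) (adapted_neq0 Wb).
by apply: contraNneq => t0; rewrite -(annihilator_contact cw) t0 pairing0l.
Qed.

(** The kernel is spanned by [P'] and by the bracket [T] of two sections of [P'];
    as both sides have dimension 4 there is no room for more. *)
Lemma derived2_kernel b v : W b ->
  derived (derived P) b v <-> pairing (annihilator b) v = 0.
Proof.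
move=> Wb; have YZb := YZ Wb.
have ker u : pairing (annihilator b) u = 0 -> derived (derived P) b u.
  move=> tu; pose k := pairing (U b) u / sg (Y b) (Z b).
  have cw : contact b (k *: T b + u).
    by rewrite /contact/= pairingDr pairingZr UT// mulrN divfK// addNr.
  have tT : pairing (annihilator b) (T b) = 0.
    by rewrite pairingDl pairingZl pairing_flat UT// mulrN divfK// subrr.
  have P'w : derived P b (k *: T b + u).
    apply/(derived_orth _ Wb); split => //.
    by rewrite -annihilator_contact// pairingDr pairingZr tT tu mulr0 addr0.
  rewrite (_ : u = (- k) *: T b + (k *: T b + u)); last by rewrite scaleNr addKr.
  apply: linspan_comb; last by left.
  by right; exists W, Y, Z; split.
split=> [Pv|/ker//]; apply: contrapT => /eqP tv.
have d4 := rank'' (WOm Wb).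
(* otherwise the second derived distribution would be the whole tangent space *)
have all u : derived (derived P) b u.
  rewrite (_ : u = (pairing (annihilator b) u / pairing (annihilator b) v) *: v
    + (u - (pairing (annihilator b) u / pairing (annihilator b) v) *: v)); last first.
    by rewrite addrC subrK.
  apply: (has_dim_lin _ d4 Pv); apply: ker.
  by rewrite pairingBr pairingZr divfK ?subrr.
case: d4 => S d E; have : (fullv <= S)%VS.
  by apply/subvP => u _; have := all u; rewrite E.
by move/dimvS; rewrite d dimvf dim_matrix.
Qed.

Let XXZ b : W b -> contact b (bracket X Z b) /\ sg (X b) (bracket X Z b) = 0.
Proof.
move=> Wb.
have cc : contact b (bracket X Z b).
  by rewrite /contact/= (pairing_U_bracket oW sX sZ Wb cX cZ) XZ// oppr0.
split=> //; rewrite -annihilator_contact//; apply/(derived2_kernel _ Wb).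
by apply: sub_linspan; right; exists W, X, Z; split.
Qed.

(* a form that vanishes on the frame and its bracket vanishes on the hyperplane of
   the contact distribution orthogonal to the first field *)
Let kill be b v : W b -> pairing be (X b) = 0 -> pairing be (Y b) = 0 ->
  pairing be (Z b) = 0 -> contact b v -> sg (X b) v = 0 -> pairing be v = 0.
Proof.
move=> Wb bX bY bZ cv sv; have [p Pp ->] := adapted_decomposition Wb cv sv.
have [_ _ _ /(_ p Pp)[c [d ->]] _] := XYP Wb.
by rewrite !pairingDr !pairingZr bX bY bZ !mulr0 !addr0.
Qed.

(** The second derived distribution meets the contact distribution in [P'], so the
    bracket of [X] with a section of [P'] stays in [P'], and the successive Lie
    derivatives of [U] all vanish there. *)
Lemma adapted_type2 : has_type W X 2.
Proof.
split => // [b Wb|b Wb]; first exact: adapted_neq0.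
pose L1 := lie_form X U; pose L2 := lie_form X L1; pose L3 := lie_form X L2.
have sL1 : smooth W L1 by apply: smooth_lie => //; exact: smooth_U.
have sL2 : smooth W L2 by exact: smooth_lie.
have L1E c : W c -> L1 c = flat (X c) by move=> Wc; exact: lie_U oW sX cX Wc.
have L1k c v : W c -> sg (X c) v = 0 -> pairing (L1 c) v = 0.
  by move=> Wc; rewrite L1E// pairing_flat.
have XY c : W c -> sg (X c) (Y c) = 0.
  by move=> Wc; exact: (basis_orth (XYP Wc) (PX Wc) (PY Wc)).
have L2k c v : W c -> contact c v -> sg (X c) v = 0 -> pairing (L2 c) v = 0.
  move=> Wc; apply: kill => //.
  - rewrite (pairing_lie0 _ oW sL1 sX Wc); last by move=> d Wd; rewrite L1k// sgxx.
    by rewrite bracketxx pairing0r oppr0.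
  - rewrite (pairing_lie0 _ oW sL1 sY Wc); last by move=> d Wd; rewrite L1k// XY.
    by rewrite L1k ?oppr0// XZ.
  - rewrite (pairing_lie0 _ oW sL1 sZ Wc); last by move=> d Wd; rewrite L1k// XZ.
    by rewrite L1k ?oppr0//; have [] := XXZ Wc.
have L3k c v : W c -> contact c v -> sg (X c) v = 0 -> pairing (L3 c) v = 0.
  move=> Wc; apply: kill => //.
  - rewrite (pairing_lie0 _ oW sL2 sX Wc).
      by rewrite bracketxx pairing0r oppr0.
    by move=> d Wd; rewrite L2k ?sgxx//; exact: cX.
  - rewrite (pairing_lie0 _ oW sL2 sY Wc).
      by rewrite L2k ?oppr0//; [exact: cZ|exact: XZ].
    by move=> d Wd; rewrite L2k ?XY//; exact: cY.
  - rewrite (pairing_lie0 _ oW sL2 sZ Wc).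
      by rewrite L2k ?oppr0//; have [] := XXZ Wc.
    by move=> d Wd; rewrite L2k ?XZ//; exact: cZ.
rewrite (_ : [seq _ | m <- iota 0 4] = [:: U b; L1 b; L2 b; L3 b])//.
have fr := free_U_flat (cX Wb) (adapted_neq0 Wb).
have -> : (<<[:: U b; L1 b; L2 b; L3 b]>> = <<[:: U b; flat (X b)]>>)%VS.
  apply/eqP; rewrite eqEsubv; apply/andP; split; apply/span_subvP => u; rewrite !inE.
    case/or4P => /eqP ->.
    - by rewrite memv_span// !inE eqxx.
    - by rewrite L1E// memv_span// !inE eqxx orbT.
    - by apply: (span_U_flat (cX Wb) (adapted_neq0 Wb)) => v; exact: L2k.
    - by apply: (span_U_flat (cX Wb) (adapted_neq0 Wb)) => v; exact: L3k.
  by case/orP => /eqP ->; rewrite -?L1E// memv_span// !inE eqxx ?orbT.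
by move: fr; rewrite /free => /eqP.
Qed.

(** Type 2 forces [X'^2(U)] to be a combination of [U] and [flat X'], both of
    which vanish on [X]; but a component of [X'] along [Y] would make
    [X'^2(U)] nonzero on [X]. *)
Lemma type2_multiple V X' b : open V -> has_type V X' 2 ->
  (forall c, V c -> P c (X' c)) -> V b -> W b ->
  exists2 c, c != 0 & X' b = c *: X b.
Proof.
move=> oV [sX' X'0 cX' rk] PX' Vb Wb.
have o : open (V `&` W) by exact: openI.
have VW : V `&` W `<=` W by move=> c [].
have WV : V `&` W `<=` V by move=> c [].
have VWb : (V `&` W) b by [].
have sX'' : smooth (V `&` W) X' by exact: smooth_sub WV sX'.
have sXX : smooth (V `&` W) X by exact: smooth_sub VW sX.
have cX'' c : (V `&` W) c -> contact c (X' c) by move=> [Vc _]; exact: cX'.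
pose L1 := lie_form X' U; pose L2 := lie_form X' L1; pose L3 := lie_form X' L2.
have sL1 : smooth (V `&` W) L1 by apply: smooth_lie => //; exact: smooth_U.
have L1E c : (V `&` W) c -> L1 c = flat (X' c).
  by move=> VWc; exact: lie_U o sX'' cX'' VWc.
have orthX c : (V `&` W) c -> sg (X' c) (X c) = 0.
  by move=> [Vc Wc]; exact: (basis_orth (XYP Wc) (PX' _ Vc) (PX Wc)).
have L2in : L2 b \in span [:: U b; flat (X' b)].
  have := rk b Vb; rewrite (_ : [seq _ | m <- iota 0 4] = [:: U b; L1 b; L2 b; L3 b])// => d2.
  have fr := free_U_flat (cX' _ Vb) (X'0 _ Vb).
  have sub : (<<[:: U b; flat (X' b)]>> <= <<[:: U b; L1 b; L2 b; L3 b]>>)%VS.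
    apply/span_subvP => u; rewrite !inE.
    by case/orP => /eqP ->; rewrite -?L1E// memv_span// !inE eqxx ?orbT.
  have /eqP -> : <<[:: U b; flat (X' b)]>>%VS == <<[:: U b; L1 b; L2 b; L3 b]>>%VS.
    by move: fr; rewrite eqEdim sub d2 /free => /eqP ->.
  by rewrite memv_span// !inE eqxx ?orbT.
have := span_U_flat_kill L2in (cX Wb) (orthX b VWb).
rewrite (pairing_lie0 _ o sL1 sXX VWb) => [|c VWc]; last by rewrite L1E// pairing_flat orthX.
rewrite L1E// pairing_flat => /eqP; rewrite oppr_eq0 => /eqP sg0.
have PX'' : is_section (V `&` W) P X' by split=> // c [Vc _]; exact: PX'.
have PXX : is_section (V `&` W) P X by split=> // c [_ Wc]; exact: PX.
have [c [d X'E]] := section_value XYP VW PX'' VWb.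
have XE : X b = 1 *: X b + 0 *: Y b by rewrite scale1r scale0r addr0.
have := bracket_modulo sX sY XYP o VW PX'' PXX VWb X'E XE.
rewrite -/Z mulr0 mulr1 sub0r scaleNr opprK => Pr.
have := basis_orth (XYP Wb) (PX' _ Vb) Pr.
rewrite sgDr sg0 add0r sgZr X'E sgDl !sgZl XZ// mulr0 add0r mulrA => /eqP.
rewrite mulf_eq0 (negPf (YZ Wb)) orbF mulf_eq0 orbb => /eqP d0.
exists c; last by rewrite d0 scale0r addr0.
apply: contraNneq (X'0 _ Vb) => c0.
by rewrite X'E c0 d0 !scale0r addr0.
Qed.

Lemma orth_derived b : W b -> orth (derived P) b = [set v | v \in <[X b]>%VS].
Proof.
move=> Wb; apply/seteqP; split=> [v [cv ov]|v /vlineP[c ->]]; last first.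
  split; first exact/contactZ/cX.
  by move=> w /(derived_orth _ Wb)[_ sw]; rewrite dform_U sgZl sw mulr0.
have ov' w : derived P b w -> sg v w = 0 by move=> /ov; rewrite dform_U.
have Pv : P b v.
  have [_ _ _ _ /(_ v cv)[_]] := XYP Wb; apply.
  split; rewrite sgC ov' ?oppr0//; [have [_] := sec_X | have [_] := sec_Y]; exact.
have [_ _ _ /(_ v Pv)[c [d vE]] _] := XYP Wb.
have := ov' (Z b); rewrite vE sgDl !sgZl XZ// mulr0 add0r => dYZ.
have /eqP : d * sg (Y b) (Z b) = 0 by apply: dYZ; have [_] := sec_Z; exact.
rewrite mulf_eq0 (negPf (YZ Wb)) orbF => /eqP ->.
by rewrite scale0r addr0 /= memvZ// memv_line.
Qed.

End Adapted.

End LagrangianDistribution.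

(** * Intermediate integrals *)

Section IntermediateIntegrals.
Context {R : realType}.
Local Notation J1 := 'rV[R]_5.
Variables (N A B C D : J1 -> R) (Om : set J1).
Hypothesis oOm : open Om.
Hypothesis sma : monge_ampere Om N A B C D.
Hypothesis par : parabolic Om N A B C D.
Let omega := ma_form N A B C D.
Let P := characteristic omega.
Hypothesis rank' : constant_rank Om (derived P).
Hypothesis rank'' : forall a, Om a -> has_dim (derived (derived P) a) 4.

Let adapted_at a : Om a -> exists (W : set J1) (X Y : J1 -> J1),
  [/\ [/\ open W, W a & W `<=` Om], smooth W X, smooth W Y &
      forall b, W b -> [/\ lagrangian_basis b (P b) (X b) (Y b),
        sg (X b) (bracket X Y b) = 0 & sg (Y b) (bracket X Y b) != 0]].
Proof. exact: (adapted_frame oOm (characteristic_frame oOm sma par) rank' rank''). Qed.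

Lemma ma_form_comb b c d v w x y : omega b (c *: v + w) (d *: x + y) =
  c * d * omega b v x + c * omega b v y + d * omega b w x + omega b w y.
Proof. by rewrite /omega !omegaE !mxE; ring. Qed.

Lemma ma_form_anti b v w : omega b v w = - omega b w v.
Proof. by rewrite /omega !omegaE; ring. Qed.

Lemma ma_form_alt b v : omega b v v = 0.
Proof. by rewrite /omega omegaE; ring. Qed.

Section AdaptedIntegral.
Variables (W : set J1) (X Y : J1 -> J1).
Hypothesis oW : open W.
Hypothesis WOm : W `<=` Om.
Hypothesis sX : smooth W X.
Hypothesis sY : smooth W Y.
Hypothesis adapted : forall b, W b -> [/\ lagrangian_basis b (P b) (X b) (Y b),
        sg (X b) (bracket X Y b) = 0 & sg (Y b) (bracket X Y b) != 0].

(** The hyperplane of the contact distribution orthogonal to [X] contains the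
    characteristic plane, which is in the kernel of [omega], as a hyperplane; and an alternating form on a line is zero. *)
Lemma ma_form_orth b v w : W b -> contact b v -> contact b w ->
  sg (X b) v = 0 -> sg (X b) w = 0 -> omega b v w = 0.
Proof.
move=> Wb cv cw sv sw.
have [p [cp Pp] ->] := adapted_decomposition oW sX sY adapted Wb cv sv.
have [q [cq Pq] ->] := adapted_decomposition oW sX sY adapted Wb cw sw.
set Z := bracket X Y b.
have cZ : contact b Z by exact: (adapted_bracket_contact oW sX sY adapted Wb).
rewrite ma_form_comb ma_form_alt (Pp q cq) (Pp Z cZ) (ma_form_anti b Z q) (Pq Z cZ).
by rewrite !mulr0 oppr0 mulr0 !addr0.
Qed.

Variables (W' : set J1) (f h : J1 -> R).
Hypothesis oW' : open W'.
Hypothesis W'W : W' `<=` W.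
Hypothesis sf : smooth W' f.
Hypothesis sh : smooth W' h.
Hypothesis thetaE : forall b, W' b -> h b != 0 /\ annihilator X Y b = h b *: dfun f b.

Let dfE b v : W' b -> pairing (dfun f b) v = (h b)^-1 * pairing (annihilator X Y b) v.
Proof.
by move=> /thetaE[h0 ->]; rewrite pairingZl mulKf.
Qed.

(** The surface is tangent to the level sets of [f], so its tangent vectors are
    contact vectors orthogonal to [X]. *)
Lemma integral_of_annihilator : intermediate_integral omega W' f.
Proof.
have cX b : W' b -> contact b (X b).
  by move/W'W/adapted => [H _ _]; exact: (basis_contact H (basis_l H)).
split => // [b Wb|k S phi [oS sphi VS _ cphi] fk s i j Ss].
  have [h0 _] := thetaE Wb.
  have [w cw sw] := sg_nondegenerate (cX b Wb) (adapted_neq0 adapted (W'W Wb)).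
  apply/freeP => k; rewrite big_ord_recl big_ord1 /= => H.
  have k0 : k ord0 = 0.
    have := congr1 (fun u => pairing u w) H.
    rewrite pairingDl !pairingZl pairing0l (dfE _ Wb) (annihilator_contact _ _ cw).
    rewrite [pairing (U b) w]cw mulr0 addr0 => /eqP.
    by rewrite !mulf_eq0 invr_eq0 (negPf h0) (negPf sw) !orbF => /eqP.
  have k1 : k (lift ord0 ord0) = 0.
    move: H; rewrite k0 scale0r add0r => /eqP.
    by rewrite scaler_eq0 (negPf (U_neq0 b)) orbF => /eqP.
  move=> [[|[|//]] Hi]; first by rewrite -k0; congr k; exact: val_inj.
  by rewrite -k1; congr k; exact: val_inj.
have Ws := VS s Ss; have [h0 E] := thetaE Ws.
have df0 l : pairing (dfun f (phi s)) (partial l phi s) = 0.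
  have dphi : derivable phi s (delta_mx 0 l) by have [H _] := sphi 1%N l; exact: H.
  have := partial_eq l oS Ss fk; rewrite [RHS]derive_cst.
  rewrite (partial_comp oW' (sf 1) Ws dphi) => e; rewrite -[RHS]e.
  by apply: eq_bigr => m _; rewrite mxE mulrC partial_mx.
have sg0 l : sg (X (phi s)) (partial l phi s) = 0.
  by rewrite -(annihilator_contact X Y (cphi s l Ss)) E pairingZl df0 mulr0.
apply: ma_form_orth => //; [exact: W'W|exact: cphi|exact: cphi].
Qed.

Lemma hamiltonian_of_annihilator : is_hamiltonian W' f (fun b => (h b)^-1 *: X b).
Proof.
have sh' : smooth W' (fun b => (h b)^-1) by apply: smoothV => // b /thetaE[].
split.
- apply: smooth_scale => //; exact: smooth_sub W'W sX.
- move=> b /W'W/adapted[H _ _].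
  exact: contactZ (basis_contact H (basis_l H)).
(* [flat X] has no component along [dz] and [U] has component 1, so this
   component of [df] is the multiple of [U] that it contains *)
exists (fun b => - dfun f b 0 jz).
  by apply: smoothN => //; apply: smooth_comp_coord => //; exact: smooth_dfun.
move=> b Wb v; have [h0 _] := thetaE Wb.
have dfz : dfun f b 0 jz = (h b)^-1 * annihilator X Y b 0 jz.
  by rewrite -!(pairing_delta jz) pairingC dfE// [in RHS]pairingC.
rewrite dform_U sgZl dfE// dfz -mulrN -mulrA -mulrDr; congr (_ * _).
have -> : annihilator X Y b 0 jz = sg (X b) (bracket Y (bracket X Y) b) / sg (Y b) (bracket X Y b).
  rewrite /annihilator mxE; have [_ _ -> _ _] := flatE (X b).
  by rewrite mxE; have [_ _ -> _ _] := UE b; rewrite add0r mulr1.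
by rewrite /annihilator pairingDl pairingZl pairing_flat mulNr addrK.
Qed.

End AdaptedIntegral.

Lemma nonholonomic_integral_unique V X Y : open V -> V `<=` Om ->
  nonholonomic_integral omega V X -> nonholonomic_integral omega V Y ->
  exists g : J1 -> R, [/\ smooth V g, forall a, V a -> g a != 0 &
    forall a, V a -> Y a = g a *: X a].
Proof.
move=> oV VOm [tX PX] [tY PY]; have [sX X0 _ _] := tX; have [sY Y0 _ _] := tY.
(* the factor exists pointwise; this expression of it is smooth *)
pose g b := pairing (Y b) (X b) * (pairing (X b) (X b))^-1.
have key a : V a -> g a != 0 /\ Y a = g a *: X a.
  move=> Va; have [W [X1 [Y1 [[oW Wa WOm] sX1 sY1 ad]]]] := adapted_at (VOm _ Va).
  have [c c0 XE] := type2_multiple oW sX1 sY1 ad oV tX PX Va Wa.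
  have [d d0 YE] := type2_multiple oW sX1 sY1 ad oV tY PY Va Wa.
  have YX : Y a = (d / c) *: X a by rewrite XE scalerA divfK.
  have gE : g a = d / c.
    by rewrite /g YX pairingZl mulfK// pairing_self_neq0// X0.
  by rewrite gE; split=> //; rewrite mulf_neq0// invr_neq0.
exists g; split=> [|a /key[]|a /key[]]//.
apply: (smoothM oV (smooth_pairing oV sY sX)); apply: smoothV => //.
  by move=> b Vb; rewrite pairing_self_neq0// X0.
exact: smooth_pairing.
Qed.

Lemma spans_orth_derived V X : open V -> V `<=` Om ->
  nonholonomic_integral omega V X -> spans V X (orth (derived P)).
Proof.
move=> oV VOm [tX PX] a Va.
have [W [X1 [Y1 [[oW Wa WOm] sX1 sY1 ad]]]] := adapted_at (VOm _ Va).
have [c c0 XE] := type2_multiple oW sX1 sY1 ad oV tX PX Va Wa.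
rewrite (orth_derived oW sX1 sY1 ad Wa); apply/seteqP; split=> v /=; last first.
  by rewrite XE => /vlineP[k ->]; rewrite scalerA memvZ// memv_line.
move=> /vlineP[k ->]; rewrite (_ : k *: X1 a = (k / c) *: X a) ?memvZ ?memv_line//.
by rewrite XE scalerA divfK.
Qed.

Lemma classical_of_involutive V X : open V -> V `<=` Om ->
  nonholonomic_integral omega V X -> is_involutive V (derived (derived P)) ->
  classical_integral omega V X.
Proof.
move=> oV VOm nX inv a Va.
have [W [X1 [Y1 [[oW Wa WOm] sX1 sY1 ad]]]] := adapted_at (VOm _ Va).
have o : open (V `&` W) by exact: openI.
have VWW : V `&` W `<=` W by move=> b [].
have ker b v : W b -> derived (derived P) b v <-> pairing (annihilator X1 Y1 b) v = 0.
  exact: (derived2_kernel rank'' oW WOm sX1 sY1 ad).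
have [||||W' [f [h [[oW' W'a W'VW] sf sh fE]]]] :=
    @frobenius_hyperplane R 4 (V `&` W) (annihilator X1 Y1) a o.
- by [].
- exact: smooth_sub VWW (smooth_annihilator oW sX1 sY1 ad).
- exact: (annihilator_neq0 ad Wa).
- move=> W2 S T oW2 W2V [sS kS] [sT kT] b W2b.
  have [Vb Wb] := W2V _ W2b; apply/(ker _ _ Wb).
  apply: (inv W2) => //; first by move=> c /W2V[].
    by split=> // c W2c; have [_ Wc] := W2V _ W2c; apply/(ker _ _ Wc); exact: kS.
  by split=> // c W2c; have [_ Wc] := W2V _ W2c; apply/(ker _ _ Wc); exact: kT.
have W'W : W' `<=` W by move=> b /W'VW[].
have W'V : W' `<=` V by move=> b /W'VW[].
have [tX PX] := nX; have [sX X0 cX rX] := tX.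
have nX' : nonholonomic_integral omega W' X.
  split; last by move=> b /W'V; exact: PX.
  split; [exact: smooth_sub W'V sX|move=> b /W'V; exact: X0|move=> b /W'V; exact: cX|].
  by move=> b /W'V; exact: rX.
have nX1 : nonholonomic_integral omega W' X1.
  have [s1 s2 s3 s4] := adapted_type2 rank'' oW WOm sX1 sY1 ad.
  split; last by move=> b /W'W/ad[H _ _]; exact: basis_l H.
  split; [exact: smooth_sub W'W s1|move=> b /W'W; exact: s2|move=> b /W'W; exact: s3|].
  by move=> b /W'W; exact: s4.
have W'Om : W' `<=` Om by move=> b /W'W/WOm.
have [g [sg_ g0 XE]] := nonholonomic_integral_unique oW' W'Om nX1 nX'.
exists W', f, (fun b => (h b)^-1 *: X1 b), (fun b => g b * h b); split => //.
- exact: (integral_of_annihilator oW sX1 sY1 ad oW' W'W sf fE).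
- exact: (hamiltonian_of_annihilator sX1 ad oW' W'W sf sh fE).
- exact: smoothM.
- by move=> b W'b; have [h0 _] := fE b W'b; rewrite scalerA mulfK// XE.
Qed.

(** The differential of a classical integral kills the derived distribution, hence
    its brackets; so the second derived distribution is the kernel of an exact
    form. *)
Lemma involutive_of_classical V X : open V -> V `<=` Om ->
  nonholonomic_integral omega V X -> classical_integral omega V X ->
  is_involutive V (derived (derived P)).
Proof.
move=> oV VOm [tX PX] cl W2 S T oW2 W2V [sS PS] [sT PT] b W2b.
have Vb := W2V _ W2b; have [_ X0 _ _] := tX.
have [W' [f [Xf [g [[oW' W'b W'V] [sf fr _] [_ _ [lam _ ham]] _ XE]]]]] := cl b Vb.
have [W [X1 [Y1 [[oW Wb WOm] sX1 sY1 ad]]]] := adapted_at (VOm _ Vb).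
have ker c v : W c -> derived (derived P) c v <-> pairing (annihilator X1 Y1 c) v = 0.
  exact: (derived2_kernel rank'' oW WOm sX1 sY1 ad).
have df1 c v : W' c -> W c -> derived P c v -> pairing (dfun f c) v = 0.
  move=> W'c Wc /(derived_orth oW sX1 sY1 ad _ Wc)[cv sv].
  have [k k0 XE1] := type2_multiple oW sX1 sY1 ad oV tX PX (W'V _ W'c) Wc.
  have /eqP : g c * sg (Xf c) v = 0 by rewrite -sgZl -XE// XE1 sgZl sv mulr0.
  rewrite mulf_eq0 => /orP[/eqP g0|/eqP].
    by have := X0 _ (W'V _ W'c); rewrite XE// g0 scale0r eqxx.
  by rewrite -(dform_U c) (ham _ W'c) [pairing (U c) v]cv mulr0 addr0.
have df2 c v : W' c -> W c -> derived (derived P) c v -> pairing (dfun f c) v = 0.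
  move=> W'c Wc; apply: (linspan_ind (Q := fun v => pairing (dfun f c) v = 0)) => [|k u w du dw|u].
  - exact: pairing0r.
  - by rewrite pairingDr pairingZr du dw mulr0 addr0.
  move=> [/(df1 _ _ W'c Wc)//|[V1 [S1 [T1 [oV1 V1c [sS1 PS1] [sT1 PT1] ->]]]]].
  have sub : V1 `&` (W' `&` W) `<=` V1 by move=> d [].
  have sub' : V1 `&` (W' `&` W) `<=` W' by move=> d [_ []].
  have oVW : open (V1 `&` (W' `&` W)) by do 2!apply: openI => //.
  apply: (bracket_kernel oVW) => //.
  - exact: smooth_sub sub' sf.
  - exact: smooth_sub sub sS1.
  - exact: smooth_sub sub sT1.
  - by move=> d [V1d [W'd Wd]]; apply: df1 => //; exact: PS1.
  - by move=> d [V1d [W'd Wd]]; apply: df1 => //; exact: PT1.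
have [k fE] : exists k, dfun f b = k *: annihilator X1 Y1 b.
  apply: pairing_ker_sub; first exact: (annihilator_neq0 ad Wb).
  by move=> v /(ker _ _ Wb); exact: df2.
have k0 : k != 0.
  apply/eqP => k0; have := free_not0 (fr b W'b) (mem_head _ _).
  by rewrite fE k0 scale0r eqxx.
apply/(ker _ _ Wb)/eqP; rewrite -(inj_eq (mulfI k0)) mulr0 -pairingZl -fE; apply/eqP.
have sub : W2 `&` (W' `&` W) `<=` W2 by move=> d [].
have sub' : W2 `&` (W' `&` W) `<=` W' by move=> d [_ []].
have oVW : open (W2 `&` (W' `&` W)) by do 2!apply: openI => //.
apply: (bracket_kernel oVW) => //.
- exact: smooth_sub sub' sf.
- exact: smooth_sub sub sS.
- exact: smooth_sub sub sT.
- by move=> d [W2d [W'd Wd]]; apply: df2 => //; exact: PS.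
- by move=> d [W2d [W'd Wd]]; apply: df2 => //; exact: PT.
Qed.

Lemma nonholonomic_integral_exists a : Om a -> exists (V : set J1) (X : J1 -> J1),
  [/\ open V, V a, V `<=` Om & nonholonomic_integral omega V X].
Proof.
move=> Oa; have [W [X1 [Y1 [[oW Wa WOm] sX1 sY1 ad]]]] := adapted_at Oa.
exists W, X1; split => //; split; first exact: (adapted_type2 rank'' oW WOm sX1 sY1 ad).
by move=> b /ad[H _ _]; exact: basis_l H.
Qed.

End IntermediateIntegrals.

Theorem theorem4p6 (R : realType) (Omega : set 'rV[R]_5)
    (N A B C D : 'rV[R]_5 -> R) :
  open Omega ->
  monge_ampere Omega N A B C D ->
  parabolic Omega N A B C D ->
  let omega := ma_form N A B C D in
  let P := characteristic omega in
  let P' := derived P in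
  let P'' := derived P' in
  constant_rank Omega P ->
  constant_rank Omega P' ->
  (forall a, Omega a -> has_dim (P'' a) 4) ->
  [/\ forall a, Omega a -> exists (V : set 'rV[R]_5) (X : 'rV[R]_5 -> 'rV[R]_5),
        [/\ open V, V a, V `<=` Omega & nonholonomic_integral omega V X],
      forall (V : set 'rV[R]_5) (X Y : 'rV[R]_5 -> 'rV[R]_5),
        open V -> V `<=` Omega ->
        nonholonomic_integral omega V X -> nonholonomic_integral omega V Y ->
        exists g : 'rV[R]_5 -> R,
          [/\ smooth V g,
              forall a, V a -> g a != 0 &
              forall a, V a -> Y a = g a *: X a],
      forall (V : set 'rV[R]_5) (X : 'rV[R]_5 -> 'rV[R]_5),
        open V -> V `<=` Omega -> nonholonomic_integral omega V X ->
        spans V X (orth P') &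
      forall (V : set 'rV[R]_5) (X : 'rV[R]_5 -> 'rV[R]_5),
        open V -> V `<=` Omega -> nonholonomic_integral omega V X ->
        (is_involutive V P'' -> classical_integral omega V X) /\
        (~ is_involutive V P'' -> ~ classical_integral omega V X)].
Proof.
move=> oOm sma par omega P P' P'' _ rank' rank''; split.
- exact: (nonholonomic_integral_exists oOm sma par rank' rank'').
- exact: (nonholonomic_integral_unique oOm sma par rank' rank'').
- exact: (spans_orth_derived oOm sma par rank' rank'').
- move=> V X oV VOm nX; split.
    exact: (classical_of_involutive oOm sma par rank' rank'' oV VOm nX).
  by move=> ni cl; apply/ni/(involutive_of_classical oOm sma par rank' rank'' oV VOm nX cl).
Qed.
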